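(* For each cardinal $\kappa\le\mathfrak{c}$, the remainder $E_\kappa^*=\beta E_\kappa\setminus E_\kappa$ of the space $E_\kappa=\omega\times E(2^\kappa)$ is Cohen-Parovičenko if and only if $\mathbb{N}^*=\beta\mathbb{N}\setminus\mathbb{N}$ is Cohen-Parovičenko.
   Context: $\mathfrak{c}=2^{\aleph_0}$; $2^\kappa$ is the Cantor cube of weight $\kappa$; $\omega$ is discrete. For a compact (Hausdorff) space $X$, $E(X)$ is its Gleason cover (absolute), i.e., the Stone space of the complete Boolean algebra of regular open subsets of $X$. A subalgebra $A$ of a Boolean algebra $B$ is \emph{$\aleph_0$-ideal} if for each $b\in B\setminus A$ the ideal $\{a\in A: a<b\}$ of $A$ has a countable cofinal subset. For an uncountable cardinal $\lambda$, $B$ is \emph{$(\lambda,\aleph_0)$-ideal} if there is a family $\mathcal{A}$ of $\aleph_0$-ideal subalgebras of $B$ of cardinality $\lambda$ such that every subset of $B$ of size $\lambda$ is contained in a member of $\mathcal{A}$ and $\mathcal{A}$ is closed under unions of chains of length at most $\lambda$ and of uncountable cofinality. $B$ is \emph{$( *,\aleph_0)$-ideal} if it is $(\lambda,\aleph_0)$-ideal for every regular uncountable $\lambda<|B|$. For subsets $S,T$ of a Boolean algebra, $S\perp T$ means $s\wedge t=0$ for all $s\in S$, $t\in T$. A subset $A$ of $B$ is \emph{$\aleph_0$-ideal complete} if for any two countable (possibly finite or empty) subsets $S,T$ of $A$ with $S\perp T$, and such that $1$ is not the join of a finite subset of $S\cup T$, there is $b\in B\setminus A$ such that $s\le b$ for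 all $s\in S$, $t\wedge b=0$ for all $t\in T$, every $a\in A$ with $a\le b$ lies below a finite join of elements of $S$, and every $a\in A$ with $a\wedge b=0$ lies below a finite join of elements of $T$. $\mathfrak{m}_c(B)$ is the minimum cardinality of a subset of $B$ that is not $\aleph_0$-ideal complete. A Boolean algebra $B$ is \emph{Cohen-Parovičenko} if it is $( *,\aleph_0)$-ideal and $\mathfrak{m}_c(B)=\mathfrak{c}$. A zero-dimensional space is \emph{Cohen-Parovičenko} if its algebra of clopen sets is. *)

(* Defs.v *)
From HB Require Import structures.
From mathcomp Require Import all_boot all_order all_algebra.
From mathcomp Require Import all_classical all_reals.
From mathcomp Require Import topology.

Set Implicit Arguments.
Unset Strict Implicit.
Unset Printing Implicit Defensive.

Import Order.TTheory GRing.Theory Num.Theory.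
Import numFieldTopology.Exports.

Local Open Scope classical_set_scope.
Local Open Scope card_scope.

Definition card_lt {T U : Type} (A : set T) (B : set U) : Prop :=
  ~~ (B #<= A).

Definition continuum : set (nat -> bool) := [set: nat -> bool].

(* [L] stands for its cardinality: it is regular when [L] is not the union of
   fewer than [L] sets, each smaller than [L]. *)
Definition regular_uncountable {T : Type} (L : set T) : Prop :=
  ~ countable L /\
  forall F : set (set T), card_lt F L -> (forall A, F A -> card_lt A L) ->
    \bigcup_(A in F) A <> L.

Definition has_countable_cofinal {T : Type} (le : T -> T -> Prop)
    (A : set T) : Prop :=
  exists C : set T, [/\ C `<=` A, countable C &
    forall a, A a -> exists2 c, C c & le a c].

Definition well_ordered_chain {T : Type} (C : set (set T)) : Prop :=
  forall D : set (set T), D `<=` C -> D !=set0 ->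
    exists2 X, D X & forall Y, D Y -> X `<=` Y.

(* The order type of the well-ordered chain [C] is at most the initial ordinal
   of the cardinal |L|: an ordinal is at most that initial ordinal iff all its
   proper initial segments have cardinality less than |L|. *)
Definition length_at_most {T U : Type} (C : set (set T)) (L : set U) : Prop :=
  forall X, C X -> card_lt [set Y | C Y /\ Y `<` X] L.

Section BooleanAlgebra.
Context {d : Order.disp_t} {B : ctbDistrLatticeType d}.
Implicit Types (A S T : set B) (a b s t : B).

Definition subalgebra A : Prop :=
  [/\ A \bot%O, A \top%O,
      forall a b, A a -> A b -> A (Order.meet a b),
      forall a b, A a -> A b -> A (Order.join a b) &
      forall a, A a -> A (Order.compl a)].

Definition aleph0_ideal_subalgebra A : Prop :=
  subalgebra A /\
  forall b, ~ A b ->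
    has_countable_cofinal (fun x y => (x <= y)%O) [set a | A a /\ (a < b)%O].

Definition disjoint_families S T : Prop :=
  forall s t, S s -> T t -> Order.meet s t = \bot%O.

Definition below_finite_join S a : Prop :=
  exists2 l : seq B, [set` l] `<=` S & (a <= \join_(x <- l) x)%O.

Definition aleph0_ideal_complete A : Prop :=
  forall S T, S `<=` A -> T `<=` A -> countable S -> countable T ->
    disjoint_families S T ->
    (forall l : seq B, [set` l] `<=` S `|` T ->
       (\join_(x <- l) x)%O <> \top%O) ->
    exists b,
      [/\ ~ A b,
          forall s, S s -> (s <= b)%O,
          forall t, T t -> Order.meet t b = \bot%O,
          forall a, A a -> (a <= b)%O -> below_finite_join S a &
          forall a, A a -> Order.meet a b = \bot%O -> below_finite_join T a].

End BooleanAlgebra.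

Section CohenParovicenkoAlgebra.
Context {d : Order.disp_t}.
Variable B : ctbDistrLatticeType d.

(* The cardinal lambda is given by a set [L] of that cardinality. *)
Definition lambda_aleph0_ideal {T : Type} (L : set T) : Prop :=
  exists F : set (set B),
    [/\ forall A, F A -> aleph0_ideal_subalgebra A /\ A #= L,
        forall X : set B, X #= L -> exists2 A, F A & X `<=` A &
        forall C : set (set B), C `<=` F -> well_ordered_chain C ->
          length_at_most C L ->
          ~ has_countable_cofinal (fun X Y => X `<=` Y) C ->
          F (\bigcup_(X in C) X)].

(* Every cardinal below |B| is the cardinality of a subset of [B]. *)
Definition star_aleph0_ideal : Prop :=
  forall L : set B, regular_uncountable L -> card_lt L [set: B] ->
    lambda_aleph0_ideal L.

(* m_c(B) = |C| *)
Definition mc_eq {T : Type} (C : set T) : Prop :=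
  (exists2 A : set B, ~ aleph0_ideal_complete A & A #= C) /\
  (forall A : set B, ~ aleph0_ideal_complete A -> C #<= A).

Definition cohen_parovicenko : Prop :=
  star_aleph0_ideal /\ mc_eq continuum.

End CohenParovicenkoAlgebra.

Fact clopen_display : Order.disp_t. Proof. exact: Order.Disp tt tt. Qed.
Fact regopen_display : Order.disp_t. Proof. exact: Order.Disp tt tt. Qed.

Definition clopens (X : topologicalType) : Type := set_type (@clopen X).

HB.instance Definition _ (X : topologicalType) :=
  Choice.copy (clopens X) (set_type (@clopen X)).

Section Clopens.
Variable X : topologicalType.
Implicit Types U V W : clopens X.

Definition mk_clopen (A : set X) (cA : clopen A) : clopens X :=
  exist _ A (mem_set cA).

Lemma clopens_clopen U : clopen (val U).
Proof. exact: set_mem (valP U). Qed.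

Definition clopen_le U V : bool := `[< val U `<=` val V >].
Definition clopen_meet U V : clopens X :=
  mk_clopen (clopenI (clopens_clopen U) (clopens_clopen V)).
Definition clopen_join U V : clopens X :=
  mk_clopen (clopenU (clopens_clopen U) (clopens_clopen V)).
Definition clopen_bot : clopens X := mk_clopen (@clopen0 X).
Definition clopen_top : clopens X := mk_clopen (@clopenT X).
Definition clopen_compl U : clopens X :=
  mk_clopen (clopenC set0 (clopens_clopen U)).
Definition clopen_diff U V : clopens X := clopen_meet U (clopen_compl V).

Lemma clopen_le_def U V : clopen_le U V = (clopen_meet U V == U).
Proof.
apply/asboolP/eqP => [/setIidPl UV|UV]; first exact: val_inj.
by apply/setIidPl; rewrite -[in RHS]UV.
Qed.

Lemma clopen_meetC : commutative clopen_meet.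
Proof. by move=> U V; apply: val_inj; exact: setIC. Qed.
Lemma clopen_joinC : commutative clopen_join.
Proof. by move=> U V; apply: val_inj; exact: setUC. Qed.
Lemma clopen_meetA : associative clopen_meet.
Proof. by move=> U V W; apply: val_inj; exact: setIA. Qed.
Lemma clopen_joinA : associative clopen_join.
Proof. by move=> U V W; apply: val_inj; exact: setUA. Qed.
Lemma clopen_joinKI V U : clopen_meet U (clopen_join U V) = U.
Proof. by apply: val_inj; rewrite /= setUC setKU. Qed.
Lemma clopen_meetKU V U : clopen_join U (clopen_meet U V) = U.
Proof. by apply: val_inj; rewrite /= setIC setKI. Qed.
Lemma clopen_meetUl : left_distributive clopen_meet clopen_join.
Proof. by move=> U V W; apply: val_inj; exact: setIUl. Qed.
Lemma clopen_meetxx : idempotent_op clopen_meet.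
Proof. by move=> U; apply: val_inj; exact: setIid. Qed.

HB.instance Definition _ :=
  Order.isMeetJoinDistrLattice.Build clopen_display (clopens X)
    clopen_le_def (fun _ _ => erefl) clopen_meetC clopen_joinC clopen_meetA
    clopen_joinA clopen_joinKI clopen_meetKU clopen_meetUl clopen_meetxx.

Lemma clopen_le0x U : (clopen_bot <= U)%O.
Proof. by apply/asboolP => x. Qed.
Lemma clopen_lex1 U : (U <= clopen_top)%O.
Proof. by apply/asboolP => x. Qed.

HB.instance Definition _ :=
  Order.hasBottom.Build clopen_display (clopens X) clopen_le0x.
HB.instance Definition _ :=
  Order.hasTop.Build clopen_display (clopens X) clopen_lex1.

Lemma clopen_diffKI U V : Order.meet V (clopen_diff U V) = \bot%O.
Proof. by apply: val_inj; rewrite /= setICA setICr setI0. Qed.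
Lemma clopen_joinIB U V : Order.join (Order.meet U V) (clopen_diff U V) = U.
Proof. by apply: val_inj; rewrite /= -setIUr setUCr setIT. Qed.

HB.instance Definition _ :=
  Order.BDistrLattice_hasSectionalComplement.Build
    clopen_display (clopens X) clopen_diffKI clopen_joinIB.

Lemma clopen_complE U : clopen_compl U = Order.diff (\top%O : clopens X) U.
Proof. by apply: val_inj; rewrite /= setTI. Qed.

HB.instance Definition _ :=
  Order.CBDistrLattice_hasComplement.Build
    clopen_display (clopens X) clopen_complE.

End Clopens.

Definition regopens (X : topologicalType) : Type := set_type (@regopen X).

HB.instance Definition _ (X : topologicalType) :=
  Choice.copy (regopens X) (set_type (@regopen X)).

Section Regopens.
Variable X : topologicalType.
Implicit Types (U V W : regopens X) (A C : set X).

Definition mk_regopen A (rA : regopen A) : regopens X :=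
  exist _ A (mem_set rA).

Lemma regopens_regopen U : regopen (val U).
Proof. exact: set_mem (valP U). Qed.

Lemma regopens_open U : open (val U).
Proof. by rewrite -(regopens_regopen U); exact: open_interior. Qed.

Lemma interior_closureI A C : open A -> open C ->
  (closure (A `&` C))° = (closure A)° `&` (closure C)°.
Proof.
move=> oA oC; apply/seteqP; split.
  by rewrite subsetI; split; apply: interiorS; apply: closureS => x [].
set W := _ `&` _; have oW : open W by apply: openI; exact: open_interior.
rewrite [X in X `<=` _](_ : W = W°); last exact/esym/interior_id.
apply: interiorS => x Wx N.
rewrite nbhsE => -[N' [oN' N'x] N'N].
have oNW : open (N' `&` W) by exact: openI.
have [y [Ay [N'y Wy]]] : A `&` (N' `&` W) !=set0.
  by case: (Wx) => /interior_subset + _; apply; exact: open_nbhs_nbhs.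
have oNWA : open (N' `&` W `&` A) by exact: openI.
have [z [Cz [[N'z Wz] Az]]] : C `&` (N' `&` W `&` A) !=set0.
  by case: (Wy) => _ /interior_subset; apply; exact: open_nbhs_nbhs.
by exists z; split => //; exact: N'N.
Qed.

Lemma closureU_ext A : closure (A `|` (~` A)°) = [set: X].
Proof.
rewrite closureU interiorC; apply/seteqP; split => // x _.
by have [Ax|nAx] := pselect (closure A x); [left|right; exact: subset_closure].
Qed.

Definition regopen_le U V : bool := `[< val U `<=` val V >].

Lemma regopen_meet_subproof U V : regopen (val U `&` val V).
Proof.
by rewrite /regopen interior_closureI ?regopens_regopen//; exact: regopens_open.
Qed.

Definition regopen_meet U V : regopens X :=
  mk_regopen (regopen_meet_subproof U V).
Definition regopen_join U V : regopens X :=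
  mk_regopen (interior_closure_idem (val U `|` val V)).

Lemma regopen_bot_subproof : regopen (@set0 X).
Proof. by rewrite /regopen closure0 interior0. Qed.
Lemma regopen_top_subproof : regopen [set: X].
Proof. by rewrite /regopen closureT interiorT. Qed.
Lemma regopen_compl_subproof U : regopen (~` val U)°.
Proof.
by apply: interior_closed_regopen; apply: open_closedC; exact: regopens_open.
Qed.

Definition regopen_bot : regopens X := mk_regopen regopen_bot_subproof.
Definition regopen_top : regopens X := mk_regopen regopen_top_subproof.
Definition regopen_compl U : regopens X :=
  mk_regopen (regopen_compl_subproof U).
Definition regopen_diff U V : regopens X := regopen_meet U (regopen_compl V).

Lemma regopen_le_def U V : regopen_le U V = (regopen_meet U V == U).
Proof.
apply/asboolP/eqP => [/setIidPl UV|UV]; first exact: val_inj.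
by apply/setIidPl; rewrite -[in RHS]UV.
Qed.

Lemma regopen_meetC : commutative regopen_meet.
Proof. by move=> U V; apply: val_inj; exact: setIC. Qed.
Lemma regopen_joinC : commutative regopen_join.
Proof. by move=> U V; apply: val_inj; rewrite /= setUC. Qed.
Lemma regopen_meetA : associative regopen_meet.
Proof. by move=> U V W; apply: val_inj; exact: setIA. Qed.

Lemma closure_interior_closureU A C : open A ->
  closure ((closure A)° `|` C) = closure (A `|` C).
Proof. by move=> oA; rewrite !closureU (closure_open_regclosed oA). Qed.

Lemma regopen_joinA : associative regopen_join.
Proof.
have oU U V : open (val U `|` val V) by apply: openU; exact: regopens_open.
move=> U V W; apply: val_inj => /=.
rewrite setUC !closure_interior_closureU; [|exact: oU..].
by rewrite [_ `|` val U]setUC setUA.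
Qed.

Lemma regopen_joinKI V U : regopen_meet U (regopen_join U V) = U.
Proof.
apply: val_inj => /=; apply/setIidPl.
rewrite -[X in X `<=` _](regopens_regopen U).
by apply: interiorS; apply: closureS; exact: subsetUl.
Qed.

Lemma regopen_meetKU V U : regopen_join U (regopen_meet U V) = U.
Proof. by apply: val_inj; rewrite /= setIC setKI; exact: regopens_regopen. Qed.

Lemma regopen_meetUl : left_distributive regopen_meet regopen_join.
Proof.
move=> U V W; apply: val_inj => /=.
rewrite -[in LHS](regopens_regopen W) -interior_closureI ?setIUl//.
- by apply: openU; exact: regopens_open.
- exact: regopens_open.
Qed.

Lemma regopen_meetxx : idempotent_op regopen_meet.
Proof. by move=> U; apply: val_inj; exact: setIid. Qed.

HB.instance Definition _ :=
  Order.isMeetJoinDistrLattice.Build regopen_display (regopens X)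
    regopen_le_def (fun _ _ => erefl) regopen_meetC regopen_joinC regopen_meetA
    regopen_joinA regopen_joinKI regopen_meetKU regopen_meetUl regopen_meetxx.

Lemma regopen_le0x U : (regopen_bot <= U)%O.
Proof. by apply/asboolP => x. Qed.
Lemma regopen_lex1 U : (U <= regopen_top)%O.
Proof. by apply/asboolP => x. Qed.

HB.instance Definition _ :=
  Order.hasBottom.Build regopen_display (regopens X) regopen_le0x.
HB.instance Definition _ :=
  Order.hasTop.Build regopen_display (regopens X) regopen_lex1.

Lemma regopen_diffKI U V : Order.meet V (regopen_diff U V) = \bot%O.
Proof.
apply: val_inj => /=; apply/seteqP; split => // x.
by case=> Vx [_ /interior_subset].
Qed.

Lemma regopen_joinIB U V : Order.join (Order.meet U V) (regopen_diff U V) = U.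
Proof.
have oV := regopens_open V; have oU := regopens_open U.
apply: val_inj; rewrite /= -setIUr interior_closureI//; last first.
  by apply: openU => //; exact: open_interior.
by rewrite closureU_ext interiorT setIT; exact: regopens_regopen.
Qed.

HB.instance Definition _ :=
  Order.BDistrLattice_hasSectionalComplement.Build
    regopen_display (regopens X) regopen_diffKI regopen_joinIB.

Lemma regopen_complE U : regopen_compl U = Order.diff (\top%O : regopens X) U.
Proof. by apply: val_inj; rewrite /= setTI. Qed.

HB.instance Definition _ :=
  Order.CBDistrLattice_hasComplement.Build
    regopen_display (regopens X) regopen_complE.

End Regopens.

Definition ultrafilter {d : Order.disp_t} {B : ctbDistrLatticeType d}
    (F : set B) : Prop :=
  [/\ F \top%O, ~ F \bot%O,
      forall a b, F a -> F b -> F (Order.meet a b),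
      forall a b, (a <= b)%O -> F a -> F b &
      forall a, F a \/ F (Order.compl a)].

Definition stone_space {d : Order.disp_t} (B : ctbDistrLatticeType d) : Type :=
  set_type (@ultrafilter d B).

HB.instance Definition _ (d : Order.disp_t) (B : ctbDistrLatticeType d) :=
  Choice.copy (stone_space B) (set_type (@ultrafilter d B)).

Section StoneSpace.
Context {d : Order.disp_t}.
Variable B : ctbDistrLatticeType d.

Definition stone_open (O : set (stone_space B)) : Prop :=
  forall F, O F -> exists2 b, val F b & [set G | val G b] `<=` O.

Lemma stone_openT : stone_open [set: stone_space B].
Proof. by move=> F _; exists \top%O => //; case: (set_mem (valP F)). Qed.

Lemma stone_openI : setI_closed stone_open.
Proof.
move=> O P oO oP F [/oO[a Fa aO] /oP[b Fb bP]]; exists (Order.meet a b).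
  by case: (set_mem (valP F)) => _ _ + _ _; apply.
move=> G /= Gab; case: (set_mem (valP G)) => _ _ _ upG _.
by split; [apply: aO|apply: bP] => /=; apply: upG Gab;
  [exact: leIl|exact: leIr].
Qed.

Lemma stone_open_bigcup (I : Type) (O : I -> set (stone_space B)) :
  (forall i, stone_open (O i)) -> stone_open (\bigcup_i O i).
Proof.
move=> oO F [i _ /oO[b Fb bO]]; exists b => // G /bO OG.
by exists i.
Qed.

HB.instance Definition _ :=
  isOpenTopological.Build (stone_space B)
    stone_openT stone_openI stone_open_bigcup.

End StoneSpace.

Definition gleason_cover (X : topologicalType) : topologicalType :=
  stone_space (regopens X).

Definition cantor_cube (K : Type) : topologicalType :=
  prod_topology (fun _ : K => bool).

Section StoneCech.
Local Open Scope ring_scope.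
Variables (R : realType) (X : topologicalType).

Definition unit_function : Type :=
  set_type [set f : X -> R | continuous f /\ forall x, 0 <= f x <= 1].

HB.instance Definition _ := Choice.on unit_function.

Definition stone_cech_cube : topologicalType :=
  prod_topology (fun _ : unit_function => R).

Definition stone_cech_map (x : X) : stone_cech_cube := fun f => val f x.

(* For Tychonoff [X], [stone_cech_map] is an embedding and [stone_cech], with
   the subspace topology, is the Stone-Cech compactification of [X]. *)
Definition stone_cech : set stone_cech_cube := closure (range stone_cech_map).

Definition stone_cech_remainder : topologicalType :=
  set_type (stone_cech `\` range stone_cech_map).

End StoneCech.

(* The library's [zero_dimensional] says that clopen sets separate points; for
   compact Hausdorff spaces this is the same as having a base of clopen sets. *)
Definition cohen_parovicenko_space (X : topologicalType) : Prop :=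
  zero_dimensional X /\ cohen_parovicenko (clopens X).

Definition E_space (K : Type) : topologicalType :=
  (nat * gleason_cover (cantor_cube K))%type.

(* Main.v *)
Require Import Defs.
From mathcomp Require Import all_boot all_order all_algebra.
From mathcomp Require Import all_classical all_reals topology normedtype.
From mathcomp Require wochoice.

(** Both remainders are compact and have enough clopen sets, and the algebra of
    clopen sets is a reduced power modulo the finite sets: for the natural
    numbers it is the power set modulo finite, P(omega)/fin, and for the sum of
    omega many copies of the Stone space of the complete algebra C of regular
    open sets of the cube it is C^omega modulo finite, since a clopen set of the
    sum is a sequence of elements of C ([remainder_reduced_power]). The theorem
    follows because every such reduced power is Cohen-Parovicenko if and only if
    P(omega)/fin is star-aleph_0-ideal and the dominating number is the continuum
    ([cohen_parovicenko_iff]), a condition which does not mention C. All that is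
    used about C is that it is not larger than a power set: the cube is separable
    because its weight is at most the continuum, hence countably many
    ultrafilters separate the elements of C and embed C in P(omega), and since C
    is complete this embedding has a monotone left inverse
    ([separable_power_set_retract]).

    The completeness condition. If sets smaller than the continuum are ideal
    complete, then the dominating number is the continuum: an element above all
    columns of omega x omega defines a function, and ideal completeness prevents
    a small family from dominating it ([mc_undominated]). Conversely, if the
    dominating and the reaping numbers are both the continuum, then sets smaller
    than the continuum are ideal complete in every reduced power: interpolate
    between the joins of the first h(n) generators of the two ideals, where h
    grows slowly, and decide by a splitting set which of the two ideals is
    followed at the coordinate n ([small_ideal_complete]).

    The ideal condition. It passes between P(omega)/fin and the reduced power of
    C along the monotone retractions between the two algebras. Subsets are moved
    along a bijection, which preserves chains, and closed under the embedding
    and the retraction ([star_transfer]).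

    The reaping number. It remains to show that if P(omega)/fin is
    star-aleph_0-ideal and the dominating number is the continuum, then so is the
    reaping number ([star_unreaped]). Suppose not, and index a smallest unsplit
    family by a well-ordered set W. At regular cardinals below |W| the ideal
    condition gives Luzin families, that is, families of
    which all but countably many members split any given nonzero element ([luzin_family]).
    They imply that the countable subsets of W are covered by |W| many sets of
    size aleph_1 ([countable_sets_covered]). This covering is used to collect
    fewer than the continuum many elements in ideal subalgebras of size aleph_1;
    some real x is the limit of none of these, when elements are viewed as sets of
    nodes of the binary tree. The countably generated ideal of the elements
    disjoint from the branch of x then contradicts the choice of the unsplit
    family ([minimal_unsplit_absurd]). *)

Set Implicit Arguments.
Unset Strict Implicit.
Unset Printing Implicit Defensive.

Import Order.Theory GRing.Theory Num.Theory.
Import numFieldTopology.Exports.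

Local Open Scope classical_set_scope.
Local Open Scope card_scope.

Local Notation meet := Order.meet.
Local Notation join := Order.join.
Local Notation neg := Order.compl.
Local Notation bot := (\bot%O).
Local Notation top := (\top%O).

(** * Cardinal arithmetic and well-orderings *)

Lemma card_le_rel {T U} (A : set T) (C : set U) (r : T -> U -> Prop) :
  (forall a, A a -> exists2 c, C c & r a c) ->
  (forall a a' c, A a -> A a' -> r a c -> r a' c -> a = a') -> A #<= C.
Proof.
move=> rtot rinj.
have [->|/set0P[a0 Aa0]] := eqVneq A set0; first exact: card_ge0.
have [c0 _ _] := rtot _ Aa0.
have /choice[f fP] a : exists c, A a -> C c /\ r a c.
  have [Aa|nAa] := pselect (A a); last by exists c0.
  by have [c Cc rac] := rtot _ Aa; exists c.
have /injfunPex[g] : exists2 g : T -> U, set_fun A C g & set_inj A g.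
  exists f; first by move=> a /fP[].
  move=> a a' /set_mem Aa /set_mem Aa' fa.
  apply: (rinj a a' (f a)) => //; first exact: (fP _ Aa).2.
  by rewrite fa; exact: (fP _ Aa').2.
exact: inj_card_le.
Qed.

Lemma card_le_inj {T U} (A : set T) (C : set U) (u0 : U) : A #<= C ->
  exists f : T -> U, (forall a, A a -> C (f a)) /\
    (forall a a', A a -> A a' -> f a = f a' -> a = a').
Proof.
move=> /card_leP[f].
have fE a (Aa : A a) : exists g : A, val g = a by exists (SigSub (mem_set Aa)).
have /choice[g gP] a : exists c, forall Aa : A a, c = val (f (SigSub (mem_set Aa))).
  have [Aa|nAa] := pselect (A a); last by exists u0 => Aa; case: nAa.
  exists (val (f (SigSub (mem_set Aa)))) => Aa'.
  by rewrite (Prop_irrelevance Aa Aa').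
exists g; split=> [a Aa|a a' Aa Aa'].
  by rewrite (gP _ Aa); exact: set_valP.
rewrite (gP _ Aa) (gP _ Aa') => /val_inj.
have fi : injective f by move=> x y fxy; apply: (inj (f := f)) => //; rewrite inE.
by move=> /fi/(congr1 val).
Qed.

(** Zorn's lemma: a maximal partial injection from [A] to [C] is total or onto. *)
Lemma card_le_total {T U} (A : set T) (C : set U) : A #<= C \/ C #<= A.
Proof.
pose P (G : set (T * U)) := [/\ G `<=` A `*` C,
  (forall x y y', G (x, y) -> G (x, y') -> y = y') &
  (forall x x' y, G (x, y) -> G (x', y) -> x = x')].
have [|G [[GAC Gf Gi] Gmax]] := @Zorn_bigcup _ P.
  move=> F FP Ftot; split.
  - by move=> p [G FG Gp]; have [GAC _ _] := FP _ FG; exact: GAC.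
  - move=> x y y' [G FG Gy] [H FH Hy'].
    have [GH|HG] := Ftot _ _ FG FH.
    + by have [_ Hf _] := FP _ FH; apply: Hf Hy'; exact: GH.
    + by have [_ Gf _] := FP _ FG; apply: Gf Gy _; exact: HG.
  - move=> x x' y [G FG Gy] [H FH Hy'].
    have [GH|HG] := Ftot _ _ FG FH.
    + by have [_ _ Hf] := FP _ FH; apply: Hf Hy'; exact: GH.
    + by have [_ _ Gf] := FP _ FG; apply: Gf Gy _; exact: HG.
have [domG|ndomG] := pselect (forall a, A a -> exists c, G (a, c)).
  left; apply: (@card_le_rel _ _ _ _ (fun a c => G (a, c))) => [a Aa|a a' c _ _].
    by have [c Gc] := domG _ Aa; exists c => //; have [] := GAC _ Gc.
  exact: Gi.
have [ranG|nranG] := pselect (forall c, C c -> exists a, G (a, c)).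
  right; apply: (@card_le_rel _ _ _ _ (fun c a => G (a, c))) => [c Cc|c c' a _ _].
    by have [a Ga] := ranG _ Cc; exists a => //; have [] := GAC _ Ga.
  exact: Gf.
move/existsNP: ndomG => [a /not_implyP[Aa /forallNP nGa]].
move/existsNP: nranG => [c /not_implyP[Cc /forallNP nGc]].
exfalso; apply: (Gmax (G `|` [set (a, c)])).
  split; first by move=> p Gp; left.
  by move=> /(_ (a, c) (or_intror erefl)); exact: nGa.
split.
- by move=> p [/GAC//|->]; split.
- move=> x y y' [Gy|[-> ->]] [Gy'|[]].
  + exact: Gf Gy Gy'.
  + by move=> xa _; move: Gy; rewrite xa => /nGa.
  + by case/nGa: Gy'.
  + by move=> ->.
- move=> x x' y [Gy|[-> ->]] [Gy'|[]].
  + exact: Gi Gy Gy'.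
  + by move=> _ xa; move: Gy; rewrite xa => /nGc.
  + by case/nGc: Gy'.
  + by move=> ->.
Qed.

Lemma card_leNgt {T U} (A : set T) (C : set U) : ~ (A #<= C) -> C #<= A.
Proof. by have [] := card_le_total A C. Qed.

Lemma card_leX {T U T' U'} (A : set T) (C : set U) (A' : set T') (C' : set U') :
  A #<= A' -> C #<= C' -> A `*` C #<= A' `*` C'.
Proof.
have [->|/set0P[[a0 c0] [Aa0 Cc0]]] := eqVneq (A `*` C) set0.
  by move=> _ _; exact: card_ge0.
move=> AA CC.
have [A0|/set0P[a' Aa']] := eqVneq A' set0.
  by move: AA; rewrite A0 card_le0 => /eqP A1; rewrite A1 in Aa0.
have [C0|/set0P[c' Cc']] := eqVneq C' set0.
  by move: CC; rewrite C0 card_le0 => /eqP C1; rewrite C1 in Cc0.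
have [f [fA fi]] := card_le_inj a' AA.
have [g [gA gi]] := card_le_inj c' CC.
apply: (@card_le_rel _ _ _ _ (fun p p' => p' = (f p.1, g p.2))).
  by move=> [a c] [/= Aa Cc]; exists (f a, g c) => //; split; [exact: fA|exact: gA].
move=> [a c] [b e] _ [/= Aa Cc] [/= Ab Ce] -> [/= fab gce].
by rewrite (fi _ _ Aa Ab fab) (gi _ _ Cc Ce gce).
Qed.

Lemma card_le_bigcupX {T I U} (D : set I) (F : I -> set T) (N : set U) :
  (forall i, D i -> F i #<= N) -> \bigcup_(i in D) F i #<= D `*` N.
Proof.
move=> FN.
have [->|/set0P[t [i Di Fit]]] := eqVneq (\bigcup_(i in D) F i) set0.
  exact: card_ge0.
have [N0|/set0P[u Nu]] := eqVneq N set0.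
  by move: (FN _ Di); rewrite N0 card_le0 => /eqP F0; rewrite F0 in Fit.
have /choice[g gP] j : exists g : T -> U, D j -> (forall a, F j a -> N (g a)) /\
    (forall a a', F j a -> F j a' -> g a = g a' -> a = a').
  have [Dj|nDj] := pselect (D j); last by exists (fun=> u).
  by have [g gP] := card_le_inj u (FN _ Dj); exists g.
apply: (@card_le_rel _ _ _ _ (fun a p => [/\ D p.1, F p.1 a & p.2 = g p.1 a])).
  move=> a [j Dj Fja]; exists (j, g j a) => //; split => //=.
  exact: (gP _ Dj).1.
move=> a a' [j n] _ _ [/= Dj Fa ->] [_ Fa' gaa'].
exact: (gP _ Dj).2.
Qed.

(** Zorn's lemma applies to the injections [D `*` D -> D] with [D] an infinite
    subset of [A]. If [A] were larger than the domain [D] of a maximal one, then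
    the complement of [D] would contain a copy [E] of [D], and since [D] is as
    large as three copies of its square, the pairs of members of [D] and [E] that
    are not in [D `*` D] could be mapped injectively into [E]. *)
Lemma card_le_square {T} (A : set T) : infinite_set A -> A `*` A #<= A.
Proof.
move=> Ainf.
pose dom (G : set (T * T * T)) := [set x | exists z, G (x, x, z)].
pose inj G := [/\ dom G `<=` A, infinite_set (dom G),
  (forall x y, dom G x -> dom G y -> exists2 z, dom G z & G (x, y, z)),
  (forall x y z, G (x, y, z) -> [/\ dom G x, dom G y & dom G z]) &
  (forall p p' z, G (p, z) -> G (p', z) -> p = p')].
pose P G := G = set0 \/ inj G.
have [|G [PG Gmax]] := @Zorn_bigcup _ P.
  move=> F FP Ftot.
  have [[G FG injG]|noinj] := pselect (exists2 G, F G & inj G); last first.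
    left; apply/seteqP; split=> // p [G FG Gp].
    by have [G0|injG] := FP _ FG; [rewrite G0 in Gp|case: noinj; exists G].
  right; set H := \bigcup_(X in F) X.
  have domH x : dom H x <-> exists2 X, F X & dom X x.
    by split=> [[z [X FX Xz]]|[X FX [z Xz]]]; [exists X => //; exists z|exists z; exists X].
  have domS X Y : X `<=` Y -> dom X `<=` dom Y.
    by move=> XY x [z Xz]; exists z; exact: XY.
  have injF X x : F X -> X x -> inj X.
    by move=> FX Xx; have [X0|//] := FP _ FX; rewrite X0 in Xx.
  split.
  - move=> x /domH[X FX Xx]; have [z Xz] := Xx.
    by have [+ _ _ _ _] := injF _ _ FX Xz; exact.
  - have [_ dinf _ _ _] := injG; move=> fin; apply: dinf.
    by apply: sub_finite_set fin => x Gx; apply/domH; exists G.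
  - move=> x y /domH[X FX Xx] /domH[Y FY Yy].
    have [Z [FZ Zx Zy]] : exists Z, [/\ F Z, dom Z x & dom Z y].
      have [XY|YX] := Ftot _ _ FX FY; last by exists X; split=> //; exact: domS Yy.
      by exists Y; split=> //; exact: domS Xx.
    have [z' Zz'] := Zy; have [_ _ + _ _] := injF _ _ FZ Zz'.
    move=> /(_ x y Zx Zy)[z Dz Gz]; exists z; last by exists Z.
    by apply/domH; exists Z.
  - move=> x y z [X FX Xz]; have [_ _ _ + _] := injF _ _ FX Xz.
    by move=> /(_ _ _ _ Xz)[? ? ?]; split; apply/domH; exists X.
  - move=> p p' z [X FX Xz] [Y FY Yz].
    have [XY|YX] := Ftot _ _ FX FY.
      by have [_ _ _ _ Yi] := injF _ _ FY Yz; exact: (Yi _ _ _ (XY _ Xz) Yz).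
    by have [_ _ _ _ Xi] := injF _ _ FX Xz; exact: (Xi _ _ _ Xz (YX _ Yz)).
have [t0 At0] := infinite_setN0 Ainf.
case: PG => [G0|[domA domI Gtot Gsub Ginj]].
  exfalso; have /(card_le_inj t0)[f [fA fi]] := (infiniteP A).1 Ainf.
  have /(card_le_inj 0%N)[g [_ gi]] : [set: nat * nat] #<= [set: nat].
    by move: card_nat2 => /card_eqPle[].
  pose G' := [set (f p.1, f p.2, f (g p)) | p in [set: nat * nat]].
  have dom' x : dom G' x <-> exists n, x = f n.
    split=> [[z [[m n] _ [/= <- _ _]]]|[n ->]]; first by exists m.
    by exists (f (g (n, n))); exists (n, n).
  have fI m n : f m = f n -> m = n by exact: fi.
  apply: (Gmax G').
    rewrite G0; split; first by [].
    by move=> /(_ _ (imageP _ (I : [set: nat * nat] (0%N, 0%N)))).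
  right; split.
  - by move=> x /dom'[n ->]; exact: fA.
  - apply/infiniteP; apply: (@card_le_rel _ _ _ _ (fun n x => x = f n)).
      by move=> n _; exists (f n) => //; apply/dom'; exists n.
    by move=> a a' c _ _ -> /fI.
  - move=> x y /dom'[m ->] /dom'[n ->]; exists (f (g (m, n))).
      by apply/dom'; exists (g (m, n)).
    by exists (m, n).
  - by move=> x y z [[m n] _ [/= <- <- <-]]; split; apply/dom'; eexists.
  - move=> p p' z [q _ [/= <- <-]] [q' _ [/= <- /fI qq']].
    by rewrite (gi q' q).
set D := dom G in domA domI Gtot Gsub Ginj.
have sqD : D `*` D #<= D.
  apply: (@card_le_rel _ _ _ _ (fun p z => G (p, z))).
    by move=> [x y] [/= Dx Dy]; have [z] := Gtot _ _ Dx Dy; exists z.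
  by move=> p p' z _ _; exact: Ginj.
have threeD : [set: 'I_3] `*` (D `*` D) #<= D.
  apply: (card_le_trans _ sqD); apply: (card_leX _ sqD).
  apply: (@card_le_trans _ _ _ [set: nat]); last exact/infiniteP.
  apply: (@card_le_rel _ _ _ _ (fun i n => n = nat_of_ord i)).
    by move=> i _; exists (nat_of_ord i).
  by move=> a a' c _ _ -> /val_inj.
have twoD : forall X Y : set T, X #<= D -> Y #<= D -> X `|` Y #<= D.
  move=> X Y XD YD; apply: card_le_trans sqD.
  have -> : X `|` Y = \bigcup_(b in [set: bool]) (if b then X else Y).
    apply/seteqP; split=> [x [Xx|Yx]|x [[] _ ?]]; [by exists true|by exists false|by left|by right].
  apply: card_le_trans (card_le_bigcupX (N := D) _) _; first by case.
  apply: card_leX (card_lexx _).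
  apply: (@card_le_trans _ _ _ [set: nat]); last exact/infiniteP.
  by apply: countableP.
have [AD|nAD] := pselect (A `\` D #<= D).
  have : A #<= D.
    by rewrite -(setDUK domA); apply: twoD.
  move=> AleD; apply: card_le_trans (card_leX AleD AleD) _.
  by apply: card_le_trans sqD _; exact: subset_card_le.
have [d0 Dd0] := infinite_setN0 domI.
have /(card_le_inj d0)[f [fA fi]] := card_leNgt nAD.
have /(card_le_inj d0)[g [gD gi]] := threeD.
exfalso.
pose E := f @` D.
have ED x : E x -> ~ D x by move=> [y Dy <-]; have [] := fA _ Dy.
(* the code of a pair outside D `*` D records which entries are new *)
pose cd (x y : T * bool) := f (g (inord (x.2 + x.2 + y.2 - 1), (x.1, y.1))).
pose em (x : T * bool) := if x.2 then f x.1 else x.1.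
pose G' := G `|` [set (em p.1, em p.2, cd p.1 p.2) |
   p in [set p : (T * bool) * (T * bool) | [/\ D p.1.1, D p.2.1 & p.1.2 || p.2.2]]].
have gD' i x y : D x -> D y -> D (g (i, (x, y))) by move=> Dx Dy; exact: gD.
have gI i x y i' x' y' : D x -> D y -> D x' -> D y' ->
    g (i, (x, y)) = g (i', (x', y')) -> [/\ i = i', x = x' & y = y'].
  move=> Dx Dy Dx' Dy' e.
  by have [-> -> ->] : (i, (x, y)) = (i', (x', y')) by exact: gi.
have dom1 x : D x -> dom G' x by move=> [z Gz]; exists z; left.
have dom2 x : D x -> dom G' (f x).
  by move=> Dx; eexists; right; exists ((x, true), (x, true)).
have domE x : dom G' x <-> D x \/ E x.
  split=> [[z [Gz|[[[u b] [v c]] /= [Du Dv _] [<- uv _]]]]|[|[y Dy <-]]].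
  - by left; exists z.
  - rewrite /em /=; case: b uv => /=; first by right; exists u.
    by left.
  - exact: dom1.
  - exact: dom2.
have emD b x : D x -> dom G' (em (x, b)) by move=> Dx; case: b; [exact: dom2|exact: dom1].
have domem x : dom G' x -> exists p, D p.1 /\ x = em p.
  move=> /domE[Dx|[y Dy <-]]; first by exists (x, false).
  by exists (y, true).
have emI p p' : D p.1 -> D p'.1 -> em p = em p' -> p = p'.
  case: p p' => x [] [y []] /= Dx Dy; rewrite /em /=.
  - by move=> /(fi _ _ Dx Dy) ->.
  - by move=> e; case: (ED (f x)); [exists x|rewrite e].
  - by move=> e; case: (ED (f y)); [exists y|rewrite -e].
  - by move=> ->.
apply: (Gmax G').
  split; first by move=> p; left.
  move=> GG; have Efd : E (f d0) by exists d0.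
  apply: (ED _ Efd).
  have [z Gz] := dom2 _ Dd0.
  by have [] := Gsub _ _ _ (GG _ Gz).
right; split.
- move=> x /domE[/domA//|[y Dy <-]]; by have [] := fA _ Dy.
- by move=> fin; apply: domI; apply: sub_finite_set fin => x Dx; exact: dom1.
- move=> x y /domem[[u b] [/= Du ->]] /domem[[v c] [/= Dv ->]].
  case bc : (b || c); last first.
    move: bc; case: b; case: c => //= _.
    have [z Dz Gz] := Gtot _ _ Du Dv.
    by exists z; [exact: dom1|left].
  exists (cd (u, b) (v, c)).
    by apply: dom2; apply: gD'.
  by right; exists ((u, b), (v, c)).
- move=> x y z [/Gsub[? ? ?]|[[[u b] [v c]] /= [Du Dv _] [<- <- <-]]].
    by split; exact: dom1.
  by split; [exact: emD|exact: emD|apply: dom2; exact: gD'].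
- move=> p p' z [Gz|[[[u b] [v c]] /= [Du Dv bc] [<- <-]]]
                [Gz'|[[[u' b'] [v' c']] /= [Du' Dv' bc'] [<- eqcd]]].
  + exact: Ginj Gz Gz'.
  + case: p Gz => x y /Gsub[_ _ Dz]; case: (ED z) => //; rewrite -eqcd.
    by eexists; last reflexivity; exact: gD'.
  + case: p' Gz' => x y /Gsub[_ _ Dz]; case: (ED _ _ Dz).
    by eexists; last reflexivity; exact: gD'.
  + move: eqcd => /fi eqcd.
    have {}eqcd := eqcd (gD' _ _ _ Du' Dv') (gD' _ _ _ Du Dv).
    have [bb uu vv] := gI _ _ _ _ _ _ Du' Dv' Du Dv eqcd.
    move: bb => /(congr1 (@nat_of_ord _)); rewrite uu vv !inordK; [|by case: (b); case: (c)|by case: (b'); case: (c')].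
    move: bc bc' {eqcd}.
    by case: b; case: c => //; case: b'; case: c'.
Qed.

Section InfiniteCardinal.
Context {U : Type} (N : set U).
Hypothesis Ninf : infinite_set N.

Lemma card_le_bigcup {T I} (D : set I) (F : I -> set T) :
  D #<= N -> (forall i, D i -> F i #<= N) -> \bigcup_(i in D) F i #<= N.
Proof.
move=> DN FN; apply: card_le_trans (card_le_bigcupX FN) _.
exact: card_le_trans (card_leX DN (card_lexx N)) (card_le_square Ninf).
Qed.

Lemma countable_card_le {T} (A : set T) : countable A -> A #<= N.
Proof. by move=> cA; apply: card_le_trans cA _; exact/infiniteP. Qed.

Lemma card_le_setU {T} (A C : set T) : A #<= N -> C #<= N -> A `|` C #<= N.
Proof.
move=> AN CN.
have -> : A `|` C = \bigcup_(b in [set: bool]) (if b then A else C).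
  apply/seteqP; split=> [x [Ax|Cx]|x [[] _ ?]];
    [by exists true|by exists false|by left|by right].
by apply: card_le_bigcup; [exact: countable_card_le|case].
Qed.

Lemma card_le_seq {T : eqType} (A : set T) :
  A #<= N -> [set s : seq T | {in s, forall x, A x}] #<= N.
Proof.
move=> AN; pose L n := [set s : seq T | size s = n /\ {in s, forall x, A x}].
have LN n : L n #<= N.
  elim: n => [|n IHn].
    apply: countable_card_le; apply: (@sub_countable _ _ _ [set [::] : seq T]).
      by apply: subset_card_le => s [/size0nil].
    exact: countable1.
  apply: (@card_le_trans _ _ _ (\bigcup_(x in A) (cons x @` L n))).
    apply: subset_card_le => -[|x s] [//= [sn] sA].
    exists x; first by apply: sA; rewrite inE eqxx.
    by exists s => //; split=> // y ys; apply: sA; rewrite inE ys orbT.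
  apply: card_le_bigcup => // x _.
  exact: card_le_trans (card_image_le _ _) IHn.
apply: (@card_le_trans _ _ _ (\bigcup_n L n)).
  by apply: subset_card_le => s sA; exists (size s).
apply: card_le_bigcup => [|n _]; last exact: LN.
by apply: countable_card_le; exact: countableP.
Qed.

End InfiniteCardinal.

Lemma uncountable_infinite {T} (A : set T) : ~ countable A -> infinite_set A.
Proof. by apply: contra_not => /finite_set_countable. Qed.

(** Arrange the continuum as a plane. Either some vertical line misses [P], so
    that [Q] contains it, or [P] meets every vertical line. *)
Lemma continuum_card_setU {T} (P Q : set T) :
  continuum #<= P `|` Q -> continuum #<= P \/ continuum #<= Q.
Proof.
have [PQ0|/set0P[t0 _]] := eqVneq (P `|` Q) set0.
  by rewrite PQ0 card_le0 => /eqP/seteqP[/(_ (fun=> true) I)].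
move=> /(card_le_inj t0)[f [fPQ fi]].
pose pr (x y : nat -> bool) n := if odd n then x n./2 else y n./2.
have prI x y x' y' : pr x y = pr x' y' -> x = x' /\ y = y'.
  move=> e; split; apply/funext => n.
    by have := congr1 (fun h => h n.*2.+1) e; rewrite /pr /= odd_double /= uphalf_double.
  by have := congr1 (fun h => h n.*2) e; rewrite /pr odd_double half_double.
have fI x y : f x = f y -> x = y by exact: fi.
have [[x xP]|noline] := pselect (exists x, forall y, ~ P (f (pr x y))).
  right; apply: (@card_le_rel _ _ _ _ (fun y t => t = f (pr x y))).
    move=> y _; exists (f (pr x y)) => //.
    by have [/xP|//] := fPQ (pr x y) I.
  by move=> y y' _ _ _ -> /fI/prI[].
left; apply: (@card_le_rel _ _ _ _ (fun x t => exists y, t = f (pr x y))).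
  move=> x _; apply: contrapT => nx; apply: noline; exists x => y Py.
  by apply: nx; exists (f (pr x y)) => //; exists y.
by move=> x x' _ _ _ [y ->] [y' /fI/prI[]].
Qed.

Lemma continuum_uncountable : ~ countable continuum.
Proof.
move=> /(card_le_inj 0%N)[f [_ fi]].
pose d n := `[< forall x, f x = n -> ~~ x n >].
have : ~~ d (f d) <-> d (f d).
  split=> [/asboolPn|/asboolP/(_ _ erefl)//].
  move=> /existsNP[x /not_implyP[fx /negP/negPn xn]].
  by have e := fi x d I I fx; rewrite e in xn.
by case: (d (f d)) => -[/=]; [move=> _ /(_ isT)|move=> /(_ isT)].
Qed.

(** * Well-orderings *)

Definition wo {T} (lt : T -> T -> Prop) := [/\ well_founded lt,
  (forall x y z, lt x y -> lt y z -> lt x z) &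
  (forall x y, lt x y \/ x = y \/ lt y x)].

Lemma exists_wo_eqType (T : eqType) : exists lt : T -> T -> Prop, wo lt.
Proof.
have [R woR] := wochoice.well_ordering_principle T.
have Rmin (A : set T) : A !=set0 -> exists2 z, A z & forall x, A x -> R z x.
  move=> [x Ax]; have [|z [[Az zmin] _]] := woR (fun x => `[< A x >]).
    by exists x; apply/asboolP.
  by exists z; [exact/asboolP|move=> y Ay; apply: zmin; apply/asboolP].
have Rtot x y : R x y \/ R y x.
  have [|z [->|->] zmin] := Rmin [set x; y]; first by exists x; left.
    by left; apply: zmin; right.
  by right; apply: zmin; left.
have Runiq (A : set T) z z' : A z -> A z' -> (forall x, A x -> R z x) ->
    (forall x, A x -> R z' x) -> z = z'.
  move=> Az Az' zA z'A; have [|u [_ uu]] := woR (fun x => `[< A x >]).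
    by exists z; apply/asboolP.
  rewrite -(uu z) ?(uu z') //; split; [exact/asboolP| |exact/asboolP|].
    by move=> x /asboolP; exact: z'A.
  by move=> x /asboolP; exact: zA.
have Rrefl x : R x x by have [] := Rtot x x.
have Ranti x y : R x y -> R y x -> x = y.
  move=> xy yx; apply: (Runiq [set x; y]); [by left|by right| |].
    by move=> z [->|->].
  by move=> z [->|->].
have Rtrans x y z : R x y -> R y z -> R x z.
  move=> xy yz; have [|u [[->|->]|->] umin] := Rmin [set x; y; z].
  - by exists x; left; left.
  - by apply: umin; right.
  - have -> // : x = y by apply: Ranti => //; apply: umin; left; left.
  - by have <- : y = z by apply: Ranti => //; apply: umin; left; right.
exists (fun x y => R x y /\ x <> y); split.
- move=> x; apply: contrapT => nx.
  have [|z nz zmin] := Rmin [set x | ~ Acc (fun x y => R x y /\ x <> y) x].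
    by exists x.
  apply: nz; constructor => y [yz yNz]; apply: contrapT => ny.
  by apply: yNz; apply: Ranti => //; exact: zmin.
- move=> x y z [xy xNy] [yz yNz]; split; first exact: Rtrans yz.
  by move=> xz; subst z; apply: xNy; exact: Ranti.
- move=> x y; have [->|xy] := eqVneq x y; first by right; left.
  have [Rxy|Ryx] := Rtot x y; [by left; split=> //; exact/eqP|right; right].
  by split=> // yx; rewrite yx eqxx in xy.
Qed.

Lemma exists_wo (T : Type) : exists lt : T -> T -> Prop, wo lt.
Proof. by have [lt ltwo] := exists_wo_eqType {classic T}; exists lt. Qed.

Section WellOrder.
Context {T : Type} (lt : T -> T -> Prop).
Hypothesis lt_wo : wo lt.

Lemma wo_irr x : ~ lt x x.
Proof.
have [wf _ _] := lt_wo; elim/(well_founded_ind wf): x => x IH xx.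
exact: (IH x xx).
Qed.

Lemma wo_trans x y z : lt x y -> lt y z -> lt x z.
Proof. by have [_ + _] := lt_wo; apply. Qed.

Lemma wo_ind (P : T -> Prop) : (forall x, (forall y, lt y x -> P y) -> P x) ->
  forall x, P x.
Proof. by have [wf _ _] := lt_wo; exact: well_founded_ind. Qed.

Lemma wo_nlt x y : ~ lt x y -> y = x \/ lt y x.
Proof. by have [_ _ /(_ x y)[|[->|]]] := lt_wo; [|left|right]. Qed.

Lemma wo_min (A : set T) : A !=set0 ->
  exists2 z, A z & forall x, A x -> ~ lt x z.
Proof.
move=> [x]; elim/wo_ind: x => x IH Ax.
have [[y [yx Ay]]|no] := pselect (exists y, lt y x /\ A y); first exact: IH Ay.
by exists x => // y Ay yx; apply: no; exists y.
Qed.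

Definition seg (A : set T) x : set T := [set y | A y /\ lt y x].

(** An uncountable set contains a copy of the first uncountable ordinal: the
    set of its members that have countably many predecessors in it. *)
Lemma exists_omega1 (A : set T) : ~ countable A -> exists P : set T,
  [/\ P `<=` A, ~ countable P & forall x, P x -> countable (seg P x)].
Proof.
move=> Aunc; pose P := [set x | A x /\ countable (seg A x)].
exists P; split=> [x []//| |x [Ax cx]]; last first.
  by apply: sub_countable cx; apply: subset_card_le => y [[Ay _] yx].
have [->//|/eqP] := eqVneq P A.
rewrite eqEsubset => nPA.
have [|x [Ax nPx] xmin] := wo_min (A := A `\` P).
  apply: contrapT => no; apply: nPA; split=> [y []//|y Ay].
  by apply: contrapT => nPy; apply: no; exists y.
have : ~ countable (seg A x) by move=> cx; apply: nPx.
apply: contra_not; apply: sub_countable; apply: subset_card_le => y [Ay yx].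
by apply: contrapT => nPy; exact: xmin yx.
Qed.

(** If [C] were cofinal, then [P] would be a countable union of countable
    initial segments. *)
Lemma omega1_sup (P C : set T) : ~ countable P ->
  (forall x, P x -> countable (seg P x)) -> C `<=` P -> countable C ->
  exists2 x, P x & forall y, C y -> lt y x.
Proof.
move=> Punc Pseg CP cC; apply: contrapT => no; apply: Punc.
have cU : countable (\bigcup_(y in C) (seg P y `|` [set y])).
  apply: bigcup_countable => // y Cy.
  have -> : seg P y `|` [set y] =
      \bigcup_(b in [set: bool]) (if b then seg P y else [set y]).
    apply/seteqP; split=> [x [Ax|Cx]|x [[] _ ?]];
      [by exists true|by exists false|by left|by right].
  apply: bigcup_countable; first exact: countableP.
  by case=> _; [apply: Pseg; exact: CP|exact: countable1].
apply: sub_countable cU; apply: subset_card_le => x Px.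
apply: contrapT => nU; apply: no; exists x => // y Cy.
have [_ _ /(_ y x)[//|[yx|xy]]] := lt_wo; exfalso; apply: nU; exists y => //.
  by right.
by left.
Qed.

(** Recursion in which each step is an existence statement: [R x f u] says that
    [u] is an admissible value at [x] when [f] gives the values below [x]. *)
Lemma wo_rec {U : Type} (u0 : U) (R : forall x : T, (T -> U) -> U -> Prop) :
  (forall x f, exists u, R x f u) ->
  (forall x f g u, (forall y, lt y x -> f y = g y) -> R x f u -> R x g u) ->
  exists f : T -> U, forall x, R x f (f x).
Proof.
move=> Rex Rext; have [wf _ _] := lt_wo.
have /choice[F FP] : forall p : T * (T -> U), exists u, R p.1 p.2 u by move=> p.
pose ext x (g : forall y, lt y x -> U) y :=
  if pselect (lt y x) is left h then g y h else u0.
pose f := Fix wf (fun=> U) (fun x g => F (x, ext x g)).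
exists f => x; have -> : f x = F (x, ext x (fun y _ => f y)).
  rewrite /f Fix_eq// => y g g' gg'; congr (F (_, _)).
  by apply/funext => z; rewrite /ext; case: pselect.
apply: Rext (FP (x, ext x (fun y _ => f y))) => y yx.
by rewrite /ext /=; case: pselect.
Qed.

End WellOrder.

(** * Eventually and infinitely often *)

Definition ev (P : nat -> Prop) := exists m, forall n, (m <= n)%N -> P n.
Definition io (P : nat -> Prop) := forall m, exists2 n, (m <= n)%N & P n.

Lemma evT (P : nat -> Prop) : (forall n, P n) -> ev P.
Proof. by move=> PT; exists 0%N. Qed.

Lemma evW (P Q : nat -> Prop) : (forall n, P n -> Q n) -> ev P -> ev Q.
Proof. by move=> PQ [m mP]; exists m => n /mP/PQ. Qed.

Lemma evI (P Q : nat -> Prop) : ev P -> ev Q -> ev (fun n => P n /\ Q n).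
Proof.
move=> [m mP] [k kQ]; exists (maxn m k) => n.
by rewrite geq_max => /andP[/mP ? /kQ ?].
Qed.

Lemma ev_le m : ev (fun n => (m <= n)%N).
Proof. by exists m. Qed.

Lemma ioW (P Q : nat -> Prop) : (forall n, P n -> Q n) -> io P -> io Q.
Proof. by move=> PQ iP m; have [n mn /PQ] := iP m; exists n. Qed.

Lemma not_ev (P : nat -> Prop) : ~ ev P <-> io (fun n => ~ P n).
Proof.
split=> [nP m|iP [m mP]]; last by have [n /mP] := iP m.
apply: contrapT => no; apply: nP; exists m => n mn.
by apply: contrapT => nP; apply: no; exists n.
Qed.

Lemma ev_io (P Q : nat -> Prop) : ev P -> io Q -> io (fun n => P n /\ Q n).
Proof.
move=> [m mP] iQ k; have [n + Qn] := iQ (maxn m k).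
by rewrite geq_max => /andP[/mP ? ?]; exists n.
Qed.

Lemma ev_forall_lt (m : nat) (P : nat -> nat -> Prop) :
  (forall k, (k < m)%N -> ev (P k)) -> ev (fun n => forall k, (k < m)%N -> P k n).
Proof.
elim: m => [|m IH] evP; first by apply: evT.
have {}IH := IH (fun k km => evP k (ltnW km)).
apply: evW (evI IH (evP m (ltnSn m))) => n [Pn Pm] k.
by rewrite ltnS leq_eqVlt => /orP[/eqP->|/Pn].
Qed.

(** * Reduced powers modulo the finite sets *)

(** [q] presents [A] as the reduced power of [C] modulo the finite subsets of
    the index set; with [C] the two-element algebra, [A] is the power set of
    the natural numbers modulo the finite sets. *)
Definition reduced_power {dC dA : Order.disp_t} {C : ctbDistrLatticeType dC}
    {A : ctbDistrLatticeType dA} (q : (nat -> C) -> A) : Prop :=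
  (forall a, exists u, q u = a) /\
  (forall u v, (q u <= q v)%O <-> ev (fun n => (u n <= v n)%O)).

Definition of_bool {d} {C : ctbDistrLatticeType d} (b : bool) : C :=
  if b then top else bot.

Section ReducedPower.
Context {dC dA : Order.disp_t} {C : ctbDistrLatticeType dC}.
Context {A : ctbDistrLatticeType dA} (q : (nat -> C) -> A).
Hypothesis qP : reduced_power q.

Lemma rp_surj a : exists u, q u = a. Proof. exact: qP.1. Qed.

Lemma rp_le u v : (q u <= q v)%O <-> ev (fun n => (u n <= v n)%O).
Proof. exact: qP.2. Qed.

Lemma rp_meet u v : q (fun n => meet (u n) (v n)) = meet (q u) (q v).
Proof.
apply/le_anti/andP; split.
  rewrite lexI; apply/andP; split; apply/rp_le/evT => n.
    exact: leIl.
  exact: leIr.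
have [w wE] := rp_surj (meet (q u) (q v)); rewrite -wE; apply/rp_le.
have wu : (q w <= q u)%O by rewrite wE leIl.
have wv : (q w <= q v)%O by rewrite wE leIr.
apply: evW (evI ((rp_le _ _).1 wu) ((rp_le _ _).1 wv)) => n [wun wvn].
by rewrite lexI wun.
Qed.

Lemma rp_bot : q (fun=> bot) = bot.
Proof.
apply/eqP; rewrite -lex0; have [w <-] := rp_surj bot.
by apply/rp_le/evT => n; exact: le0x.
Qed.

Lemma rp_eq u v : q u = q v <-> ev (fun n => u n = v n).
Proof.
split=> [uv|uv].
  have uv1 : (q u <= q v)%O by rewrite uv.
  have uv2 : (q v <= q u)%O by rewrite uv.
  apply: evW (evI ((rp_le _ _).1 uv1) ((rp_le _ _).1 uv2)) => n [un vn].
  by apply: le_anti; rewrite un.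
apply/le_anti/andP.
by split; apply/rp_le; apply: evW uv => n ->; exact: lexx.
Qed.

Lemma rp_eq0 u : q u = bot <-> ev (fun n => u n = bot).
Proof. by rewrite -rp_bot rp_eq. Qed.

Lemma rp_neq0 u : q u <> bot <-> io (fun n => u n <> bot).
Proof. by rewrite rp_eq0 not_ev. Qed.

Lemma rp_neg u : q (fun n => neg (u n)) = neg (q u).
Proof.
have disj w v : (q w <= neg (q v))%O <-> ev (fun n => (w n <= neg (v n))%O).
  rewrite -disj_leC -rp_meet; split.
    move=> /eqP/rp_eq0; apply: evW => n e.
    by rewrite -disj_leC e.
  move=> e; apply/eqP/rp_eq0; apply: evW e => n.
  by rewrite -disj_leC => /eqP.
apply/le_anti/andP; split.
  by apply/disj/evT => n; exact: lexx.
have [w wE] := rp_surj (neg (q u)); rewrite -wE.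
by apply/rp_le/disj; rewrite wE.
Qed.

Lemma rp_join u v : q (fun n => join (u n) (v n)) = join (q u) (q v).
Proof.
rewrite -[RHS]complK complU -!rp_neg -rp_meet -rp_neg.
by congr q; apply/funext => n; rewrite -complU complK.
Qed.

Lemma rp_top : q (fun=> top) = top.
Proof.
rewrite -[RHS]complK compl1 -rp_bot -rp_neg.
by congr q; apply/funext => n; rewrite compl0.
Qed.

Lemma rp_joins (s : nat -> nat -> C) m :
  q (fun n => \join_(i < m) s i n)%O = (\join_(i < m) q (s i))%O.
Proof.
elim: m => [|m IH].
  rewrite big_ord0 -rp_bot; congr q; apply/funext => n.
  by rewrite big_ord0.
rewrite big_ord_recr /= -IH -rp_join; congr q; apply/funext => n.
by rewrite big_ord_recr.
Qed.

End ReducedPower.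

Section FiniteJoins.
Context {d : Order.disp_t} {A : ctbDistrLatticeType d}.
Implicit Types (S T : set A) (a b : A).

Lemma below_finite_joinW S a b :
  (a <= b)%O -> below_finite_join S b -> below_finite_join S a.
Proof. by move=> ab [l lS bl]; exists l => //; exact: le_trans bl. Qed.

Lemma below_finite_join0 S : below_finite_join S bot.
Proof. by exists [::] => //; exact: le0x. Qed.

Lemma below_finite_join_mem S a : S a -> below_finite_join S a.
Proof.
move=> Sa; exists [:: a]; last by rewrite big_seq1 lexx.
by move=> x /=; rewrite inE => /eqP ->.
Qed.

Lemma below_finite_joinU S T a b :
  below_finite_join S a -> below_finite_join T b ->
  below_finite_join (S `|` T) (join a b).
Proof.
move=> [l lS al] [k kT bk]; exists (l ++ k).
  by move=> x /=; rewrite mem_cat => /orP[/lS|/kT]; [left|right].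
by rewrite big_cat /=; exact: leU2.
Qed.

Lemma below_finite_joins S (s : nat -> A) m :
  (forall i, (i < m)%N -> below_finite_join S (s i)) ->
  below_finite_join S (\join_(i < m) s i)%O.
Proof.
elim: m => [|m IH] sS; first by rewrite big_ord0; exact: below_finite_join0.
rewrite big_ord_recr /= -[S]setUid; apply: below_finite_joinU.
  by apply: IH => i im; apply: sS; exact: ltnW.
exact: sS.
Qed.

Lemma not_below_finite_join S T a :
  (forall l : seq A, [set` l] `<=` S `|` T -> (\join_(x <- l) x)%O <> top) ->
  below_finite_join S a -> ~ below_finite_join T (neg a).
Proof.
move=> nST Sa Ta; have [l lST] := below_finite_joinU Sa Ta.
rewrite joinxC le1x => /eqP; exact: nST.
Qed.

Lemma countable_sequence S : countable S ->
  exists s : nat -> A, (forall i, S (s i) \/ s i = bot) /\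
    (forall a, S a -> exists i, s i = a).
Proof.
move=> /(card_le_inj 0%N)[f [_ fi]].
have /choice[s sP] i : exists a, (S a /\ f a = i) \/
    (a = bot /\ ~ exists2 b, S b & f b = i).
  have [[a Sa fa]|no] := pselect (exists2 a, S a & f a = i); first by exists a; left.
  by exists bot; right.
exists s; split=> [i|a Sa]; first by have [[]|[]] := sP i; [left|right].
exists (f a); have [[Ss fs]|[_ []]] := sP (f a); last by exists a.
exact: fi.
Qed.

End FiniteJoins.

(** * The dominating and the reaping numbers *)

(** The dominating number is the continuum. *)
Definition undominated : Prop := forall G : set (nat -> nat),
  ~ (continuum #<= G) ->
  exists h : nat -> nat, forall g, G g -> io (fun n => (g n < h n)%N).

(** The reaping number is the continuum. *)
Definition unreaped : Prop := forall Y : set (nat -> bool),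
  ~ (continuum #<= Y) -> (forall P, Y P -> io P) ->
  exists y : nat -> bool, forall P, Y P ->
    io (fun n => P n /\ y n) /\ io (fun n => P n /\ ~~ y n).

(** The pairing [(k, m) |-> 2^k (2m + 1)] partitions the positive integers into
    infinite columns. *)
Definition pr (k m : nat) : nat := (2 ^ k * m.*2.+1)%N.
Definition pr1 (n : nat) : nat := logn 2 n.
Definition pr2 (n : nat) : nat := (n %/ 2 ^ logn 2 n)./2.

Lemma prK1 k m : pr1 (pr k m) = k.
Proof.
rewrite /pr1 /pr lognM ?expn_gt0// pfactorK// lognE /=.
by rewrite dvdn2 /= odd_double /= addn0.
Qed.

Lemma prK2 k m : pr2 (pr k m) = m.
Proof.
by rewrite /pr2 -/(pr1 _) prK1 /pr mulKn ?expn_gt0//= uphalf_double.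
Qed.

Lemma pr12K n : (0 < n)%N -> pr (pr1 n) (pr2 n) = n.
Proof.
move=> n0; rewrite /pr /pr2 /pr1.
have [|k ke kE] := @pfactor_coprime 2 n _ n0; first by [].
rewrite {2}kE mulnK ?expn_gt0//.
have odk : odd k by rewrite -coprime2n.
have -> : k./2.*2.+1 = k by rewrite -{2}[k]odd_double_half odk.
by rewrite mulnC.
Qed.

Lemma le_pr2 k m : (m <= pr k m)%N.
Proof.
rewrite /pr; apply: (@leq_trans m.*2.+1); first by rewrite -addnn -addSn leq_addl.
by rewrite leq_pmull// expn_gt0.
Qed.

Lemma le_pr1 k m : (k <= pr k m)%N.
Proof.
rewrite /pr; apply: (@leq_trans (2 ^ k)%N); first exact/ltnW/ltn_expl.
by rewrite leq_pmulr.
Qed.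

Section DominatingReaping.
Context {dC dA : Order.disp_t} {C : ctbDistrLatticeType dC}.
Context {A : ctbDistrLatticeType dA} (q : (nat -> C) -> A).
Hypothesis qP : reduced_power q.

(** Partition the index set into infinite columns and let [b] be above every
    column: on the [k]-th column [b] is [top] above some height [h k]. If [g]
    dominated [h], the set above the graph of [g] would lie below [b] without
    being covered by finitely many columns. *)
Lemma mc_undominated : (bot : C) <> top -> mc_eq A continuum -> undominated.
Proof.
move=> C01 [_ mcA] G nG.
pose col k : A := q (fun n => of_bool (pr1 n == k)).
pose low k : A := q (fun n => of_bool (pr1 n < k)%N).
pose above g : A := q (fun n => of_bool (g (pr1 n) <= pr2 n)%N).
have ob_le (b b' : bool) : ((of_bool b : C) <= of_bool b')%O <-> (b -> b').
  rewrite /of_bool; case: b; case: b'; rewrite ?le0x ?lexx//.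
  rewrite le1x; split=> [/eqP|/(_ isT)//].
  by move=> e; case: C01.
have colT k : ~ (above (fun=> 0%N) <= low k)%O.
  move=> /(rp_le qP)[m /(_ (pr k m) (le_pr2 _ _))/ob_le/(_ isT)].
  by rewrite prK1 ltnn.
have aboveN g k : ~ (above g <= low k)%O.
  move=> /(rp_le qP)[m /(_ (pr k (maxn m (g k))))].
  have mp : (m <= pr k (maxn m (g k)))%N by rewrite (leq_trans (leq_maxl m (g k)))// le_pr2.
  move=> /(_ mp)/ob_le; rewrite prK1 prK2 leq_maxr => /(_ isT).
  by rewrite ltnn.
have join_low (l : seq A) : [set` l] `<=` range col ->
    exists k, (\join_(x <- l) x <= low k)%O.
  elim: l => [|a l IH] lcol.
    by exists 0%N; rewrite big_nil le0x.
  have [k lk] : exists k, (\join_(x <- l) x <= low k)%O.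
    by apply: IH => x xl; apply: lcol; rewrite /= inE orbC xl.
  have [j _ ja] : range col a by apply: lcol; rewrite /= inE eqxx.
  exists (maxn j.+1 k); rewrite big_cons leUx; apply/andP; split.
    rewrite -ja; apply/(rp_le qP)/evT => n; apply/ob_le => /eqP ->.
    exact: leq_maxl.
  apply: le_trans lk _; apply/(rp_le qP)/evT => n.
  by apply/ob_le => nk; rewrite (leq_trans nk)// leq_maxr.
pose X := range col `|` above @` G.
have Xc : aleph0_ideal_complete X.
  apply: contrapT => /mcA /continuum_card_setU[cc|cG].
    apply: continuum_uncountable; apply: sub_countable cc _.
    exact: card_image_le.
  by apply: nG; apply: card_le_trans cG (card_image_le _ _).
have [||||||b [_ colb _ bX _]] := Xc (range col) set0.
- by move=> x; left.
- by [].
- exact: sub_countable (card_image_le _ _) (countableP _).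
- exact: countable0.
- by move=> s t _ [].
- move=> l; rewrite setU0 => /join_low[k lk] lT; apply: (colT k).
  by rewrite lT in lk; apply: le_trans (lex1 _) lk.
have [u ub] := rp_surj qP b.
have /choice[h hP] k : exists hk, forall m, (hk <= m)%N -> u (pr k m) = top.
  have /(rp_le qP)[m mP] : (col k <= q u)%O by rewrite ub; apply: colb; exists k.
  exists m => m' mm'; apply/eqP; rewrite -le1x.
  have := mP (pr k m') (leq_trans mm' (le_pr2 _ _)).
  by rewrite prK1 eqxx.
exists h => g Gg m.
apply: contrapT => nex.
have gh k : (m <= k)%N -> (h k <= g k)%N.
  by move=> mk; rewrite leqNgt; apply/negP => gh; apply: nex; exists k.
have : (above g <= b)%O.
  rewrite -ub; apply/(rp_le qP).
  have cols : ev (fun n => forall k, (k < m)%N -> ((of_bool (pr1 n == k) : C) <= u n)%O).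
    apply: ev_forall_lt => k km; apply/(rp_le qP).
    by rewrite ub; apply: colb; exists k.
  apply: evW (evI cols (ev_le 1)) => n [ncols n1].
  have [nm|mn] := ltnP (pr1 n) m.
    apply: le_trans (ncols _ nm).
    by apply/ob_le; rewrite eqxx.
  rewrite /of_bool; case: ifPn => [gn|_]; last exact: le0x.
  by rewrite -[n]pr12K// hP ?lexx// (leq_trans (gh _ mn)).
move=> /bX[|l lS gl]; first by right; exists g.
have [k lk] := join_low _ lS.
by apply: (aboveN g k); exact: le_trans lk.
Qed.

End DominatingReaping.

Lemma incr_lt (g : nat -> nat) : (forall m, (g m < g m.+1)%N) ->
  forall i j, (i < j)%N -> (g i < g j)%N.
Proof.
move=> g_incr i; elim=> // j IH; rewrite ltnS leq_eqVlt => /orP[/eqP->//|/IH].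
by move=> /ltn_trans; apply.
Qed.

Lemma incr_ge (g : nat -> nat) : (forall m, (g m < g m.+1)%N) ->
  forall m, (m <= g m)%N.
Proof. by move=> g_incr; elim=> // m IH; exact: leq_ltn_trans IH _. Qed.

(** [h] is the index function of the partition into the intervals between
    consecutive values of [g]; its value below [g 0] makes it total. *)
Lemma block_index (g : nat -> nat) : (forall m, (g m < g m.+1)%N) ->
  exists h : nat -> nat, (forall n, (n < g 0)%N -> h n = 0%N) /\
    (forall n k, (g k <= n < g k.+1)%N -> h n = k) /\
    (forall n, (g 0 <= n)%N -> (g (h n) <= n < g (h n).+1)%N).
Proof.
move=> g_incr; have glt := incr_lt g_incr.
have /choice[h hP] n : exists k, ((n < g 0)%N /\ k = 0%N) \/ (g k <= n < g k.+1)%N.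
  elim: n => [|n [k [[n0 _]|/andP[kn nk]]]].
  - case: (posnP (g 0%N)) => [g0|]; last by exists 0%N; left.
    by exists 0%N; right; have := g_incr 0%N; rewrite g0.
  - move: n0; rewrite leq_eqVlt => /orP[/eqP e|]; last by exists 0%N; left.
    by exists 0%N; right; rewrite e leqnn /=.
  - move: nk; rewrite leq_eqVlt => /orP[/eqP e|nk].
      by exists k.+1; right; rewrite e leqnn /=.
    by exists k; right; rewrite nk leqW.
have guniq n i j : (g i <= n < g i.+1)%N -> (g j <= n < g j.+1)%N -> i = j.
  move=> /andP[gi ig] /andP[gj jg]; apply/eqP; rewrite eqn_leq.
  apply/andP; split; rewrite leqNgt; apply/negP => ij.
    have : (g j.+1 <= g i)%N by move: ij; rewrite leq_eqVlt => /orP[/eqP->//|/glt/ltnW].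
    by rewrite leqNgt (leq_ltn_trans gi).
  have : (g i.+1 <= g j)%N by move: ij; rewrite leq_eqVlt => /orP[/eqP->//|/glt/ltnW].
  by rewrite leqNgt (leq_ltn_trans gj).
exists h; split; last split.
- move=> n n0; have [[]//|/andP[hn _]] := hP n.
  case: (posnP (h n)) => // hn0.
  by have := leq_trans (glt _ _ hn0) hn; rewrite ltnNge ltnW.
- move=> n k nk; have [[n0 _]|hn] := hP n; last exact: guniq hn nk.
  case: k nk => [|k] /andP[gk _].
    by rewrite ltnNge gk in n0.
  have := glt 0%N k.+1 isT; rewrite ltnNge => /negP[].
  exact/ltnW/(leq_ltn_trans gk).
- by move=> n n0; have [[]|//] := hP n; rewrite ltnNge n0.
Qed.

Section Completeness.
Context {dC dA : Order.disp_t} {C : ctbDistrLatticeType dC}.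
Context {A : ctbDistrLatticeType dA} (q : (nat -> C) -> A).
Hypothesis qP : reduced_power q.

(** Let [s i], [t j] generate the two ideals, with representatives [sg i],
    [tu j]. The coordinate [n] of [b] is the join of the first [h n] many [sg i n]
    when [n] is outside [y], and the complement of the join of the first [h n]
    many [tu j n] when [n] is in [y]. If [a] is below no finite join of the [s i],
    then [a] exceeds the former joins infinitely often as soon as [h] grows
    slowly enough, which is arranged for all [a] at once by a function that is
    not dominated; and [y] splits the set of these coordinates, so that [a] is
    not below [b]. The elements disjoint from [b] are treated symmetrically. *)
Lemma small_ideal_complete : undominated -> unreaped ->
  forall X : set A, ~ (continuum #<= X) -> aleph0_ideal_complete X.
Proof.
move=> domc reapc X nX S T SX TX cS cT ST nST.
have [s [sS Ss]] := countable_sequence cS.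
have [t [tT Tt]] := countable_sequence cT.
have /choice[sg sgE] i : exists u, q u = s i by exact: rp_surj.
have /choice[tu tuE] i : exists u, q u = t i by exact: rp_surj.
have /choice[rep repE] : forall a, exists u, q u = a by exact: rp_surj.
pose J (x : nat -> nat -> C) m n := (\join_(i < m.+1) x i n)%O.
have JE x m : q (J x m) = (\join_(i < m.+1) q (x i))%O by exact: (rp_joins qP x m.+1).
have JS m : below_finite_join S (q (J sg m)).
  rewrite JE; apply: (below_finite_joins (s := fun i => q (sg i))) => i _; rewrite sgE.
  by have [/below_finite_join_mem//|->] := sS i; exact: below_finite_join0.
have JT m : below_finite_join T (q (J tu m)).
  rewrite JE; apply: (below_finite_joins (s := fun i => q (tu i))) => i _; rewrite tuE.
  by have [/below_finite_join_mem//|->] := tT i; exact: below_finite_join0.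
have Jle x i m n : (i <= m)%N -> (x i n <= J x m n)%O.
  rewrite -ltnS => im.
  exact: (joins_sup (j := Ordinal im) (P := xpredT) (fun i : 'I_m.+1 => x i n)).
have Jmono x m m' n : (m <= m')%N -> (J x m n <= J x m' n)%O.
  move=> mm; apply: joins_le => i _; apply: Jle.
  by rewrite (leq_trans _ mm)// -ltnS.
(* to be disjoint from [b] is to lie below its complement *)
pose X' := X `|` neg @` X.
have nX' : ~ (continuum #<= X').
  move=> /continuum_card_setU[//|cX]; apply: nX.
  exact: card_le_trans cX (card_image_le _ _).
have /choice[K KP] m : exists k, forall n, (k <= n)%N -> meet (J sg m n) (J tu m n) = bot.
  have : meet (q (J sg m)) (q (J tu m)) = bot.
    apply/eqP; rewrite disj_leC !JE; apply: joins_le => i _.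
    rewrite -disj_leC meetC disj_leC; apply: joins_le => j _.
    rewrite -disj_leC meetC sgE tuE.
    have [Ssi|->] := sS i; last by rewrite meet0x.
    have [Ttj|->] := tT j; last by rewrite meetx0.
    by rewrite ST.
  by rewrite -(rp_meet qP) => /(rp_eq0 qP).
have far x a : ~ (exists m, (a <= q (J x m))%O) ->
    exists phi : nat -> nat, forall m, (m <= phi m)%N /\
      ~ (rep a (phi m) <= J x m (phi m))%O.
  move=> na; have /choice[phi phiP] m : exists n, (m <= n)%N /\ ~ (rep a n <= J x m n)%O.
    have : io (fun n => ~ (rep a n <= J x m n)%O).
      by apply/not_ev => e; apply: na; exists m; rewrite -(repE a); apply/(rp_le qP).
    by move=> /(_ m)[n mn nle]; exists n.
  by exists phi.
have /choice[phi phiP] (p : bool * A) : exists phi : nat -> nat,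
    ~ (exists m, (p.2 <= q (J (if p.1 then sg else tu) m))%O) ->
    forall m, (m <= phi m)%N /\
      ~ (rep p.2 (phi m) <= J (if p.1 then sg else tu) m (phi m))%O.
  have [yes|no] := pselect (exists m, (p.2 <= q (J (if p.1 then sg else tu) m))%O).
    by exists (fun=> 0%N).
  by have [f fP] := far _ _ no; exists f.
pose phis := (fun a => phi (true, a)) @` X' `|` (fun a => phi (false, a)) @` X'.
have [|g0 g0P] := domc phis.
  by move=> /continuum_card_setU[] c; apply: nX'; apply: card_le_trans c (card_image_le _ _).
pose g m := (m + \sum_(i < m) g0 i + \sum_(i < m.+1) K i)%N.
have gK m : (K m <= g m)%N by rewrite /g big_ord_recr /= addnA leq_addl.
have gg0 m : (g0 m <= g m.+1)%N.
  by rewrite /g [X in (_ + X + _)%N]big_ord_recr /= addnAC addnA leq_addl.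
have g_incr m : (g m < g m.+1)%N.
  rewrite /g !addSn ltnS leq_add//; first by rewrite leq_add2l big_ord_recr leq_addr.
  by rewrite [leqRHS]big_ord_recr leq_addr.
have [h [h0 [_ hP]]] := block_index g_incr.
have hg n : h n = 0%N \/ (g (h n) <= n)%N.
  by have [/h0|/hP/andP[]] := ltnP n (g 0%N); [left|right].
have hle n m : (n < g m.+1)%N -> (h n <= m)%N.
  move=> nm; have [/h0->//|/hP/andP[hn _]] := ltnP n (g 0%N).
  rewrite leqNgt; apply/negP; rewrite leq_eqVlt => /orP[/eqP e|/(incr_lt g_incr)].
    by rewrite -e leqNgt nm in hn.
  by move=> /(ltn_trans nm)/leq_trans/(_ hn); rewrite ltnn.
have hev k : ev (fun n => (k <= h n)%N).
  exists (g k) => n kn; rewrite leqNgt; apply/negP => hk.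
  have [n0|/hP/andP[_ nh]] := ltnP n (g 0%N).
    case: k kn hk => // k kn _; have := incr_lt g_incr (ltn0Sn k).
    by rewrite ltnNge (leq_trans kn (ltnW n0)).
  have : (g (h n).+1 <= g k)%N.
    by move: hk; rewrite leq_eqVlt => /orP[/eqP->//|/(incr_lt g_incr)/ltnW].
  by rewrite leqNgt (leq_ltn_trans kn nh).
have disjJ : ev (fun n => meet (J sg (h n) n) (J tu (h n) n) = bot).
  apply: evW (ev_le (K 0%N)) => n K0; apply: KP.
  by have [->//|] := hg n; apply: leq_trans; exact: gK.
pose P x a n := `[< ~ (rep a n <= J x (h n) n)%O >].
have Pio b a : X' a -> ~ (exists m, (a <= q (J (if b then sg else tu) m))%O) ->
    io (P (if b then sg else tu) a).
  move=> X'a na m.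
  have phiX : phis (phi (b, a)).
    by case: (b) => /=; [left|right]; exists a.
  have [k mk phik] := g0P _ phiX m.
  have [kphi nle] := phiP (b, a) na k.
  exists (phi (b, a) k); first exact: leq_trans kphi.
  apply/asboolP => le; apply: nle; apply: le_trans le _.
  by apply: Jmono; apply: hle; exact: leq_trans phik (gg0 _).
pose Ps := (P sg) @` [set a | X' a /\ ~ (exists m, (a <= q (J sg m))%O)] `|`
           (P tu) @` [set a | X' a /\ ~ (exists m, (a <= q (J tu m))%O)].
have [||y yP] := reapc Ps.
- move=> /continuum_card_setU[] c; apply: nX'; apply: card_le_trans c _;
    apply: card_le_trans (card_image_le _ _) _; apply: subset_card_le;
    by move=> ? [].
- move=> _ [[a [X'a na] <-]|[a [X'a na] <-]]; first exact: (Pio true).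
  exact: (Pio false).
pose b := q (fun n => if y n then neg (J tu (h n) n) else J sg (h n) n).
have Sb a : S a -> (a <= b)%O.
  move=> /Ss[i <-]; rewrite -sgE; apply/(rp_le qP).
  apply: evW (evI disjJ (hev i)) => n [disj ih].
  apply: le_trans (Jle sg i (h n) n ih) _.
  by case: (y n) => //; rewrite -disj_leC disj.
have Tb a : T a -> meet a b = bot.
  move=> /Tt[i <-]; rewrite -tuE -(rp_meet qP); apply/(rp_eq0 qP).
  apply: evW (evI disjJ (hev i)) => n [disj ih].
  apply/eqP; rewrite disj_leC; apply: le_trans (Jle tu i (h n) n ih) _.
  by case: (y n); rewrite ?complK// -disj_leC meetC disj.
have bS a : X' a -> (a <= b)%O -> below_finite_join S a.
  move=> X'a ab; apply: contrapT => nS.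
  have na : ~ (exists m, (a <= q (J sg m))%O).
    by move=> [m am]; apply: nS; exact: below_finite_joinW (JS m).
  have [|_ iny] := yP (P sg a); first by left; exists a.
  move: ab; rewrite -{1}(repE a) => /(rp_le qP) ab.
  have [n _ [abn [/asboolP Pn /negPf yn]]] := ev_io ab iny 0%N.
  by apply: Pn; rewrite yn in abn.
have bT a : X' a -> meet a b = bot -> below_finite_join T a.
  move=> X'a ab; apply: contrapT => nT.
  have na : ~ (exists m, (a <= q (J tu m))%O).
    by move=> [m am]; apply: nT; exact: below_finite_joinW (JT m).
  have [|iny _] := yP (P tu a); first by right; exists a.
  move: ab; rewrite -{1}(repE a) -(rp_meet qP) => /(rp_eq0 qP) ab.
  have [n _ [/eqP abn [/asboolP Pn yn]]] := ev_io ab iny 0%N.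
  by apply: Pn; move: abn; rewrite yn disj_leC complK.
exists b; split=> //.
- move=> Xb; apply: (not_below_finite_join nST (a := b)).
    by apply: bS; [left|exact: lexx].
  by apply: bT; [right; exists b|rewrite meetC meetxC].
- by move=> a Xa; apply: bS; left.
- by move=> a Xa; apply: bT; left.
Qed.

End Completeness.

(** * Families of subsets closed under long chains *)

(** [F] is like the family of subalgebras which witnesses that an algebra is
    ideal for the cardinal of [L]; only the set-theoretic part of the condition
    matters here. *)
Section Clubs.
Context {T U : Type} (L : set U) (F : set (set T)).
Hypothesis Lunc : ~ countable L.
Hypothesis FL : forall D, F D -> D #= L.
Hypothesis Fcof : forall X : set T, X #= L -> exists2 D, F D & X `<=` D.
Hypothesis Fchain : forall C : set (set T), C `<=` F -> well_ordered_chain C ->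
  length_at_most C L -> ~ has_countable_cofinal (fun X Y => X `<=` Y) C ->
  F (\bigcup_(X in C) X).

Let Linf : infinite_set L := uncountable_infinite Lunc.

(** A set smaller than [L] is first enlarged by a copy [L0] of [L]. *)
Lemma club_above (L0 X : set T) : L0 #= L -> X #<= L ->
  exists2 D, F D & X `<=` D.
Proof.
move=> L0L XL; have [|D FD XD] := Fcof (X := L0 `|` X).
  apply/card_eqPle; split.
    by apply: card_le_setU => //; move/card_eqPle: L0L => [].
  apply: (@card_le_trans _ _ _ L0); first by move/card_eqPle: L0L => [].
  by apply: subset_card_le => x; left.
by exists D => // x Xx; apply: XD; right.
Qed.

(** If the chain has a countable cofinal subset, then by the uncountable
    cofinality of the index set it is eventually constant. *)
Lemma club_omega1_chain {J} (lt : J -> J -> Prop) (P : set J) (D : J -> set T) :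
  wo lt -> ~ countable P -> (forall x, P x -> countable (seg lt P x)) ->
  (forall i, P i -> F (D i)) ->
  (forall i j, P i -> P j -> lt i j -> D i `<=` D j) ->
  F (\bigcup_(i in P) D i).
Proof.
move=> ltwo Punc Pseg FD Dmono.
have -> : \bigcup_(i in P) D i = \bigcup_(X in D @` P) X.
  by rewrite bigcup_image.
have [[C [CD cC Ccof]]|ncof] :=
    pselect (has_countable_cofinal (fun X Y => X `<=` Y) (D @` P)); last first.
  apply: Fchain => //.
  - by move=> _ [i Pi <-]; exact: FD.
  - move=> E ED [X EX].
    have [|i [Pi Ei] imin] := wo_min ltwo (A := [set i | P i /\ E (D i)]).
      by have [i Pi iX] := ED _ EX; exists i; split => //; rewrite iX.
    exists (D i) => // Y EY; have [j Pj jY] := ED _ EY.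
    have nji : ~ lt j i by apply: imin; split=> //; rewrite jY.
    rewrite -jY; have [->//|ij] := wo_nlt ltwo nji; exact: Dmono.
  - move=> _ [i Pi <-].
    suff cS : countable [set Y | (D @` P) Y /\ Y `<` D i].
      by apply/negP => LS; apply: Lunc; exact: sub_countable LS cS.
    apply: (@sub_countable _ _ _ (D @` seg lt P i)); last first.
      by apply: sub_countable (card_image_le _ _) (Pseg _ Pi).
    apply: subset_card_le => _ [[j Pj <-] [_ nji]].
    exists j => //; split=> //; apply: contrapT => nlt.
    apply: nji; have [->|ij] := wo_nlt ltwo nlt; [by []|exact: Dmono].
have /choice[r rP] X : exists i, C X -> P i /\ D i = X.
  have [CX|nCX] := pselect (C X); first by have [i Pi iX] := CD _ CX; exists i.
  have [i Pi] : P !=set0.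
    by apply/set0P/eqP => P0; apply: Punc; rewrite P0; exact: countable0.
  by exists i.
have [||i Pi iC] := omega1_sup ltwo Punc Pseg (C := r @` C).
- by move=> _ [X CX <-]; have [] := rP _ CX.
- exact: sub_countable (card_image_le _ _) cC.
suff -> : \bigcup_(X in D @` P) X = D i by exact: FD.
apply/seteqP; split=> [x [X DX Xx]|x Dix]; last by exists (D i) => //; exists i.
have [Y CY XY] := Ccof _ DX; have [Pr rY] := rP _ CY.
apply: (Dmono (r Y) i) => //; first by apply: iC; exists Y.
by rewrite rY; exact: XY.
Qed.

(** Alternately enlarge to a member of [F] and close under the functions, in
    omega_1 steps: the union of a chain of length omega need not be in [F]. *)
Lemma club_closed (L0 X : set T) (g : bool -> T -> T) : L0 #= L -> X #<= L ->
  exists D, [/\ F D, X `<=` D & forall b x, D x -> D (g b x)].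
Proof.
move=> L0L XL.
have [lt ltwo] := exists_wo (nat -> bool).
have [P [_ Punc Pseg]] := exists_omega1 ltwo continuum_uncountable.
have [||D DP] := wo_rec ltwo (set0 : set T) (R := fun i f u =>
   P i -> (forall j, seg lt P i j -> F (f j)) ->
   [/\ F u, X `<=` u & forall j, seg lt P i j -> f j `<=` u /\
        forall b, g b @` f j `<=` u]).
- move=> i f; have [Pi|nPi] := pselect (P i); last by exists set0.
  have [Ff|nFf] := pselect (forall j, seg lt P i j -> F (f j)); last by exists set0.
  have fL j : seg lt P i j -> f j #<= L.
    by move=> /Ff/FL/card_eqPle[].
  have [||D FD DP] := club_above (L0 := L0)
      (X := X `|` \bigcup_(j in seg lt P i) (f j `|` \bigcup_b (g b @` f j))).
  + by [].
  + apply: card_le_setU => //; apply: card_le_bigcup => //.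
      by apply: countable_card_le => //; exact: Pseg.
    move=> j /fL fjL; apply: card_le_setU => //; apply: card_le_bigcup => //.
      by apply: countable_card_le => //; exact: countableP.
    by move=> b _; apply: card_le_trans fjL; exact: card_image_le.
  exists D => _ _; split=> //; first by move=> x Xx; apply: DP; left.
  move=> j ij; split=> [x fx|b x gx]; apply: DP; right; exists j => //.
    by left.
  by right; exists b.
- move=> i f h u fh Ru Pi Fh.
  have fhE j : seg lt P i j -> f j = h j by move=> [_ /fh].
  have [|Fu Xu uP] := Ru Pi; first by move=> j ij; rewrite fhE//; exact: Fh.
  by split=> // j ij; rewrite -fhE//; exact: uP.
have FD i : P i -> F (D i).
  elim/(wo_ind ltwo): i => i IH Pi; have [] := DP i Pi; last by [].
  by move=> j [Pj ji]; exact: IH.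
have DPi i : P i -> [/\ F (D i), X `<=` D i & forall j, seg lt P i j -> D j `<=` D i /\
        forall b, g b @` D j `<=` D i].
  by move=> Pi; apply: DP => // j [Pj _]; exact: FD.
exists (\bigcup_(i in P) D i); split.
- apply: (club_omega1_chain ltwo) => // i j Pi Pj ij.
  by have [_ _ /(_ i)[]] := DPi _ Pj.
- have [i Pi] : P !=set0.
    by apply/set0P/eqP => P0; apply: Punc; rewrite P0; exact: countable0.
  by move=> x Xx; exists i => //; have [_ + _] := DPi _ Pi; apply.
- move=> b x [i Pi Dx].
  have [||j Pj /(_ i erefl) ij] := omega1_sup ltwo Punc Pseg (C := [set i]).
  + by move=> ? ->.
  + exact: countable1.
  exists j => //; have [_ _ /(_ i)[//|_ /(_ b)]] := DPi _ Pj.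
  by apply; exists x.
Qed.

End Clubs.

(** * Transfer of the ideal condition *)

(** [i] represents the elements of [A] in [B], and [psi] is a monotone left
    inverse. The order of a reduced power holds only up to finitely many
    coordinates, hence [i] need not be monotone; [tr n] is [i] with the first [n]
    coordinates enlarged so that they do not matter. *)
Section Transfer.
Context {dA dB : Order.disp_t} {A : ctbDistrLatticeType dA}.
Context {B : ctbDistrLatticeType dB}.
Variables (phi : A -> B) (phi' : B -> A).
Hypotheses (phiK : cancel phi phi') (phi'K : cancel phi' phi).
Variables (psi : B -> A) (i : A -> B) (tr : nat -> A -> B).
Hypothesis psi_mono : forall b c, (b <= c)%O -> (psi b <= psi c)%O.
Hypothesis psiK : forall a, psi (i a) = a.
Hypothesis psi_tr : forall n a, psi (tr n a) = a.
Hypothesis i_tr : forall a c, (a <= c)%O -> exists n, (i a <= tr n c)%O.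
Hypothesis psi_meet : forall a c, psi (meet (i a) (i c)) = meet a c.
Hypothesis psi_neg : forall a, psi (neg (i a)) = neg a.

Lemma regular_image (L : set A) :
  regular_uncountable L -> regular_uncountable (phi @` L).
Proof.
have phiI : injective phi := can_inj phiK.
have LL : phi @` L #= L by apply: inj_card_eq => x y _ _ /phiI.
move=> [Lunc Lreg]; split.
  move=> cL; apply: Lunc; apply: sub_countable cL.
  by move: LL => /card_eqPle[].
move=> G GL Gs GE; apply: (Lreg ((fun X => phi @^-1` X) @` G)).
- apply/negP => LG; move/negP: GL; apply.
  apply: card_le_trans (card_le_trans LG (card_image_le _ _)).
  by move: LL => /card_eqPle[].
- move=> _ [X GX <-]; apply/negP => LX; have /negP := Gs _ GX; apply.
  apply: (@card_le_trans _ _ _ (phi @^-1` X)).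
    by apply: card_le_trans LX; move: LL => /card_eqPle[].
  apply: (@card_le_rel _ _ _ _ (fun a b => b = phi a)) => [a Xa|a a' c _ _ -> /phiI//].
  by exists (phi a).
- apply/seteqP; split=> [a [_ [X GX <-] Xa]|a La].
    have : (\bigcup_(X in G) X) (phi a) by exists X.
    by rewrite GE => -[a' La' /phiI <-].
  have : (phi @` L) (phi a) by exists a.
  by rewrite -GE => -[X GX Xa]; exists (phi @^-1` X) => //; exists X.
Qed.

(** A subset of [A] is transported to [B] along a bijection, rather than along
    [i] or [psi], so that the transported sets determine the original ones and
    chains go to chains; closure under [i] and [psi] then makes the members of
    a transported set exactly those mapped by [i] into it. *)
Lemma star_transfer : star_aleph0_ideal B -> star_aleph0_ideal A.
Proof.
have phiI : injective phi := can_inj phiK.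
have phi_card (X : set A) : phi @` X #= X.
  by apply: inj_card_eq => x y _ _ /phiI.
move=> starB L Lreg LA.
have L'L := phi_card L.
have [||F [Fideal Fcof Fchain]] := starB (phi @` L).
- exact: regular_image.
- apply/negP => BL; move/negP: LA; apply.
  apply: (@card_le_trans _ _ _ [set: B]).
    apply: (@card_le_rel _ _ _ _ (fun a b => b = phi a)) => [a _|a a' c _ _ -> /phiI//].
    by exists (phi a).
  by apply: card_le_trans BL _; exact: card_image_le.
have Lunc' : ~ countable (phi @` L) by have [] := regular_image Lreg.
have FL D : F D -> D #= phi @` L by move=> /Fideal[].
pose g (b : bool) x := if b then i (phi' x) else phi (psi x).
pose FA := [set X : set A | F (phi @` X) /\
   forall b x, (phi @` X) x -> (phi @` X) (g b x)].
have memI (X : set A) a : (phi @` X) (phi a) <-> X a.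
  by split=> [[a' Xa' /phiI <-]//|Xa]; exists a.
have FAi X a : FA X -> X a <-> (phi @` X) (i a).
  move=> [_ Xg]; split=> [Xa|Xia].
    by have := Xg true (phi a); rewrite /g phiK; apply; exists a.
  by have := Xg false _ Xia; rewrite /g psiK memI.
have FApsi X b : FA X -> (phi @` X) b -> X (psi b).
  by move=> [_ Xg] /(Xg false); rewrite /g memI.
exists FA; split.
- move=> X FAX; have [FX _] := FAX.
  have [[[Xbot Xtop Xmeet Xjoin Xneg] Xid] XL] := Fideal _ FX.
  split; last first.
    apply: card_eq_trans (card_esym (phi_card X)) _.
    exact: card_eq_trans XL L'L.
  have Am a c : X a -> X c -> X (meet a c).
    move=> /(FAi _ _ FAX) Xa /(FAi _ _ FAX) Xc.
    by rewrite -psi_meet; apply: FApsi => //; exact: Xmeet.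
  have An a : X a -> X (neg a).
    move=> /(FAi _ _ FAX) Xa.
    by rewrite -psi_neg; apply: FApsi => //; exact: Xneg.
  have A0 : X bot.
    have Xp : X (psi bot) by exact: FApsi.
    by rewrite -(meetxC (psi bot)); apply: Am => //; exact: An.
  split.
    split=> //; first by rewrite -compl0; exact: An.
    move=> a c Xa Xc; rewrite -[join a c]complK complU.
    by apply/An/Am; exact: An.
  move=> b nXb.
  have ntr n : ~ (phi @` X) (tr n b).
    by move=> /(FApsi _ _ FAX); rewrite psi_tr.
  have /choice[C CP] n := Xid _ (ntr n).
  exists (\bigcup_n (psi @` C n)); split.
  + move=> _ [n _ [c Cc <-]]; have [Csub _ _] := CP n.
    have [Xc cb] := Csub _ Cc; have Xpc := FApsi _ _ FAX Xc.
    split=> //; rewrite lt_neqAle; apply/andP; split.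
      by apply/eqP => e; apply: nXb; rewrite -e.
    by rewrite -(psi_tr n b); apply: psi_mono; exact: ltW.
  + apply: bigcup_countable => // n _; have [_ cC _] := CP n.
    by apply: sub_countable cC; exact: card_image_le.
  + move=> a [Xa ab]; have [n ian] := i_tr (ltW ab).
    have [_ _ Ccof] := CP n.
    have [|c Cc ac] := Ccof (i a).
      split; first exact/FAi.
      rewrite lt_neqAle ian andbT; apply/eqP => e; apply: (ntr n).
      by rewrite -e; apply/FAi.
    exists (psi c); first by exists n => //; exists c.
    by rewrite -(psiK a); exact: psi_mono.
- move=> X XL.
  have [||D [FD XD Dg]] := club_closed (L := phi @` L) Lunc' FL Fcof Fchain
     (L0 := phi @` L) (X := phi @` X) g.
  + exact: card_eqxx.
  + apply: card_le_trans (card_image_le _ _) _.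
    have [XL' _] := (card_eqPle _ _).1 XL; apply: card_le_trans XL' _.
    by move: L'L => /card_eqPle[].
  have DE : phi @` (phi @^-1` D) = D.
    apply/seteqP; split=> [_ [a Da <-]//|b Db].
    by exists (phi' b); rewrite /= phi'K.
  exists (phi @^-1` D); first by split; rewrite DE.
  by move=> a Xa; apply: XD; exists a.
- move=> C CF Cwo Clen Ccof.
  pose C' := (fun X => phi @` X) @` C.
  have imS (X Y : set A) : phi @` X `<=` phi @` Y -> X `<=` Y.
    by move=> XY x Xx; apply/memI/XY; exists x.
  have UE : phi @` (\bigcup_(X in C) X) = \bigcup_(Y in C') Y.
    apply/seteqP; split=> [_ [a [X CX Xa] <-]|b [_ [X CX <-] [a Xa <-]]].
      by exists (phi @` X); [exists X|exists a].
    by exists a => //; exists X.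
  split; rewrite UE; last first.
    move=> b x [_ [X CX <-] Xx]; exists (phi @` X); first by exists X.
    by have [_ +] := CF _ CX; apply.
  apply: Fchain.
  + by move=> _ [X CX <-]; have [] := CF _ CX.
  + move=> E EC' [Y0 EY0]; have [X0 CX0 X0E] := EC' _ EY0.
    have [||X EX' Xmin] := Cwo [set X | C X /\ E (phi @` X)].
    * by move=> X [].
    * by exists X0; split=> //; rewrite X0E.
    exists (phi @` X); first by case: EX'.
    move=> Y EY; have [Z CZ ZY] := EC' _ EY.
    by rewrite -ZY; apply: image_subset; apply: Xmin; split=> //; rewrite ZY.
  + move=> _ [X CX <-]; apply/negP => LX; have /negP := Clen _ CX; apply.
    apply: (@card_le_trans _ _ _ (phi @` L)); first by move: L'L => /card_eqPle[].
    apply: card_le_trans LX _.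
    apply: (@card_le_rel _ _ _ _ (fun Y Z => Y = phi @` Z)); last first.
      by move=> Y Y' Z _ _ -> ->.
    move=> _ [[Z CZ <-] ZX]; exists Z => //; split=> //.
    split; first by apply: imS; case: ZX.
    by move=> XZ; case: ZX => _; apply; exact: image_subset.
  + move=> [E [EC' cE Ecof]]; apply: Ccof.
    exists [set X | C X /\ E (phi @` X)]; split.
    * by move=> X [].
    * apply: sub_countable cE.
      apply: (@card_le_rel _ _ _ _ (fun X Y => Y = phi @` X)) => [X [CX EX]|X Y Z _ _ ->].
        by exists (phi @` X).
      by move=> e; apply/seteqP; split; apply: imS; rewrite e.
    * move=> X CX; have [|Y EY XY] := Ecof (phi @` X); first by exists X.
      have [Z CZ ZY] := EC' _ EY; exists Z; first by split=> //; rewrite ZY.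
      by apply: imS; rewrite ZY.
Qed.

End Transfer.

(** * Splitting *)

Definition splits {d} {B : ctbDistrLatticeType d} (b a : B) : Prop :=
  meet a b <> bot /\ meet a (neg b) <> bot.

Lemma not_splits {d} {B : ctbDistrLatticeType d} (b a : B) :
  ~ splits b a -> (a <= b)%O \/ (a <= neg b)%O.
Proof.
move=> ns; have [e|ne] := eqVneq (meet a (neg b)) bot.
  by left; rewrite -[b]complK -disj_leC e.
have [e|ne'] := eqVneq (meet a b) bot; first by right; rewrite -disj_leC e.
by case: ns; split; exact/eqP.
Qed.

(** * Luzin families *)

Section Luzin.
Context {d : Order.disp_t} {B : ctbDistrLatticeType d} (L : set B).
Hypothesis Lunc : ~ countable L.
Hypothesis Lideal : lambda_aleph0_ideal B L.
Hypothesis Lsplit : forall Y : set B, Y #<= L -> (forall a, Y a -> a <> bot) ->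
  exists b, forall a, Y a -> splits b a.

(** Let [c j] split a member [D j] of the family of ideal subalgebras that
    contains all the [c i] with [i < j]. If uncountably many of the [c j] failed
    to split [a], then so would omega_1 many; the corresponding union [M] of the
    [D j] is again in the family, so the elements of [M] disjoint from [a] are
    generated by countably many, and one of these would lie above uncountably
    many of the [c j] or of their complements. But its complement lies in some
    [D j] with such a [c j], which splits it. *)
Lemma luzin_family {J : Type} (P : set J) : P #<= L ->
  exists c : J -> B, forall a, a <> bot -> countable [set j | P j /\ ~ splits (c j) a].
Proof.
move=> PL; have Linf := uncountable_infinite Lunc.
have [F [Fideal Fcof Fchain]] := Lideal.
have FL D : F D -> D #= L by move=> /Fideal[].
have /choice[sp spP] D : exists b, F D -> forall a, D a -> a <> bot -> splits b a.
  have [FD|nFD] := pselect (F D); last by exists bot.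
  have [|a []//|b bP] := Lsplit (Y := [set a | D a /\ a <> bot]).
    apply: (@card_le_trans _ _ _ D); first by apply: subset_card_le => a [].
    by have /card_eqPle[] := FL _ FD.
  by exists b => _ a Da a0; exact: bP.
have [lt ltwo] := exists_wo J.
have [||D DP] := wo_rec ltwo (set0 : set B) (R := fun i f u =>
   P i -> (forall j, seg lt P i j -> F (f j)) ->
   F u /\ forall j, seg lt P i j -> f j `<=` u /\ u (sp (f j))).
- move=> i f; have [Pi|nPi] := pselect (P i); last by exists set0.
  have [Ff|nFf] := pselect (forall j, seg lt P i j -> F (f j)); last by exists set0.
  have [||D FD DP] := club_above Lunc Fcof (L0 := L)
     (X := \bigcup_(j in seg lt P i) (f j `|` [set sp (f j)])).
  + exact: card_eqxx.
  + apply: card_le_bigcup => //.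
      by apply: card_le_trans PL; apply: subset_card_le => j [].
    move=> j /Ff/FL/card_eqPle[fL _]; apply: card_le_setU => //.
    by apply: countable_card_le => //; exact: countable1.
  exists D => _ _; split=> // j ij; split; last by apply: DP; exists j => //; right.
  by move=> x fx; apply: DP; exists j => //; left.
- move=> i f h u fh Ru Pi Fh.
  have fhE j : seg lt P i j -> f j = h j by move=> [_ /fh].
  have [|Fu uP] := Ru Pi; first by move=> j ij; rewrite fhE//; exact: Fh.
  by split=> // j ij; rewrite -fhE//; exact: uP.
have FD i : P i -> F (D i).
  elim/(wo_ind ltwo): i => i IH Pi; have [] := DP i Pi; last by [].
  by move=> j [Pj ji]; exact: IH.
have DPi i j : P i -> P j -> lt j i -> D j `<=` D i /\ D i (sp (D j)).
  move=> Pi Pj ji; have [|_ +] := DP i Pi; first by move=> k [Pk _]; exact: FD.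
  by apply.
exists (fun j => sp (D j)) => a a0; apply: contrapT => Aunc.
have [Q [QA Qunc Qseg]] := exists_omega1 ltwo Aunc.
have QP j : Q j -> P j by move=> /QA[].
have Qns j : Q j -> ~ splits (sp (D j)) a by move=> /QA[].
have Qsup j : Q j -> exists2 i, Q i & lt j i.
  move=> Qj; have [||i Qi /(_ j erefl)] := omega1_sup ltwo Qunc Qseg (C := [set j]).
  - by move=> ? ->.
  - exact: countable1.
  by exists i.
pose M := \bigcup_(j in Q) D j.
have FM : F M.
  apply: (club_omega1_chain Lunc Fchain ltwo) => //.
    by move=> i /QP/FD.
  by move=> i j /QP Pi /QP Pj ij; have [] := DPi _ _ Pj Pi ij.
have alg E : F E -> subalgebra E by move=> /Fideal[[]].
have nMa : ~ M a.
  move=> [j Qj Dja]; have [i Qi ji] := Qsup _ Qj; apply: (Qns i Qi).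
  apply: spP => //; first exact/FD/QP.
  by have [+ _] := DPi _ _ (QP _ Qi) (QP _ Qj) ji; apply.
have [[_ _ _ _ Mneg] Mid] := (Fideal _ FM).1.
have nMna : ~ M (neg a) by move=> /Mneg; rewrite complK.
have [E [EM cE Ecof]] := Mid _ nMna.
have QE j : Q j -> exists2 e, E e & (sp (D j) <= e)%O \/ (neg (sp (D j)) <= e)%O.
  move=> Qj; have [i Qi ji] := Qsup _ Qj.
  have Msp : M (sp (D j)) by exists i => //; have [] := DPi _ _ (QP _ Qi) (QP _ Qj) ji.
  have lt_na x : M x -> (x <= neg a)%O -> (x < neg a)%O.
    by move=> Mx xa; rewrite lt_neqAle xa andbT; apply/eqP => e; rewrite e in Mx.
  have [asp|ansp] := not_splits (Qns _ Qj).
    have [|e Ee ee] := Ecof (neg (sp (D j))); last by exists e => //; right.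
    by split; [exact: Mneg|apply: lt_na; [exact: Mneg|rewrite leC]].
  have [|e Ee ee] := Ecof (sp (D j)); last by exists e => //; left.
  by split => //; apply: lt_na => //; rewrite lexC.
pose Qe e := [set j | Q j /\ ((sp (D j) <= e)%O \/ (neg (sp (D j)) <= e)%O)].
have [e [Ee Qeunc]] : exists e, E e /\ ~ countable (Qe e).
  apply: contrapT => no; apply: Qunc.
  have : countable (\bigcup_(e in E) Qe e).
    apply: bigcup_countable => // e Ee; apply: contrapT => nc.
    by apply: no; exists e.
  apply: sub_countable; apply: subset_card_le => j Qj.
  by have [e Ee ee] := QE _ Qj; exists e.
have [[k Qk Dke] ea] := EM _ Ee.
have [j [[Qj je] kj]] : exists j, Qe e j /\ lt k j.
  apply: contrapT => no; apply: Qeunc.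
  have : countable (seg lt Q k `|` [set k]).
    apply: (card_le_setU infinite_nat); first exact: Qseg.
    exact: countable1.
  apply: sub_countable; apply: subset_card_le => j Qej.
  have [|->|jk] := wo_nlt ltwo (x := k) (y := j).
  - by move=> kj; apply: no; exists j.
  - by right.
  - by left; split=> //; case: Qej.
have Dje : D j (neg e).
  have [_ _ _ _ Dneg] := alg _ (FD _ (QP _ Qj)); apply: Dneg.
  by have [+ _] := DPi _ _ (QP _ Qj) (QP _ Qk) kj; apply.
have ne0 : neg e <> bot.
  move=> e0; apply: a0; apply/eqP; rewrite -lex0 -e0.
  by rewrite lexC; exact: ltW.
have [s1 s2] := spP _ (FD _ (QP _ Qj)) _ Dje ne0.
case: je => je; [apply: s1|apply: s2]; apply/eqP; rewrite meetC disj_leC.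
  by rewrite complK.
by rewrite complK.
Qed.

End Luzin.

(** * A criterion for regularity *)

(** [L] has the size of the successor of [N], and a successor is regular because
    a union of [N] many sets of size at most [N] is not larger than [N]. *)
Lemma successor_regular {T U} (lt : T -> T -> Prop) (L : set T) (N : set U) :
  wo lt -> infinite_set N -> ~ (L #<= N) ->
  (forall v, L v -> [set u | L u /\ ~ lt v u] #<= N) -> regular_uncountable L.
Proof.
move=> ltwo Ninf nLN LN.
have small (V : Type) (Y : set V) : ~ (L #<= Y) -> Y #<= N.
  move=> nLY.
  have [t0 Lt0] : L !=set0.
    by apply/set0P/eqP => L0; apply: nLN; rewrite L0; exact: card_ge0.
  have [f [fL fi]] := card_le_inj t0 (card_leNgt nLY).
  have fY : f @` Y #= Y by apply: inj_card_eq => x y /set_mem Yx /set_mem Yy; exact: fi.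
  have [YfY fYY] := (card_eqPle _ _).1 fY.
  apply: card_le_trans fYY _.
  have [[v [Lv vY]]|unb] := pselect (exists v, L v /\ forall y, (f @` Y) y -> ~ lt v y).
    apply: card_le_trans (LN _ Lv); apply: subset_card_le => y fYy.
    by split; [case: fYy => ? ? <-; exact: fL|exact: vY].
  have [//|NY] := card_le_total (f @` Y) N.
  exfalso; apply: nLY; apply: (card_le_trans _ YfY).
  apply: (@card_le_trans _ _ _ (\bigcup_(y in f @` Y) [set u | L u /\ ~ lt y u])).
    apply: subset_card_le => u Lu; apply: contrapT => nu; apply: unb; exists u.
    split=> // y fYy uy; apply: nu; exists y => //; split=> // yu.
    exact: wo_irr ltwo _ (wo_trans ltwo uy yu).
  apply: card_le_bigcup.
  - by apply: contra_not Ninf => fin; exact: card_le_finite fin.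
  - exact: card_lexx.
  - by move=> y [x Yx <-]; apply: card_le_trans NY; exact/LN/fL.
split; first by move=> cL; apply: nLN; exact: countable_card_le.
move=> G GL Gs GE; apply: nLN; rewrite -GE; apply: card_le_bigcup => //.
  by apply: small; exact/negP.
by move=> A /Gs/negP; exact: small.
Qed.

(** * Splitting in the power set modulo finite *)

Section PowerSetModFinite.
Context {d : Order.disp_t} {B : ctbDistrLatticeType d}.
Variable q : (nat -> bool) -> B.
Hypothesis qP : reduced_power q.

Lemma rpb_neq0 u : q u <> bot <-> io u.
Proof.
rewrite (rp_neq0 qP); split; apply: ioW => n; first by move=> /eqP; case: (u n).
by move=> ->.
Qed.

Lemma rpb_splits b a :
  splits (q b) (q a) <-> io (fun n => a n && b n) /\ io (fun n => a n && ~~ b n).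
Proof.
by rewrite /splits -(rp_neg qP) -!(rp_meet qP) !rpb_neq0.
Qed.

(** The branches of the binary tree are almost disjoint. *)
Lemma continuum_le_rpb : continuum #<= [set: B].
Proof.
pose br (x : nat -> bool) n := n == pickle (mkseq x (size (odflt [::] (unpickle n : option (seq bool))))).
apply: (@card_le_rel _ _ _ _ (fun x b => b = q (br x))) => [x _|x y c _ _ -> e].
  by exists (q (br x)).
have {}e : ev (fun n => br x n = br y n) by apply/(rp_eq qP).
apply/funext => k; have [m mP] := e.
have brE z j : br z (pickle (mkseq z j)).
  by rewrite /br pickleK /= size_mkseq.
have [j [kj mj]] : exists j, (k < j)%N /\ (m <= pickle (mkseq x j))%N.
  apply: contrapT => no.
  have /card_le_finite : [set: nat] #<= `I_m.
    apply: (@card_le_rel _ _ _ _ (fun j n => n = pickle (mkseq x (k + j).+1))).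
      move=> j _; eexists; last reflexivity; rewrite /= ltnNge; apply/negP => mj.
      by apply: no; exists (k + j).+1; rewrite ltnS leq_addr.
    move=> j j' _ _ _ -> /(pcan_inj pickleK)/(congr1 size).
    by rewrite !size_mkseq => -[/addnI].
  by move=> /(_ (finite_II m))/infinite_nat.
have := mP _ mj; rewrite brE /br pickleK /= size_mkseq => /esym/eqP.
move=> /(pcan_inj pickleK)/(congr1 (fun s => nth false s k)).
by rewrite !nth_mkseq.
Qed.

(** Take a block partition in which the [j]-th block meets the first [j] sets,
    and split every set by the union of the blocks of odd index. *)
Lemma countable_split (X : set B) : countable X -> (forall a, X a -> a <> bot) ->
  exists b, forall a, X a -> splits b a.
Proof.
move=> cX X0; have [s [sX Xs]] := countable_sequence cX.
have /choice[u uE] i : exists u, q u = s i by exact: (rp_surj qP).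
have /choice[nx nxP] (p : nat * nat) :
    exists n, io (u p.1) -> (p.2 <= n)%N /\ u p.1 n.
  have [iou|nio] := pselect (io (u p.1)); last by exists 0%N.
  by have [n mn un] := iou p.2; exists n.
pose g := fix g j := if j is j'.+1 then
  (g j' + \sum_(i < j) nx (i : nat, g j')).+1 else 0%N.
have gS j : g j.+1 = (g j + \sum_(i < j.+1) nx (i : nat, g j)).+1 by [].
have g_incr m : (g m < g m.+1)%N by rewrite gS ltnS leq_addr.
have [h [_ [hE _]]] := block_index g_incr.
exists (q (fun n => odd (h n))) => a Xa; have [i ia] := Xs _ Xa.
have ioi : io (u i) by apply/rpb_neq0; rewrite uE ia; exact: X0.
have key j : (i <= j)%N -> exists2 n, (j <= n)%N & u i n /\ h n = j.
  move=> ij; have [gn un] := nxP (i, g j) ioi.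
  exists (nx (i, g j)); first exact: leq_trans (incr_ge g_incr j) gn.
  split=> //; apply: hE; rewrite gn andTb gS ltnS.
  by rewrite (bigD1 (Ordinal (ij : (i < j.+1)%N)))//= addnCA leq_addr.
rewrite -ia -uE; apply/rpb_splits; split=> m.
  have [|n jn [un hn]] := key (maxn i m).*2.+1.
    by rewrite -addnn ltnW// ltnS (leq_trans (leq_maxl i m))// leq_addr.
  exists n; last by rewrite un hn /= odd_double.
  by rewrite (leq_trans _ jn)// -addnn ltnW// ltnS (leq_trans (leq_maxr i m))// leq_addr.
have [|n jn [un hn]] := key (maxn i m).*2.
  by rewrite -addnn (leq_trans (leq_maxl i m))// leq_addr.
exists n; last by rewrite un hn odd_double.
by rewrite (leq_trans _ jn)// -addnn (leq_trans (leq_maxr i m))// leq_addr.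
Qed.

(** Let [b] agree with [c j] on the [j]-th block of a partition into intervals.
    If the partition is not dominated, then for each [e] infinitely many blocks
    are long enough to show that [c j] splits [y e]. *)
Lemma diagonal_split {E : Type} (W : set E) (y : E -> B) (c : nat -> B) :
  undominated -> ~ (continuum #<= W) ->
  (forall e, W e -> ev (fun j => splits (c j) (y e))) ->
  exists b, forall e, W e -> splits b (y e).
Proof.
move=> domc nW Wc.
have /choice[be beE] j : exists u, q u = c j by exact: (rp_surj qP).
have /choice[et etE] e : exists u, q u = y e by exact: (rp_surj qP).
pose good e j n l := (exists k, [/\ n <= k, k < l, et e k & be j k]%N) /\
  (exists k, [/\ n <= k, k < l, et e k & ~~ be j k]%N).
have /choice[psi psiP] (p : E * nat * nat) :
    exists l, splits (c p.1.2) (y p.1.1) -> good p.1.1 p.1.2 p.2 l.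
  have [sp|nsp] := pselect (splits (c p.1.2) (y p.1.1)); last by exists 0%N.
  move: sp; rewrite -beE -etE => /rpb_splits[io1 io2].
  have [k1 nk1 /andP[e1 b1]] := io1 p.2; have [k2 nk2 /andP[e2 b2]] := io2 p.2.
  exists (maxn k1 k2).+1 => _; split; [exists k1|exists k2]; split=> //.
    by rewrite ltnS leq_maxl.
  by rewrite ltnS leq_maxr.
(* if the blocks with endpoints [g] are too short for [e] from the [j0]-th one
   on, then [fr e (g j0) j0] bounds [g]; [G e] bounds all these functions
   eventually *)
pose fr e v j0 := fix fr j := if j is j'.+1 then
   if (j <= j0)%N then v else (\max_(n < (fr j').+1) psi (e, j', n : nat))%N else v.
have frE e v j0 : fr e v j0 j0 = v by case: j0 => [|j0] //=; rewrite leqnn.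
have frS e v j0 j n : (j0 <= j)%N -> (n <= fr e v j0 j)%N ->
    (psi (e, j, n) <= fr e v j0 j.+1)%N.
  move=> jj nf /=; rewrite ltnNge jj /=.
  exact: (@leq_bigmax _ (fun n : 'I__ => psi (e, j, n : nat)) (Ordinal (nf : (n < _.+1)%N))).
pose G e j := (\max_(j0 < j.+1) \max_(v < j.+1) fr e v j0 j)%N.
have [|h0 h0P] := domc (G @` W).
  by move=> cG; apply: nW; exact: card_le_trans cG (card_image_le _ _).
pose g j := (\sum_(i < j.+1) (h0 i).+1)%N.
have g_incr m : (g m < g m.+1)%N.
  by rewrite /g [X in (_ < X)%N]big_ord_recr /= -addn1 leq_add2l.
have gh0 m : (h0 m <= g m)%N by rewrite /g big_ord_recr /= addnS ltnW// ltnS leq_addl.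
have [h [_ [hE _]]] := block_index g_incr.
exists (q (fun n => be (h n) n)) => e We.
have [m0 m0P] := Wc _ We.
have iog : io (fun j => (m0 <= j)%N /\ (psi (e, j, g j) <= g j.+1)%N).
  move=> m; apply: contrapT => no; pose m1 := maxn m m0.
  have gpsi j : (m1 <= j)%N -> (g j.+1 < psi (e, j, g j))%N.
    rewrite geq_max => /andP[mj m0j]; rewrite ltnNge; apply/negP => psg.
    by apply: no; exists j.
  have gfr k : (g (m1 + k) <= fr e (g m1) m1 (m1 + k))%N.
    elim: k => [|k IH]; first by rewrite addn0 frE.
    rewrite addnS; apply: leq_trans (ltnW (gpsi _ (leq_addr _ _))) _.
    by apply: frS => //; exact: leq_addr.
  have [|k] := h0P (G e) _ (maxn m1 (g m1)); first by exists e.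
  rewrite geq_max => /andP[m1k g1k]; rewrite ltnNge => /negP; apply.
  apply: leq_trans (gh0 _) _.
  have {1}-> : k = (m1 + (k - m1))%N by rewrite subnKC.
  apply: leq_trans (gfr _) _; rewrite subnKC//.
  apply: leq_trans (leq_bigmax (Ordinal (m1k : (m1 < k.+1)%N))) => /=.
  exact: (@leq_bigmax _ (fun v : 'I_k.+1 => fr e v m1 k) (Ordinal (g1k : (g m1 < k.+1)%N))).
have inblock j k l : (l <= g j.+1)%N -> (g j <= k)%N -> (k < l)%N -> h k = j.
  by move=> lg gk kl; apply: hE; rewrite gk (leq_trans kl).
rewrite -etE; apply/rpb_splits; split=> m.
  have [j mj [m0j psg]] := iog m.
  have [[k [gk kl ek bk]] _] := psiP (e, j, g j) (m0P _ m0j).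
  exists k; first exact: leq_trans (leq_trans mj (incr_ge g_incr j)) gk.
  by rewrite ek (inblock _ _ _ psg gk kl).
have [j mj [m0j psg]] := iog m.
have [_ [k [gk kl ek bk]]] := psiP (e, j, g j) (m0P _ m0j).
exists k; first exact: leq_trans (leq_trans mj (incr_ge g_incr j)) gk.
by rewrite ek (inblock _ _ _ psg gk kl).
Qed.

End PowerSetModFinite.

(** * Covering countable sets *)

(** [y] is a family indexed by [W] which no element splits, and [W] is least in
    the sense that all families indexed by its proper initial segments can be
    split. *)
Section Covering.
Context {d : Order.disp_t} {B : ctbDistrLatticeType d}.
Variable q : (nat -> bool) -> B.
Hypothesis qP : reduced_power q.
Hypothesis starB : star_aleph0_ideal B.
Hypothesis domc : undominated.
Variables (lt : B -> B -> Prop) (W O : set B) (y : B -> B).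
Hypothesis ltwo : wo lt.
Hypothesis nW : ~ (continuum #<= W).
Hypothesis y0 : forall e, W e -> y e <> bot.
Hypothesis yns : forall b, exists2 e, W e & ~ splits b (y e).
Hypothesis Wmin : forall v, W v -> forall Y : set B, Y #<= seg lt W v ->
  (forall a, Y a -> a <> bot) -> exists b, forall a, Y a -> splits b a.
Hypothesis OW : O `<=` W.
Hypothesis Ounc : ~ countable O.

Let Oinf : infinite_set O := uncountable_infinite Ounc.
Let Winf : infinite_set W.
Proof. by apply: contra_not Oinf; exact: sub_finite_set. Qed.

(** In the application [O] has size omega_1, and this is a bound on a covering
    number: |[W]| many sets of size omega_1 contain all countable subsets. *)
Definition covered (Y : set B) := exists A : B -> set B,
  (forall e, W e -> A e #<= O) /\
  forall K, countable K -> K `<=` Y -> exists2 e, W e & K `<=` A e.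

Let le v : set B := [set u | W u /\ ~ lt v u].

Let leE v : W v -> le v = seg lt W v `|` [set v].
Proof.
move=> Wv; apply/seteqP; split=> [u [Wu nvu]|u [[Wu uv]|->]].
- by have [->|uv] := wo_nlt ltwo nvu; [right|left].
- by split=> // vu; exact: wo_irr ltwo _ (wo_trans ltwo uv vu).
- by split=> //; exact: wo_irr.
Qed.

Let le_seg v : W v -> infinite_set (le v) -> le v #<= seg lt W v.
Proof.
move=> Wv; rewrite leE// => inf.
have sinf : infinite_set (seg lt W v).
  apply: contra_not inf => fin; rewrite finite_setU; split=> //; exact: finite_set1.
by apply: card_le_setU => //; apply: countable_card_le => //; exact: countable1.
Qed.

Let le_total v w : W v -> W w -> le v `<=` le w \/ le w `<=` le v.
Proof.
move=> Wv Ww; have [vw|nvw] := pselect (lt v w).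
  left=> u [Wu nvu]; split=> // wu; exact: nvu (wo_trans ltwo vw wu).
right=> u [Wu nwu]; split=> // vu.
have [e|wv] := wo_nlt ltwo nvw; first by apply: nwu; rewrite e.
exact: nwu (wo_trans ltwo wv vu).
Qed.

(** The case of a limit of cofinality omega whose proper initial segments are
    smaller: a countable subset [i] of [Y] is coded by its finite initial
    segments [s j], which index members of Luzin families. Some [y e] is left
    unsplit by infinitely many of these, while it is left unsplit by countably
    many members of the Luzin families only. *)
Lemma covered_cofinality_omega (Y K0 : set B) :
  Y `<=` W -> (forall v u, Y v -> W u -> lt u v -> Y u) ->
  ~ (Y #<= O) -> (forall v, Y v -> ~ (Y #<= seg lt W v)) ->
  countable K0 -> K0 `<=` Y -> (forall v, Y v -> ~ (K0 `<=` seg lt W v)) ->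
  covered Y.
Proof.
move=> YW Ydown nYO nYseg cK0 K0Y K0unb.
have Yunc : ~ countable Y by move=> cY; apply: nYO; exact: countable_card_le.
have K0W k : K0 k -> W k by move=> /K0Y/YW.
have Yle : Y `<=` \bigcup_(k in K0) le k.
  move=> v Yv; apply: contrapT => no; apply: (K0unb v Yv) => k K0k.
  split; first exact: K0W.
  by apply: contrapT => nkv; apply: no; exists k => //; split=> //; exact: YW.
have [k1 [K0k1 k1unc]] : exists k, K0 k /\ ~ countable (le k).
  apply: contrapT => no; apply: Yunc; apply: sub_countable (subset_card_le Yle) _.
  apply: bigcup_countable => // k K0k; apply: contrapT => nc; apply: no; by exists k.
have reg k : K0 k -> exists rho, [/\ W rho, regular_uncountable (seg lt W rho) &
    le k #<= seg lt W rho].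
  move=> K0k.
  have [m [K0m km k1m]] : exists m, [/\ K0 m, le k `<=` le m & le k1 `<=` le m].
    by have [kk|kk] := le_total (K0W _ K0k) (K0W _ K0k1);
      [exists k1|exists k]; split=> //; exact: subset_refl.
  have munc : ~ countable (le m).
    by move=> cm; apply: k1unc; apply: sub_countable cm; exact: subset_card_le.
  have minf := uncountable_infinite munc.
  have mle := le_seg (K0W _ K0m) minf.
  have Ninf : infinite_set (seg lt W m).
    by apply: contra_not minf => fin; exact: card_le_finite fin.
  have [v [Yv nv]] : exists v, Y v /\ ~ (seg lt W v #<= seg lt W m).
    apply: contrapT => no; apply: (nYseg m (K0Y _ K0m)).
    apply: card_le_trans (subset_card_le Yle) _.
    apply: card_le_bigcup => //; first exact: countable_card_le.
    move=> k' K0k'; rewrite leE; last exact: K0W.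
    apply: card_le_setU => //; last by apply: countable_card_le => //; exact: countable1.
    by apply: contrapT => nk'; apply: no; exists k'; split=> //; exact: K0Y.
  have [|rho [Yrho nrho] rmin] :=
      wo_min ltwo (A := [set v | Y v /\ ~ (seg lt W v #<= seg lt W m)]).
    by exists v.
  exists rho; split; first exact: YW.
    apply: (successor_regular (N := seg lt W m) ltwo) => // u [Wu urho].
    apply: (@card_le_trans _ _ _ (le u)).
      by apply: subset_card_le => w [[Ww _] nuw].
    rewrite leE//; apply: card_le_setU => //; last first.
      by apply: countable_card_le => //; exact: countable1.
    apply: contrapT => nu; apply: (rmin u) => //; split=> //.
    exact: Ydown urho.
  apply: card_le_trans (card_leNgt nrho).
  by apply: card_le_trans mle; exact: subset_card_le.
have /choice[c cP] k : exists c : seq B -> B, K0 k -> forall a, a <> bot ->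
    countable [set s : seq B | {in s, forall x, le k x} /\ ~ splits (c s) a].
  have [K0k|nK0k] := pselect (K0 k); last by exists (fun=> bot).
  have [rho [Wrho rreg krho]] := reg _ K0k.
  have [runc _] := rreg.
  have [|||c cP] := luzin_family runc _ _
      (P := [set s : seq B | {in s, forall x, le k x}]).
  - apply: starB => //; apply/negP => Br; apply: nW.
    apply: card_le_trans (continuum_le_rpb qP) _; apply: card_le_trans Br _.
    by apply: subset_card_le => u [].
  - exact: Wmin.
  - by apply: card_le_seq => //; exact: uncountable_infinite.
  by exists c.
exists (fun e => [set x | exists2 k, K0 k & exists s : seq B,
  [/\ {in s, forall x, le k x}, ~ splits (c k s) (y e) & x \in s]]).
split=> [e We|K cK KY].
  apply: countable_card_le => //.
  have : countable (\bigcup_(k in K0) \bigcup_(s in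
      [set s : seq B | {in s, forall x, le k x} /\ ~ splits (c k s) (y e)]) [set` s]).
    apply: bigcup_countable => // k K0k; apply: bigcup_countable.
      exact: cP (y0 We).
    by move=> s _; exact/finite_set_countable/finite_seq.
  apply: sub_countable; apply: subset_card_le => x [k K0k [s [sk sns xs]]].
  by exists k => //; exists s.
have [t [tK Kt]] := countable_sequence cK.
have [->|/set0P[x0 Kx0]] := eqVneq K set0.
  by have [e We _] := yns bot; exists e.
have [i iK Ki] : exists2 i : nat -> B, (forall n, K (i n)) & (forall x, K x -> exists n, i n = x).
  exists (fun n => if `[< K (t n) >] then t n else x0).
    by move=> n; case: asboolP.
  by move=> x Kx; have [n nx] := Kt _ Kx; exists n; rewrite nx; case: asboolP.
have bound (s : seq B) : {in s, forall x, K x} -> exists k, K0 k /\ {in s, forall x, le k x}.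
  elim: s => [|x s IH] sK.
    by exists k1; split.
  have [k [K0k sk]] : exists k, K0 k /\ {in s, forall x, le k x}.
    by apply: IH => z zs; apply: sK; rewrite inE zs orbT.
  have [k' K0k' xk'] : (\bigcup_(k in K0) le k) x.
    by apply/Yle/KY/sK; rewrite inE eqxx.
  have [kk|kk] := le_total (K0W _ K0k) (K0W _ K0k').
    exists k'; split=> // z; rewrite inE => /orP[/eqP->//|/sk]; exact: kk.
  exists k; split=> // z; rewrite inE => /orP[/eqP->|/sk//]; exact: kk.
have /choice[k kP] j : exists k, K0 k /\ {in mkseq i j, forall x, le k x}.
  by apply: bound => x /mapP[n _ ->].
have [e We ens] : exists2 e, W e & io (fun j => ~ splits (c (k j) (mkseq i j)) (y e)).
  apply: contrapT => no.
  have [|b bP] := diagonal_split qP (c := fun j => c (k j) (mkseq i j)) (y := y) domc nW.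
    move=> e We; apply: contrapT => /not_ev nev; apply: no; by exists e.
  by have [e We] := yns b; apply; exact: bP.
exists e => // x Kx; have [n <-] := Ki _ Kx.
have [j nj jns] := ens n.+1; have [K0k kj] := kP j.
exists (k j) => //; exists (mkseq i j); split=> //.
by apply/mapP; exists n => //; rewrite mem_iota.
Qed.

(** The bound is inherited by a larger initial segment [Y]: trivially if [Y] is
    not larger than [O] or not larger than a proper initial segment, by collecting
    the covers of the proper initial segments if every countable subset is
    bounded, and in the remaining case the cofinality is omega. *)
Lemma covered_step (Y : set B) :
  Y `<=` W -> (forall v u, Y v -> W u -> lt u v -> Y u) ->
  (forall v, Y v -> covered (seg lt W v)) -> covered Y.
Proof.
move=> YW Ydown IH.
have [w0 Ww0] := infinite_setN0 Winf.
have [YO|nYO] := pselect (Y #<= O).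
  by exists (fun=> Y); split=> // K _ KY; exists w0.
have [[v [Yv Yseg]]|nYseg] := pselect (exists v, Y v /\ Y #<= seg lt W v).
  have [A [AO Acov]] := IH _ Yv; have [f [fY fi]] := card_le_inj w0 Yseg.
  exists (fun e => [set x | Y x /\ A e (f x)]); split=> [e We|K cK KY].
    apply: card_le_trans (AO _ We).
    apply: (@card_le_rel _ _ _ _ (fun x z => z = f x)) => [x [Yx Ax]|x x' _ [Yx _] [Yx' _] ->].
      by exists (f x).
    exact: fi.
  have [||e We Ke] := Acov (f @` K).
  - exact: sub_countable (card_image_le _ _) cK.
  - by move=> _ [x Kx <-]; exact/fY/KY.
  by exists e => // x Kx; split; [exact: KY|apply: Ke; exists x].
have [bd|nbd] := pselect (forall K, countable K -> K `<=` Y ->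
    exists v, Y v /\ K `<=` seg lt W v).
  have /choice[A AP] v : exists A : B -> set B, Y v -> (forall e, W e -> A e #<= O) /\
      forall K, countable K -> K `<=` seg lt W v -> exists2 e, W e & K `<=` A e.
    have [Yv|nYv] := pselect (Y v); last by exists (fun=> set0).
    by have [A AP] := IH _ Yv; exists A.
  have [p [pW pi]] := card_le_inj w0 (card_le_square Winf).
  exists (fun e => [set x | exists v e', [/\ Y v, W e', p (v, e') = e & A v e' x]]).
  split=> [e We|K cK KY].
    have [[v [e' [Yv We' pe]]]|no] :=
        pselect (exists v e', [/\ Y v, W e' & p (v, e') = e]).
      have [AO _] := AP _ Yv.
      apply: card_le_trans (AO _ We'); apply: subset_card_le => x [v' [e'' [Yv' We'' pe' Ax]]].
      have [<- <-] // : (v', e'') = (v, e').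
      by apply: pi; [split=> //; exact: YW|split=> //; exact: YW|rewrite pe].
    apply: (@card_le_trans _ _ _ (set0 : set B)); last exact: card_ge0.
    apply: subset_card_le => x [v [e' [Yv We' pe _]]]; apply: no; by exists v, e'.
  have [v [Yv Kv]] := bd _ cK KY; have [_ Acov] := AP _ Yv.
  have [e We Ke] := Acov _ cK Kv; exists (p (v, e)).
    by apply: pW; split=> //; exact: YW.
  by move=> x Kx; exists v, e; split=> //; exact: Ke.
move/existsNP: nbd => [K0 /not_implyP[cK0 /not_implyP[K0Y K0unb]]].
apply: (covered_cofinality_omega YW Ydown nYO _ cK0 K0Y).
  by move=> v Yv Yseg; apply: nYseg; exists v.
by move=> v Yv K0v; apply: K0unb; exists v.
Qed.

Lemma countable_sets_covered : covered W.
Proof.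
apply: covered_step => // v Wv; elim/(wo_ind ltwo): v Wv => v IH Wv.
apply: covered_step => [u []//|u w [Wu uv] Ww wu|u [Wu uv]].
  by split=> //; exact: wo_trans wu uv.
exact: IH.
Qed.

End Covering.

(** * Coding reals along the binary tree *)

Section Tree.
Context {d : Order.disp_t} {B : ctbDistrLatticeType d}.
Variable q : (nat -> bool) -> B.
Hypothesis qP : reduced_power q.

Local Notation node := (seq bool).
Local Notation point := (nat -> bool).

Definition io_node (P : node -> Prop) := forall m, exists2 s : node, (m <= pickle s)%N & P s.

Lemma io_nodeW (P Q : node -> Prop) : (forall s, P s -> Q s) -> io_node P -> io_node Q.
Proof. by move=> PQ iP m; have [s ms /PQ] := iP m; exists s. Qed.

Definition qnode (U : pred node) : B :=
  q (fun n => if pickle_inv n is Some s then U s else false).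

Lemma le_boolP (a b : bool) : (a <= b)%O <-> (a -> b).
Proof. by case: a; case: b; split=> // /(_ isT). Qed.

Lemma pickle_inv_some n (s : node) : pickle_inv n = Some s -> n = pickle s.
Proof. by move=> e; have := @pickle_invK node n; rewrite e. Qed.

Lemma qnode_le_rep (U : pred node) (r : nat -> bool) : (qnode U <= q r)%O <->
  exists m, forall s, (m <= pickle s)%N -> U s -> r (pickle s).
Proof.
split=> [/(rp_le qP)[m mP]|[m mP]].
  by exists m => s /mP; rewrite pickleK_inv => /le_boolP.
apply/(rp_le qP); exists m => n mn; apply/le_boolP.
case e : (pickle_inv n) => [s|//]; move: mn; rewrite (pickle_inv_some e).
exact: mP.
Qed.

Lemma qnode_le (U V : pred node) : (qnode U <= qnode V)%O <->
  exists m, forall s, (m <= pickle s)%N -> U s -> V s.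
Proof.
by rewrite qnode_le_rep; split=> -[m mP]; exists m => s /mP; rewrite pickleK_inv.
Qed.

Lemma qnode_disj (U V : pred node) : (forall s, U s -> ~~ V s) -> meet (qnode U) (qnode V) = bot.
Proof.
move=> UV; rewrite -(rp_meet qP); apply/(rp_eq0 qP)/evT => n.
by case: (pickle_inv n) => [s|//]; case: (boolP (U s)) => // /UV/negPf ->.
Qed.

Definition cone (s : node) : B := qnode (prefix s).

Definition branch (x : point) : B := qnode (fun s => s == mkseq x (size s)).

(** Almost all nodes in a representative of [t] extend any given initial segment
    of [x]. *)
Definition converges (t : B) (x : point) := t <> bot /\ forall k, (t <= cone (mkseq x k))%O.

Lemma prefix_mkseq (x : point) j k : (j <= k)%N -> prefix (mkseq x j) (mkseq x k).
Proof.
move=> jk; rewrite prefixE size_mkseq /mkseq -map_take take_iota.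
by rewrite (minn_idPl jk).
Qed.

Lemma prefix_same_size (s t u : node) : size s = size t ->
  prefix s u -> prefix t u -> s = t.
Proof. by rewrite !prefixE => st /eqP <- /eqP <-; rewrite st. Qed.

Lemma prefix_mkseqE (s : node) (x : point) k : prefix s (mkseq x k) -> s = mkseq x (size s).
Proof.
move=> sx; have sk : (size s <= k)%N by have := size_prefix sx; rewrite size_mkseq.
by apply: (prefix_same_size _ sx (prefix_mkseq x sk)); rewrite size_mkseq.
Qed.

Lemma mkseq_neq (x z : point) : x <> z -> ev (fun k => mkseq x k <> mkseq z k).
Proof.
move=> xz; have [n xn] : exists n, x n <> z n.
  by apply: contrapT => no; apply: xz; apply/funext => n; apply: contrapT => nn; apply: no; exists n.
exists n.+1 => k nk e; apply: xn.
by rewrite -(nth_mkseq false x nk) e nth_mkseq.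
Qed.

Lemma branch_neq0 x : branch x <> bot.
Proof.
apply/(rpb_neq0 qP) => m; apply: contrapT => no.
have /card_le_finite : [set: nat] #<= `I_m.
  apply: (@card_le_rel _ _ _ _ (fun j n => n = pickle (mkseq x j))).
    move=> j _; eexists; last reflexivity; rewrite /= ltnNge; apply/negP => mj.
    by apply: no; eexists; first exact: mj; rewrite pickleK_inv size_mkseq.
  move=> j j' _ _ _ -> /(pcan_inj pickleK_inv)/(congr1 size).
  by rewrite !size_mkseq.
by move=> /(_ (finite_II m))/infinite_nat.
Qed.

Lemma branch_converges x : converges (branch x) x.
Proof.
split=> [|k]; first exact: branch_neq0.
have [m mP] : ev (fun n => forall j, (j < k)%N -> n <> pickle (mkseq x j)).
  apply: ev_forall_lt => j _; exists (pickle (mkseq x j)).+1 => n jn e.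
  by rewrite e ltnn in jn.
apply/qnode_le; exists m => s ms /eqP sE.
have [ks|sk] := leqP k (size s); first by rewrite sE prefix_mkseq.
by case: (mP _ ms _ sk); rewrite -sE.
Qed.

Lemma converges_uniq t x z : converges t x -> converges t z -> x = z.
Proof.
move=> [t0 tx] [_ tz]; apply: contrapT => /mkseq_neq[k /(_ k (leqnn k)) xz].
apply: t0; apply/eqP; rewrite -lex0.
have <- : meet (cone (mkseq x k)) (cone (mkseq z k)) = bot.
  apply: qnode_disj => s xs; apply/negP => zs; apply: xz.
  by apply: prefix_same_size xs zs; rewrite !size_mkseq.
by rewrite lexI tx tz.
Qed.

(** Koenig's lemma. *)
Lemma accumulation_point (U : node -> Prop) : io_node U ->
  exists p : point, forall k, io_node (fun s => U s /\ prefix (mkseq p k) s).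
Proof.
move=> ioU.
have /choice[nb nbP] (s : node) : exists b : bool,
    io_node (fun t => U t /\ prefix s t) -> io_node (fun t => U t /\ prefix (rcons s b) t).
  have [yes|no] := pselect (io_node (fun t => U t /\ prefix (rcons s true) t)).
    by exists true.
  exists false => ios; move/existsNP: no => [m0 nm0] m.
  have [t] := ios (maxn (maxn m m0) (pickle s).+1).
  rewrite !geq_max => /andP[/andP[mt m0t] st] [Ut /prefixP[[|b u] tE]].
    by rewrite tE cats0 ltnn in st.
  exists t => //; split=> //; rewrite tE.
  case: b tE => tE; last by rewrite -cat_rcons prefix_prefix.
  by case: nm0; exists t => //; split=> //; rewrite tE -cat_rcons prefix_prefix.
pose sg := fix sg n := if n is n'.+1 then rcons (sg n') (nb (sg n')) else [::] : node.
exists (fun n => nb (sg n)) => k.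
have -> : mkseq (fun n => nb (sg n)) k = sg k.
  by elim: k => // k IH; rewrite mkseqS IH.
elim: k => [|k IH] /=; last exact: nbP.
by apply: io_nodeW ioU => s Us; rewrite prefix0s.
Qed.

(** [U] has infinitely many accumulation points in the Cantor space. *)
Definition good (U : node -> Prop) := forall P : seq point,
  exists2 p, p \notin P & forall k, io_node (fun s => U s /\ prefix (mkseq p k) s).

(** A list [l] of nodes stands for the union of their cones. The finitely many
    nodes below a member of [l] belong neither to it nor to its outside, so that
    the branch of a point in this union avoids the outside completely. *)
Definition cone_in (l : seq node) : pred node := fun s => has (fun u => prefix u s) l.
Definition cone_out (l : seq node) : pred node :=
  fun s => ~~ has (fun u => prefix u s || prefix s u) l.
Definition in_cones (l : seq node) (x : point) := has (fun u => u == mkseq x (size u)) l.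

Lemma in_cones_out l x k : in_cones l x -> ~~ cone_out l (mkseq x k).
Proof.
move=> /hasP[u ul /eqP ux]; rewrite negbK; apply/hasP; exists u => //.
have [uk|/ltnW ku] := leqP (size u) k.
  by have := prefix_mkseq x uk; rewrite -ux => ->.
by have := prefix_mkseq x ku; rewrite -ux => ->; rewrite orbT.
Qed.

Lemma in_cones_in l x k : ~~ in_cones l x -> ~~ cone_in l (mkseq x k).
Proof.
apply: contraNN => /hasP[u ul ux]; apply/hasP; exists u => //.
by apply/eqP; exact: prefix_mkseqE ux.
Qed.

(** Choose distinct points [p i], [r i], all of them accumulation points of the
    [i]-th set, and let the [n]-th finite union of cones contain [p 0 ... p n]
    but none of [r 0 ... r n]. *)
Lemma splitting_cones {I : Type} (Z : set I) (U : I -> node -> Prop) : countable Z ->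
  exists f : nat -> seq node, forall t, Z t -> good (U t) -> ev (fun n =>
    io_node (fun s => U t s /\ cone_in (f n) s) /\
    io_node (fun s => U t s /\ cone_out (f n) s)).
Proof.
move=> cZ.
have [[t0 [Zt0 gt0]]|no] := pselect (exists t, Z t /\ good (U t)); last first.
  by exists (fun=> [::]) => t Zt gt; case: no; exists t.
have [tt [ttg ttZ]] : exists tt : nat -> I, (forall i, good (U (tt i))) /\
    forall t, Z t -> good (U t) -> exists i, tt i = t.
  have [f [_ fi]] := card_le_inj 0%N cZ.
  have /choice[tt ttP] i : exists t, good (U t) /\
      forall t', Z t' -> good (U t') -> f t' = i -> t = t'.
    have [[t [Zt gt ft]]|nt] := pselect (exists t, [/\ Z t, good (U t) & f t = i]).
      by exists t; split=> // t' Zt' _ ft'; apply: fi => //; rewrite ft ft'.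
    by exists t0; split=> // t' Zt' gt' ft'; case: nt; exists t'.
  exists tt; split=> [i|t Zt gt]; first by have [] := ttP i.
  by exists (f t); have [_] := ttP (f t); apply.
pose acc i (p : point) := forall k, io_node (fun s => U (tt i) s /\ prefix (mkseq p k) s).
have natwo : wo (fun i j : nat => (i < j)%N).
  split; [|by move=> x y z; exact: ltn_trans|].
    move=> n; elim/ltn_ind: n => n IH; exact: Acc_intro.
  by move=> i j; case: (ltngtP i j) => [ij|ji|->]; [left|right; right|right; left].
pose fresh i (f : nat -> point * point) (u : point * point) :=
  [/\ acc i u.1, acc i u.2, u.1 <> u.2 & forall j, (j < i)%N ->
    [/\ u.1 <> (f j).1, u.1 <> (f j).2, u.2 <> (f j).1 & u.2 <> (f j).2]].
have [||pp ppP] := wo_rec natwo ((fun=> true, fun=> true) : point * point) (R := fresh).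
- move=> i f; pose P := flatten [seq [:: (f j).1; (f j).2] | j <- iota 0 i].
  have [p pP pacc] := ttg i P; have [r rP racc] := ttg i (p :: P).
  exists (p, r); split=> //=.
    by move=> e; move: rP; rewrite inE -e eqxx.
  move: rP; rewrite inE negb_or => /andP[_ rP] j ji.
  have mem1 : (f j).1 \in P.
    by apply/flattenP; exists [:: (f j).1; (f j).2]; rewrite ?inE ?eqxx//;
      apply/mapP; exists j => //; rewrite mem_iota.
  have mem2 : (f j).2 \in P.
    by apply/flattenP; exists [:: (f j).1; (f j).2]; rewrite ?inE ?eqxx ?orbT//;
      apply/mapP; exists j => //; rewrite mem_iota.
  split=> e; [move: pP|move: pP|move: rP|move: rP]; rewrite e; exact/negP/negPn.
- move=> i f h u fh [a1 a2 ne nf]; split=> // j ji; rewrite -fh//; exact: nf.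
have ppne i j : (pp i).1 <> (pp j).2.
  case: (ltngtP i j) => [ij|ji|->].
  - have [_ _ _ /(_ i ij)[_ _ + _]] := ppP j.
    by move=> ne e; apply: ne.
  - by have [_ _ _ /(_ j ji)[_ + _ _]] := ppP i.
  - by have [] := ppP j.
have /choice[k kP] n : exists k, forall i, (i < n.+1)%N -> forall j, (j < n.+1)%N ->
    mkseq (pp i).1 k <> mkseq (pp j).2 k.
  have [m mP] : ev (fun k => forall i, (i < n.+1)%N -> forall j, (j < n.+1)%N ->
      mkseq (pp i).1 k <> mkseq (pp j).2 k).
    apply: ev_forall_lt => i _; apply: ev_forall_lt => j _.
    exact: mkseq_neq (ppne i j).
  by exists m; exact: mP.
exists (fun n => [seq mkseq (pp i).1 (k n) | i <- iota 0 n.+1]) => t Zt gt.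
have [i <-] := ttZ _ Zt gt; have [acc1 acc2 _ _] := ppP i.
exists i => n iN; split.
  apply: io_nodeW (acc1 (k n)) => s [Us ps]; split=> //; apply/hasP.
  exists (mkseq (pp i).1 (k n)) => //; apply/mapP; exists i => //.
  by rewrite mem_iota.
apply: io_nodeW (acc2 (k n)) => s [Us ps]; split=> //.
apply/negP => /hasP[u /mapP[j + ->]]; rewrite mem_iota /= add0n => jn.
have ne := kP n j jn i iN.
move=> /orP[js|sj]; apply: ne.
  by apply: prefix_same_size js ps; rewrite !size_mkseq.
apply/esym; apply: prefix_same_size (prefix_trans ps sj) (prefix_refl _).
by rewrite !size_mkseq.
Qed.

Variable rep : B -> nat -> bool.
Hypothesis repE : forall t, q (rep t) = t.

Definition outside (t : B) (s : node) : Prop := ~~ rep t (pickle s).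

(** Otherwise the part of the complement of [t] inside some neighbourhood of
    [x] would converge to [x]. *)
Lemma good_outside (t : B) (x : point) : meet t (branch x) = bot ->
  (forall k, ~ converges (meet (neg t) (cone (mkseq x k))) x) -> good (outside t).
Proof.
move=> tx nconv P.
have [k kP] : exists k, forall p, p \in P -> p = x \/ mkseq p k <> mkseq x k.
  suff [m mP] : ev (fun k => forall p, p \in P -> p = x \/ mkseq p k <> mkseq x k).
    by exists m; exact: mP.
  elim: P => [|p P IH]; first by apply: evT.
  have [->|px] := pselect (p = x).
    apply: evW IH => k kP r; rewrite inE => /orP[/eqP->|/kP//]; by left.
  apply: evW (evI IH (mkseq_neq px)) => k [kP pk] r.
  by rewrite inE => /orP[/eqP->|/kP//]; right.
have bt : (branch x <= neg t)%O by rewrite -disj_leC meetC tx.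
have [bx0 bxk] := branch_converges x.
have [j nj] : exists j, ~ (meet (neg t) (cone (mkseq x k)) <= cone (mkseq x j))%O.
  apply: contrapT => no; apply: (nconv k); split=> [e|j].
    apply: bx0; apply/eqP; rewrite -lex0 -e lexI bt; exact: bxk.
  by apply: contrapT => nj; apply: no; exists j.
have [|p pP] := accumulation_point (U := fun s =>
    [/\ outside t s, prefix (mkseq x k) s & ~~ prefix (mkseq x j) s]).
  move=> m; apply: contrapT => no; apply: nj.
  rewrite -{1}(repE t) -(rp_neg qP) -(rp_meet qP); apply/(rp_le qP).
  exists m => n mn; apply/le_boolP.
  case e : (pickle_inv n) => [s|]; last by rewrite meetC.
  have en := pickle_inv_some e.
  move=> /andP[nts xs]; apply: contrapT => /negP nxs; apply: no.
  by exists s; rewrite -?en//; split=> //; rewrite /outside -en.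
exists p; last by move=> i; apply: io_nodeW (pP i) => s [[? _ _] ?].
have [s _ [[_ xs _] ps]] := pP k 0%N.
have pxk : mkseq p k = mkseq x k by apply: prefix_same_size ps xs; rewrite !size_mkseq.
have [s' _ [[_ _ /negP nxs] ps']] := pP j 0%N.
by apply/negP => /kP[e|//]; apply: nxs; rewrite -e.
Qed.

End Tree.

(** * The ideal condition bounds the reaping number *)

Section Unreaped.
Context {d : Order.disp_t} {B : ctbDistrLatticeType d}.
Variable q : (nat -> bool) -> B.
Hypothesis qP : reduced_power q.
Hypothesis starB : star_aleph0_ideal B.
Hypothesis domc : undominated.

Local Notation node := (seq bool).
Local Notation point := (nat -> bool).

(** Let [O] be the initial part of type omega_1 of [W], let the sets [A e] of
    size omega_1 contain all countable subsets of [W], and let [F] be a family of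
    ideal subalgebras of size omega_1. Build members [D al e] of [F], for [al] in
    [O] and [e] in [W], that contain all [D be e'] with [be] below [al] and [e'] in
    [A e], and the elements [dec] computed from these. Their union [N] is smaller
    than the continuum, hence some real [x] is not the limit of an element of [N];
    let [b] be the branch of [x] in the binary tree.

    For a subalgebra [M] among the [D al e], the elements of [M] disjoint from
    [b] have a countable cofinal subset, and the complement of each of these
    accumulates at infinitely many points, since otherwise part of it would
    converge to [x]. So there are finite unions [f n] of cones such
    that each of these complements is split by almost all [f n]. The set of the
    [n] such that [x] is in [f n] fails to split some [y e]. Hence, for almost all
    [n] in [y e], the point [x] is on the same side of [f n]; the union [dec] of
    the opposite sides is disjoint from [b], but it meets the complement of each
    member of the cofinal set.

    The element [dec] is in general not in [M]. Therefore the construction is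
    repeated along a sequence [S] of length omega_1 of subalgebras, each
    containing the elements [dec] of the earlier ones. The covering sets [A e]
    make the limit steps possible. The union [MM] is again in [F], and the
    countable cofinal subset of the elements of [MM] disjoint from [b] already
    lies in some [M (S i)], to which the argument applies. *)
Lemma minimal_unsplit_absurd (lt : B -> B -> Prop) (W : set B) (y : B -> B) :
  wo lt -> ~ (continuum #<= W) -> (forall e, W e -> y e <> bot) ->
  (forall b, exists2 e, W e & ~ splits b (y e)) ->
  (forall v, W v -> forall Y : set B, Y #<= seg lt W v ->
     (forall a, Y a -> a <> bot) -> exists b, forall a, Y a -> splits b a) ->
  False.
Proof.
move=> ltwo nW y0 yns Wmin.
have Wunc : ~ countable W.
  move=> cW; have [||b bP] := countable_split qP (X := y @` W).
  - exact: sub_countable (card_image_le _ _) cW.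
  - by move=> _ [e We <-]; exact: y0.
  by have [e We] := yns b; apply; apply: bP; exists e.
have Winf := uncountable_infinite Wunc.
have [O [OW Ounc Oseg]] := exists_omega1 ltwo Wunc.
have Oinf := uncountable_infinite Ounc.
have [A [AO Acov]] := countable_sets_covered qP starB domc ltwo nW y0 yns Wmin OW Ounc.
have WleO X : countable X -> X #<= O by move=> cX; exact: (countable_card_le Oinf cX).
have [F [Fideal Fcof Fchain]] : lambda_aleph0_ideal B O.
  apply: starB.
    apply: (successor_regular (N := [set: nat]) ltwo) => //; first exact: infinite_nat.
    move=> v Ov; apply: (@card_le_trans _ _ _ (seg lt O v `|` [set v])).
      apply: subset_card_le => u [Ou nvu].
      by have [->|uv] := wo_nlt ltwo nvu; [right|left].
    by apply: (card_le_setU infinite_nat); [exact: Oseg|exact: countable1].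
  apply/negP => BO; apply: nW; apply: card_le_trans (continuum_le_rpb qP) _.
  by apply: card_le_trans BO _; exact: subset_card_le.
have FL D : F D -> D #= O by move=> /Fideal[].
have FlO D : F D -> D #<= O by move=> /FL/card_eqPle[].
have /choice[rep repE] t : exists u, q u = t by exact: (rp_surj qP).
have [o0 Oo0] := infinite_setN0 Oinf.
(* enumerations of the members of [F] in type omega_1 *)
have /choice[en enP] D : exists f : B -> B, F D -> forall t, D t -> exists2 xi, O xi & f xi = t.
  have [FD|nFD] := pselect (F D); last by exists id.
  have [g [gO gi]] := card_le_inj o0 (FlO _ FD).
  have /choice[f fP] xi : exists t, forall t', D t' -> g t' = xi -> t = t'.
    have [[t [Dt gt]]|no] := pselect (exists t, D t /\ g t = xi); last first.
      by exists bot => t' Dt' gt'; case: no; exists t'.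
    by exists t => t' Dt' gt'; apply: gi => //; rewrite gt gt'.
  exists f => _ t Dt; exists (g t); first exact: gO.
  exact: fP.
(* the first [eta] members of [D]; a countable subset of [D] is contained in one
   of these sets *)
pose Z D eta := en D @` seg lt O eta.
have /choice[ff ffP] (p : set B * B) : exists f : nat -> seq node, O p.2 ->
    forall t, Z p.1 p.2 t -> good (outside rep t) -> ev (fun n =>
    io_node (fun s => outside rep t s /\ cone_in (f n) s) /\
    io_node (fun s => outside rep t s /\ cone_out (f n) s)).
  have [Op|nOp] := pselect (O p.2); last by exists (fun=> [::]).
  have [|f fP] := splitting_cones (Z := Z p.1 p.2) (outside rep).
    by apply: sub_countable (Oseg _ Op); exact: card_image_le.
  by exists f.
(* the union over the [n >= k] in [y e] of the sides [g (f n)], where [g] selects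
   the inside or the outside *)
pose dec (g : seq node -> pred node) (f : nat -> seq node) e k :=
  qnode q (fun s => `[< exists2 n, (k <= n)%N & rep (y e) n /\ g (f n) s >]).
have [||D DP] := wo_rec ltwo ((fun=> set0) : B -> set B) (R := fun al D u =>
   O al -> (forall be e, seg lt O al be -> W e -> F (D be e)) ->
   forall e, W e -> [/\ F (u e), range (cone q) `<=` u e &
     forall be e', seg lt O al be -> W e' -> A e e' -> D be e' `<=` u e /\
       forall eta e'' k, O eta -> W e'' -> A e e'' ->
         u e (dec cone_in (ff (D be e', eta)) e'' k) /\
         u e (dec cone_out (ff (D be e', eta)) e'' k)]).
- move=> al D; have [Oal|nOal] := pselect (O al); last by exists (fun=> set0).
  have [FD|nFD] := pselect (forall be e, seg lt O al be -> W e -> F (D be e));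
    last by exists (fun=> set0).
  have /choice[u uP] e : exists u : set B, W e -> [/\ F u, range (cone q) `<=` u &
     forall be e', seg lt O al be -> W e' -> A e e' -> D be e' `<=` u /\
       forall eta e'' k, O eta -> W e'' -> A e e'' ->
         u (dec cone_in (ff (D be e', eta)) e'' k) /\
         u (dec cone_out (ff (D be e', eta)) e'' k)]; last by exists u => _ _.
  have [We|nWe] := pselect (W e); last by exists set0.
  have AOe : [set e' | W e' /\ A e e'] #<= O.
    by apply: card_le_trans (AO _ We); apply: subset_card_le => e' [].
  have [||u Fu uP] := club_above Ounc Fcof (L0 := O) (X := range (cone q) `|`
      \bigcup_(be in seg lt O al) \bigcup_(e' in [set e' | W e' /\ A e e'])
        (D be e' `|` \bigcup_(eta in O) \bigcup_(e'' in [set e' | W e' /\ A e e'])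
          \bigcup_(k in [set: nat])
          [set dec cone_in (ff (D be e', eta)) e'' k;
               dec cone_out (ff (D be e', eta)) e'' k])).
  + exact: card_eqxx.
  + apply: card_le_setU => //.
      by apply: WleO; apply: sub_countable (card_image_le _ _) (countableP _).
    apply: card_le_bigcup => //; first exact/WleO/Oseg.
    move=> be abe; apply: card_le_bigcup => // e' [We' Aee'].
    apply: card_le_setU => //; first exact/FlO/FD.
    apply: card_le_bigcup => // eta Oeta; apply: card_le_bigcup => // e'' _.
    apply: card_le_bigcup => [//||k _]; first exact/WleO/countableP.
    by apply/WleO/finite_set_countable/finite_set2.
  exists u => _; split=> //; first by move=> t ct; apply: uP; left.
  move=> be e' abe We' Aee'; split=> [t Dt|eta e'' k Oeta We'' Aee''].
    by apply: uP; right; exists be => //; exists e' => //; left.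
  split; apply: uP; right; exists be => //; exists e' => //; right;
    exists eta => //; exists e'' => //; exists k => //; by [left|right].
- move=> al D D' u DD' Ru Oal FD' e We.
  have FD be e' : seg lt O al be -> W e' -> F (D be e').
    by move=> [Obe beal]; rewrite DD'//; exact: FD'.
  have [Fu cu uP] := Ru Oal FD e We; split=> // be e' [Obe beal] We' Aee'.
  by rewrite -DD'//; exact: uP.
have FD al e : O al -> W e -> F (D al e).
  elim/(wo_ind ltwo): al e => al IH e Oal We.
  have [|//|] := DP al Oal _ e; first by move=> be e' [Obe beal]; exact: IH.
  by [].
have DPa al e : O al -> W e -> [/\ F (D al e), range (cone q) `<=` D al e &
     forall be e', seg lt O al be -> W e' -> A e e' -> D be e' `<=` D al e /\
       forall eta e'' k, O eta -> W e'' -> A e e'' ->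
         D al e (dec cone_in (ff (D be e', eta)) e'' k) /\
         D al e (dec cone_out (ff (D be e', eta)) e'' k)].
  by move=> Oal We; apply: DP => // be e' [Obe _]; exact: FD.
pose N := \bigcup_(al in O) \bigcup_(e in W) D al e.
have OleW : O #<= W by exact: subset_card_le.
have nN : ~ (continuum #<= N).
  move=> cN; apply: nW; apply: card_le_trans cN _.
  apply: card_le_bigcup => // al Oal; apply: card_le_bigcup => // e We.
  by apply: card_le_trans OleW; exact/FlO/FD.
have DN al e : O al -> W e -> D al e `<=` N.
  by move=> Oal We t Dt; exists al => //; exists e.
have [x xN] : exists x : point, forall t, N t -> ~ converges q t x.
  apply: contrapT => no; apply: nN.
  apply: (@card_le_rel _ _ _ _ (fun x t => converges q t x)) => [x _|x x' t _ _ tx tx'].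
    by apply: contrapT => nx; apply: no; exists x => t Nt tx; apply: nx; exists t.
  exact: converges_uniq tx tx'.
pose b := branch q x.
have nNb : ~ N b by move=> Nb; exact: xN Nb (branch_converges qP x).
have /choice[w wP] (f : nat -> seq node) : exists e, W e /\
    ~ splits (q (fun n => in_cones (f n) x)) (y e).
  by have [e We ens] := yns (q (fun n => in_cones (f n) x)); exists e.
(* a subalgebra inside [N] does not contain [neg b], because [b] converges to [x] *)
have ideal D0 : F D0 -> D0 `<=` N -> exists E : set B, [/\ E `<=` D0, countable E,
    forall t, E t -> (t <= neg b)%O &
    forall t, D0 t -> (t <= neg b)%O -> exists2 t', E t' & (t <= t')%O].
  move=> FD0 D0N; have [[[_ _ _ _ Dneg] Did] _] := Fideal _ FD0.
  have nDnb : ~ D0 (neg b) by move=> /Dneg; rewrite complK => /D0N.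
  have [E [ED cE Ecof]] := Did _ nDnb; exists E; split=> //.
  - by move=> t /ED[].
  - by move=> t /ED[_ /ltW].
  - move=> t Dt tb; have [|t' Et' tt'] := Ecof t; last by exists t'.
    by split=> //; rewrite lt_neqAle tb andbT; apply/eqP => e; apply: nDnb; rewrite -e.
have /choice[eta etaP] D0 : exists eta, F D0 -> D0 `<=` N -> O eta /\
    forall t, D0 t -> (t <= neg b)%O ->
      exists t', [/\ D0 t', Z D0 eta t', (t' <= neg b)%O & (t <= t')%O].
  have [[FD0 D0N]|no] := pselect (F D0 /\ D0 `<=` N); last first.
    by exists o0 => FD0 D0N; case: no.
  have [E [ED cE Eb Ecof]] := ideal _ FD0 D0N.
  have /choice[xi xiP] t : exists xi, D0 t -> O xi /\ en D0 xi = t.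
    have [Dt|nDt] := pselect (D0 t); last by exists o0.
    by have [xi Oxi xit] := enP _ FD0 _ Dt; exists xi.
  have [||eta Oeta etaE] := omega1_sup ltwo Ounc Oseg (C := xi @` E).
  - by move=> _ [t /ED /xiP[Oxi _] <-].
  - exact: sub_countable (card_image_le _ _) cE.
  exists eta => _ _; split=> // t Dt tb; have [t' Et' tt'] := Ecof _ Dt tb.
  have [Oxi xiE] := xiP _ (ED _ Et').
  exists t'; split=> //; [exact: ED| |exact: Eb].
  by exists (xi t') => //; split=> //; apply: etaE; exists t'.
pose M (p : B * B) := D p.1 p.2.
pose f (p : B * B) := ff (M p, eta (M p)).
have [||S SP] := wo_rec ltwo (o0, o0) (R := fun i S u =>
   O i -> (forall j, seg lt O i j -> O (S j).1 /\ W (S j).2) ->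
   [/\ O u.1, W u.2 & forall j, seg lt O i j ->
     [/\ lt (S j).1 u.1, A u.2 (S j).2 & A u.2 (w (f (S j)))]]).
- move=> i S; have [Oi|nOi] := pselect (O i); last by exists (o0, o0).
  have [SO|nS] := pselect (forall j, seg lt O i j -> O (S j).1 /\ W (S j).2);
    last by exists (o0, o0).
  have [||be Obe beS] := omega1_sup ltwo Ounc Oseg (C := (fun j => (S j).1) @` seg lt O i).
  + by move=> _ [j /SO[] ? _ <-].
  + by apply: sub_countable (card_image_le _ _) (Oseg _ Oi).
  have [||e We eS] := Acov ((fun j => (S j).2) @` seg lt O i `|`
                            (fun j => w (f (S j))) @` seg lt O i).
  + apply: (card_le_setU infinite_nat);
      by apply: sub_countable (card_image_le _ _) (Oseg _ Oi).
  + by move=> _ [[j /SO[] _ ? <-//]|[j _ <-]]; have [] := wP (f (S j)).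
  exists (be, e) => _ _; split=> // j ij; split.
  + by apply: beS; exists j.
  + by apply: eS; left; exists j.
  + by apply: eS; right; exists j.
- move=> i S S' u SS' Ru Oi SO'.
  have SO j : seg lt O i j -> O (S j).1 /\ W (S j).2.
    by move=> /[dup] ij [_ ji]; rewrite SS'//; exact: SO'.
  have [? ? uP] := Ru Oi SO; split=> // j /[dup] ij [_ ji].
  by rewrite -SS'//; exact: uP.
have SO i : O i -> O (S i).1 /\ W (S i).2.
  elim/(wo_ind ltwo): i => i IH Oi.
  by have [|] := SP i Oi; first by move=> j [Oj ji]; exact: IH.
have SPi i j : O i -> seg lt O i j ->
    [/\ lt (S j).1 (S i).1, A (S i).2 (S j).2 & A (S i).2 (w (f (S j)))].
  move=> Oi ij; have [|_ _ +] := SP i Oi; first by move=> k [Ok _]; exact: SO.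
  exact.
have FM i : O i -> F (M (S i)) by move=> /SO[]; exact: FD.
have MN i : O i -> M (S i) `<=` N by move=> /SO[]; exact: DN.
have Mstep i j : O i -> seg lt O i j -> M (S j) `<=` M (S i) /\
    forall k, M (S i) (dec cone_in (f (S j)) (w (f (S j))) k) /\
              M (S i) (dec cone_out (f (S j)) (w (f (S j))) k).
  move=> Oi ij; have [Oj _] := ij; have [OSi WSi] := SO _ Oi; have [OSj WSj] := SO _ Oj.
  have [ltS AS Aw] := SPi _ _ Oi ij.
  have [_ _ /(_ (S j).1 (S j).2 (conj OSj ltS) WSj AS)[MM Mdec]] := DPa _ _ OSi WSi.
  split=> // k; apply: Mdec => //; last by have [] := wP (f (S j)).
  by have [] := etaP _ (FM _ Oj) (MN _ Oj).
pose MM := \bigcup_(i in O) M (S i).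
have FMM : F MM.
  by apply: (club_omega1_chain Ounc Fchain ltwo) => // i j Oi Oj ij; have [] := Mstep j i Oj.
have MMN : MM `<=` N by move=> t [i Oi Mt]; exact: MN Mt.
have [E [EMM cE Eb Ecof]] := ideal _ FMM MMN.
have /choice[id idP] t : exists i, E t -> O i /\ M (S i) t.
  have [Et|nEt] := pselect (E t); last by exists o0.
  by have [i Oi Mt] := EMM _ Et; exists i.
have [||i Oi iE] := omega1_sup ltwo Ounc Oseg (C := id @` E).
- by move=> _ [t /idP[] Oi _ <-].
- exact: sub_countable (card_image_le _ _) cE.
have EM : E `<=` M (S i).
  move=> t Et; have [Oid Mt] := idP _ Et.
  by have [|+ _] := Mstep i (id t) Oi; [split=> //; apply: iE; exists t|apply].
have [||i' Oi' /(_ i erefl) ii'] := omega1_sup ltwo Ounc Oseg (C := [set i]).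
- by move=> ? ->.
- exact: countable1.
have [_ Mdec] := Mstep i' i Oi' (conj Oi ii').
have [Oeta etaE] := etaP _ (FM _ Oi) (MN _ Oi).
set e := w (f (S i)) in Mdec; have [We ens] := wP (f (S i)); rewrite -/e in We ens.
have ioe : io (rep (y e)) by apply/(rpb_neq0 qP); rewrite repE; exact: y0.
(* an element of [MM] disjoint from [b] lies below a member of [E], whose
   complement is split by almost all [f n] *)
have absurd g k : (g = cone_in \/ g = cone_out) -> MM (dec g (f (S i)) e k) ->
    (dec g (f (S i)) e k <= neg b)%O -> False.
  move=> gE Mg gb; have [t Et gt] := Ecof _ Mg gb.
  have [t' [Mt' Zt' t'b tt']] := etaE _ (EM _ Et) (Eb _ Et).
  have [[[_ _ Mmeet _ Mneg] _] _] := Fideal _ (FM _ Oi).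
  have cones : range (cone q) `<=` M (S i).
    by have [OSi WSi] := SO _ Oi; have [] := DPa _ _ OSi WSi.
  have gt' : good (outside rep t').
    apply: (good_outside qP repE (x := x)) => [|k'].
      by apply/eqP; rewrite disj_leC.
    apply: xN; apply: (MN _ Oi); apply: Mmeet; first exact: Mneg.
    by apply: cones; exists (mkseq x k').
  have evf := ffP (M (S i), eta (M (S i))) Oeta _ Zt' gt'.
  have [n kn [[io1 io2] en']] := ev_io evf ioe k.
  have [s0 _ _] := io1 0%N.
  have : (dec g (f (S i)) e k <= q (rep t'))%O by rewrite repE; exact: le_trans tt'.
  move=> /(qnode_le_rep qP)[m mP].
  have [s ms [ts gs]] : exists2 s : node, (m <= pickle s)%N &
      outside rep t' s /\ g (f (S i) n) s by case: gE => ->; [exact: io1|exact: io2].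
  move/negP: ts; apply; apply: mP => //; apply/asboolP.
  by exists n.
have disj g k : (forall n j, (k <= n)%N -> rep (y e) n -> ~~ g (f (S i) n) (mkseq x j)) ->
    (dec g (f (S i)) e k <= neg b)%O.
  move=> gx; rewrite -disj_leC; apply/eqP; apply: (qnode_disj qP) => s /asboolP[n kn [en' gs]].
  apply/eqP => sx; move: gs; rewrite sx; exact/negP/gx.
have [] := not_splits ens; rewrite -(repE (y e)) -1?(rp_neg qP) => /(rp_le qP)[k kP].
  apply: (absurd cone_out k); [by right|by exists i' => //; exact: (Mdec k).2|].
  apply: disj => n j kn en'; apply: in_cones_out.
  by have /le_boolP := kP _ kn; exact.
apply: (absurd cone_in k); [by left|by exists i' => //; exact: (Mdec k).1|].
apply: disj => n j kn en'; apply: in_cones_in.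
by have /le_boolP := kP _ kn; exact.
Qed.

(** Among the initial segments of a well-order, the least one that indexes an
    unsplit family satisfies the hypotheses of the previous lemma. *)
Lemma small_split (X : set B) : ~ (continuum #<= X) -> (forall a, X a -> a <> bot) ->
  exists b, forall a, X a -> splits b a.
Proof.
move=> nX X0; apply: contrapT => nsplit.
have [lt ltwo] := exists_wo B.
pose unsplit (W : set B) (y : B -> B) := (forall e, W e -> y e <> bot) /\
  forall b, exists2 e, W e & ~ splits b (y e).
have [W [y [nW [y0 yns] Wmin]]] : exists W y, [/\ ~ (continuum #<= W), unsplit W y &
    forall v, W v -> forall y', ~ unsplit (seg lt W v) y'].
  have [[v0 [Xv0 yv0]]|no] := pselect (exists v, X v /\ exists y, unsplit (seg lt X v) y).
    have [|v [Xv [y yP]] vmin] :=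
        wo_min ltwo (A := [set v | X v /\ exists y, unsplit (seg lt X v) y]).
      by exists v0.
    exists (seg lt X v), y; split=> // [cX|u [Xu uv] y' y'P].
      by apply: nX; apply: card_le_trans cX _; apply: subset_card_le => u [].
    apply: (vmin u) => //; split=> //; exists y'.
    suff <- : seg lt (seg lt X v) u = seg lt X u by [].
    apply/seteqP; split=> [z [[? ?] ?]//|z [Xz zu]].
    by split=> //; split=> //; exact: wo_trans zu uv.
  exists X, id; split=> //; first split=> // b.
    apply: contrapT => nb; apply: nsplit; exists b => a Xa.
    by apply: contrapT => na; apply: nb; exists a.
  by move=> v Xv y' y'P; apply: no; exists v; split=> //; exists y'.
apply: (minimal_unsplit_absurd ltwo nW y0 yns) => v Wv Y Yv Y0.
apply: contrapT => nY.
have nYb b : exists2 a, Y a & ~ splits b a.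
  apply: contrapT => nb; apply: nY; exists b => a Ya.
  by apply: contrapT => na; apply: nb; exists a.
have [a0 Ya0 _] := nYb bot.
have [f [fv fi]] := card_le_inj bot Yv.
have /choice[y' y'P] e : exists a, Y a /\ forall a', Y a' -> f a' = e -> a = a'.
  have [[a [Ya ae]]|ne] := pselect (exists a, Y a /\ f a = e).
    by exists a; split=> // a' Ya' ae'; apply: fi => //; rewrite ae ae'.
  by exists a0; split=> // a' Ya' ae'; case: ne; exists a'.
apply: (Wmin _ Wv y'); split=> [e _|b]; first by apply: Y0; have [] := y'P e.
have [a Ya nab] := nYb b; exists (f a); first exact: fv.
by have [_ /(_ a Ya erefl) ->] := y'P (f a).
Qed.

Theorem star_unreaped : unreaped.
Proof.
move=> Y nY Yio.
have [||b bP] := small_split (X := q @` Y).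
- by move=> cY; apply: nY; apply: card_le_trans cY _; exact: card_image_le.
- by move=> _ [P YP <-]; apply/(rpb_neq0 qP); exact: Yio.
have [u ub] := rp_surj qP b; exists u => P YP.
have : splits (q u) (q P) by rewrite ub; apply: bP; exists P.
by move=> /(rpb_splits qP)[io1 io2]; split; [move: io1|move: io2];
  apply: ioW => n /andP[].
Qed.

End Unreaped.

Lemma card_eq_bijection {T U : Type} : [set: T] #= [set: U] ->
  exists (phi : T -> U) (phi' : U -> T), cancel phi phi' /\ cancel phi' phi.
Proof.
move=> /card_bijP[f [g fK gK]].
have inT (V : Type) (v : V) : v \in [set: V] by rewrite inE.
exists (fun t => val (f (SigSub (inT _ t)))), (fun u => val (g (SigSub (inT _ u)))).
split=> [t|u].
  have -> : SigSub (inT _ (val (f (SigSub (inT _ t))))) = f (SigSub (inT _ t)) by exact: val_inj.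
  by rewrite fK.
have -> : SigSub (inT _ (val (g (SigSub (inT _ u))))) = g (SigSub (inT _ u)) by exact: val_inj.
by rewrite gK.
Qed.

(** * Cohen-Parovicenko algebras that are reduced powers *)

(** Countably many ultrafilters separate the elements of [C], and the embedding
    into the power set of the natural numbers that they define has a monotone
    left inverse. *)
Definition power_set_retract {d} (C : ctbDistrLatticeType d) : Prop :=
  exists (h : nat -> C -> bool) (r : (nat -> bool) -> C),
    [/\ forall l c c', h l (meet c c') = h l c && h l c',
        forall l c, h l (neg c) = ~~ h l c,
        forall x x' : nat -> bool, (forall l, x l -> x' l) -> (r x <= r x')%O &
        forall c, r (fun l => h l c) = c].

Lemma bool_power_set_retract : power_set_retract bool.
Proof.
exists (fun _ c => c), (fun x => x 0%N); split=> // x x' /(_ 0%N).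
by case: (x 0%N); case: (x' 0%N) => // /(_ isT).
Qed.

Lemma card_rpb_le {d} {B : ctbDistrLatticeType d} (q : (nat -> bool) -> B) :
  reduced_power q -> [set: B] #<= continuum.
Proof.
move=> qP; have /choice[rep repE] : forall b, exists u, q u = b by exact: (rp_surj qP).
apply: (@card_le_rel _ _ _ _ (fun b x => x = rep b)) => [b _|b b' _ _ _ -> e].
  by exists (rep b).
by rewrite -(repE b) e repE.
Qed.

Section Characterization.
Context {dC dA dB : Order.disp_t} {C : ctbDistrLatticeType dC}.
Context {A : ctbDistrLatticeType dA} {B : ctbDistrLatticeType dB}.
Variables (qA : (nat -> C) -> A) (qB : (nat -> bool) -> B).
Hypotheses (qAP : reduced_power qA) (qBP : reduced_power qB).
Hypothesis Cret : power_set_retract C.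

Lemma retract_nontrivial : (bot : C) <> top.
Proof.
have [h [r [hM hN _ _]]] := Cret; move=> e.
have h0 : h 0%N bot = false by rewrite -(meetxC bot) hM hN andbN.
by have := hN 0%N bot; rewrite compl0 -e h0.
Qed.

Lemma of_bool_le (b b' : bool) : ((of_bool b : C) <= of_bool b')%O <-> (b -> b').
Proof.
rewrite /of_bool; case: b; case: b'; rewrite ?le0x ?lexx//.
rewrite le1x; split=> [/eqP e|/(_ isT)//].
by case: retract_nontrivial.
Qed.

Lemma card_reduced_power : [set: A] #= continuum.
Proof.
have [h [r [hM hN rmono rK]]] := Cret.
have /choice[repA repAE] : forall a, exists u, qA u = a by exact: (rp_surj qAP).
have /choice[repB repBE] : forall a, exists u, qB u = a by exact: (rp_surj qBP).
apply: Cantor_Bernstein.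
  apply: (@card_le_rel _ _ _ _ (fun a x => x = fun m => h (pr2 m) (repA a (pr1 m)))).
    by move=> a _; eexists.
  move=> a a' _ _ _ -> e; rewrite -(repAE a) -(repAE a'); congr qA; apply/funext => n.
  rewrite -(rK (repA a n)) -(rK (repA a' n)); congr r; apply/funext => l.
  by have := congr1 (fun x => x (pr n l)) e; rewrite prK1 prK2.
apply: card_le_trans (continuum_le_rpb qBP) _.
apply: (@card_le_rel _ _ _ _ (fun b a => a = qA (fun n => of_bool (repB b n)))).
  by move=> b _; eexists.
move=> b b' _ _ _ -> e; rewrite -(repBE b) -(repBE b').
have le u u' : qA (fun n => of_bool (u n)) = qA (fun n => of_bool (u' n)) ->
    (qB u <= qB u')%O.
  move=> /(rp_eq qAP) uu; apply/(rp_le qBP); apply: evW uu => n uu.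
  by apply/le_boolP; apply/of_bool_le; rewrite uu.
by apply: le_anti; rewrite !le.
Qed.

(** The columns of the index set of [B] represent the coordinates of [A]: the
    [n]-th column of [i a] lists the values of [h l] on the [n]-th coordinate of
    [a], and [psi] decodes each column by the left inverse [r]. *)
Lemma star_from_power_set : star_aleph0_ideal B -> star_aleph0_ideal A.
Proof.
have [h [r [hM hN rmono rK]]] := Cret.
have hmono l c c' : (c <= c')%O -> h l c -> h l c'.
  by move=> /meet_idPl <-; rewrite hM => /andP[].
have /choice[repA repAE] : forall a, exists u, qA u = a by exact: (rp_surj qAP).
have /choice[repB repBE] : forall b, exists u, qB u = b by exact: (rp_surj qBP).
have [phi [phi' [phiK phi'K]]] : exists (phi : A -> B) (phi' : B -> A),
    cancel phi phi' /\ cancel phi' phi.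
  apply: card_eq_bijection; apply: card_eq_trans card_reduced_power _.
  by apply: Cantor_Bernstein; [exact: (continuum_le_rpb qBP)|exact: (card_rpb_le qBP)].
pose code (u : nat -> C) m := h (pr2 m) (u (pr1 m)).
pose psi (b : B) := qA (fun n => r (fun l => repB b (pr n l))).
pose i (a : A) := qB (code (repA a)).
pose tr n (a : A) := qB (fun m => (pr1 m < n)%N || code (repA a) m).
have psi_code u v : ev (fun n => forall l, v (pr n l) = code u (pr n l)) ->
    psi (qB v) = qA u.
  move=> uv; apply/(rp_eq qAP).
  have /(rp_eq qBP)[m mP] : qB (repB (qB v)) = qB v by exact: repBE.
  apply: evW (evI uv (ev_le m)) => n [un mn]; rewrite -(rK (u n)); congr r.
  apply/funext => l; rewrite mP ?un /code ?prK1 ?prK2//.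
  exact: leq_trans mn (le_pr1 _ _).
apply: (@star_transfer _ _ A B phi phi' phiK phi'K psi i tr).
- move=> b c; rewrite -{1}(repBE b) -{1}(repBE c) => /(rp_le qBP)[m mP].
  apply/(rp_le qAP); exists m => n mn; apply: rmono => l.
  by apply/le_boolP/mP; exact: leq_trans mn (le_pr1 _ _).
- by move=> a; rewrite -[RHS]repAE; apply: psi_code; apply: evT.
- move=> n a; rewrite -[RHS]repAE; apply: psi_code; exists n => k nk l.
  by rewrite prK1 ltnNge nk.
- move=> a c; rewrite -{1}(repAE a) -{1}(repAE c) => /(rp_le qAP)[n nP].
  exists n; apply/(rp_le qBP)/evT => m; apply/le_boolP; rewrite /code.
  by have [//|nm] := ltnP (pr1 m) n; apply: hmono; exact: nP.
- move=> a c; rewrite -(rp_meet qBP) -[in RHS](repAE a) -[in RHS](repAE c) -(rp_meet qAP).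
  by apply: psi_code; apply: evT => n l; rewrite /code hM.
- move=> a; rewrite -(rp_neg qBP) -[in RHS](repAE a) -(rp_neg qAP).
  by apply: psi_code; apply: evT => n l; rewrite /code hN.
Qed.

(** [B] consists of the sequences of zeros and ones, and a single ultrafilter of
    [C] retracts [A] onto it. *)
Lemma star_to_power_set : star_aleph0_ideal A -> star_aleph0_ideal B.
Proof.
have [h [r [hM hN rmono rK]]] := Cret.
have hmono l c c' : (c <= c')%O -> h l c -> h l c'.
  by move=> /meet_idPl <-; rewrite hM => /andP[].
have h_of_bool b : h 0%N (of_bool b) = b.
  have h0 : h 0%N bot = false by rewrite -(meetxC bot) hM hN andbN.
  by case: b => //=; rewrite -compl0 hN h0.
have /choice[repA repAE] : forall a, exists u, qA u = a by exact: (rp_surj qAP).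
have /choice[repB repBE] : forall b, exists u, qB u = b by exact: (rp_surj qBP).
have [phi [phi' [phiK phi'K]]] : exists (phi : B -> A) (phi' : A -> B),
    cancel phi phi' /\ cancel phi' phi.
  apply: card_eq_bijection; apply: card_eq_trans (card_esym card_reduced_power).
  by apply: Cantor_Bernstein; [exact: (card_rpb_le qBP)|exact: (continuum_le_rpb qBP)].
pose psi (a : A) := qB (fun n => h 0%N (repA a n)).
pose i (b : B) := qA (fun n => of_bool (repB b n)).
have psi_q u : psi (qA u) = qB (fun n => h 0%N (u n)).
  apply/(rp_eq qBP); have /(rp_eq qAP) : qA (repA (qA u)) = qA u by exact: repAE.
  by apply: evW => n ->.
apply: (@star_transfer _ _ B A phi phi' phiK phi'K psi i (fun=> i)).
- move=> a c; rewrite -{1}(repAE a) -{1}(repAE c) => /(rp_le qAP) ac.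
  by apply/(rp_le qBP); apply: evW ac => n /hmono hac; apply/le_boolP/hac.
- by move=> b; rewrite psi_q -[RHS]repBE; congr qB; apply/funext => n.
- by move=> _ b; rewrite psi_q -[RHS]repBE; congr qB; apply/funext => n.
- move=> b c; rewrite -{1}(repBE b) -{1}(repBE c) => /(rp_le qBP) bc; exists 0%N.
  by apply/(rp_le qAP); apply: evW bc => n /le_boolP ?; exact/of_bool_le.
- move=> b c; rewrite -(rp_meet qAP) psi_q -[in RHS](repBE b) -[in RHS](repBE c).
  by rewrite -(rp_meet qBP); congr qB; apply/funext => n; rewrite hM !h_of_bool.
- move=> b; rewrite -(rp_neg qAP) psi_q -[in RHS](repBE b) -(rp_neg qBP).
  by congr qB; apply/funext => n; rewrite hN h_of_bool.
Qed.

(** An element [b] outside the set [A] of all elements cannot be found for the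
    empty families, so that [A] itself is a set of the size of the continuum that
    is not ideal complete; smaller sets are ideal complete since the dominating
    and the reaping numbers are the continuum. *)
Theorem cohen_parovicenko_iff :
  cohen_parovicenko A <-> star_aleph0_ideal B /\ undominated.
Proof.
split=> [[starA mcA]|[starB domc]].
  split; first exact: star_to_power_set.
  exact: mc_undominated qAP retract_nontrivial mcA.
split; first exact: star_from_power_set.
split; last first.
  move=> X nX; apply: contrapT => cX; apply: nX.
  exact: small_ideal_complete qAP domc (star_unreaped qBP starB domc) _ cX.
exists [set: A]; last exact: card_reduced_power.
move=> /(_ set0 set0)[//|//|||||b [nb _ _ _ _]].
- exact: countable0.
- exact: countable0.
- by move=> s t [].
- move=> [|x l] lS; last by have [] := lS x (mem_head x l).
  rewrite big_nil => bt; apply: retract_nontrivial.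
  have : qA (fun=> bot) = qA (fun=> top) by rewrite (rp_bot qAP) (rp_top qAP).
  by move=> /(rp_eq qAP)[m /(_ m (leqnn m))].
- exact: nb.
Qed.

End Characterization.

Lemma cvg_prod_topology {I : Type} (T : I -> topologicalType)
    (F : set_system (prod_topology T)) (t : prod_topology T) : Filter F ->
  (forall i (U : set (T i)), open U -> U (t i) -> F [set f | U (f i)]) -> F --> t.
Proof.
move=> FF Ft; apply/cvg_sup => i A; rewrite nbhsE => -[B [[U oU <-] Ut] BA].
by apply: filterS BA _; exact: Ft.
Qed.

(** The finite intersection property for a directed family. *)
Lemma compact_directed {T : topologicalType} {I : Type} (K : set T) (D : set I)
    (F : I -> set T) : compact K -> D !=set0 ->
  (forall i j, D i -> D j -> exists2 k, D k & F k `<=` F i `&` F j) ->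
  (forall i, D i -> K `&` F i !=set0) ->
  exists2 p, K p & forall i, D i -> closure (F i) p.
Proof.
move=> Kco [i0 Di0] Ddir KF; pose G := filter_from D (fun i => K `&` F i).
have GF : ProperFilter G.
  apply: filter_from_proper => //; apply: filter_from_filter; first by exists i0.
  move=> i j Di Dj; have [k Dk kij] := Ddir _ _ Di Dj; exists k => //.
  by move=> x [Kx /kij[]].
have [|p [Kp pG]] := Kco G GF; first by exists i0 => // x [].
exists p => // i Di B pB; have [|x [[_ Fx] Bx]] := pG (K `&` F i) B _ pB.
  by exists i.
by exists x.
Qed.

(** Otherwise the differences of [P] and the sets [F i] inside it, a directed
    family, would have a common point in [P]. *)
Lemma compact_generated {T : topologicalType} {I : Type} (F : I -> set T) (P : set T) :
  compact P -> (forall i, open (F i)) -> (exists i, F i = set0) ->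
  (forall i j, exists k, F k = F i `|` F j) ->
  (forall z, P z -> exists2 i, F i z & F i `<=` P) -> exists i, F i = P.
Proof.
move=> Pco oF [i0 F0] FU local; apply: contrapT => no.
have [|||z Pz zF] := compact_directed (K := P)
    (D := [set i | F i `<=` P]) (F := fun i => P `\` F i) Pco.
- by exists i0; rewrite /= F0.
- move=> i j iP jP; have [k kE] := FU i j; exists k; first by rewrite /= kE subUset.
  by rewrite kE => z [Pz /not_orP[]].
- move=> i iP; apply: contrapT => nne; apply: no; exists i.
  apply/seteqP; split=> // z Pz; apply: contrapT => nz; apply: nne.
  by exists z.
have [i iz iP] := local _ Pz.
have [|z' [[_ nz'] z'i]] := zF i iP (F i); first exact: open_nbhs_nbhs.
exact: nz'.
Qed.

(** * Stone-Cech remainders *)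

Section Remainder.
Local Open Scope ring_scope.
Variables (R : realType) (X : topologicalType).
Context {dC : Order.disp_t} {C : ctbDistrLatticeType dC}.
(** [X] is the sum of the compact open sets [rk @^-1` [set n]], and [v] maps a
    sequence of elements of [C] to the clopen set which they define piecewise.
    The last hypothesis says that disjoint zero sets are separated by clopen
    sets. *)
Variables (rk : X -> nat) (v : (nat -> C) -> set X).
Hypothesis v_clopen : forall u, clopen (v u).
Hypothesis v_surj : forall V : set X, clopen V -> exists u, v u = V.
Hypothesis v_le : forall u u' m, (forall x, (m <= rk x)%N -> v u x -> v u' x) <->
  (forall n, (m <= n)%N -> (u n <= u' n)%O).
Hypothesis rk_clopen : forall m, clopen [set x | (rk x < m)%N].
Hypothesis rk_compact : forall m, compact [set x | (rk x < m)%N].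
Hypothesis v_sep : forall (f : X -> R) (r : R), continuous f ->
  exists u, (forall x, f x < r -> v u x) /\ (forall x, v u x -> f x <= r).

Local Notation cube := (stone_cech_cube R X).
Local Notation emb := (@stone_cech_map R X).
Local Notation bX := (@stone_cech R X).
Local Notation rem := (stone_cech_remainder R X).
Local Notation ufun := (unit_function R X).

Lemma indicator_continuous (V : set X) : clopen V ->
  continuous (fun x => (x \in V)%:R : R) /\ forall x, 0 <= ((x \in V)%:R : R) <= 1.
Proof.
move=> [oV cV]; split=> [x|x]; last by case: (x \in V); rewrite ?ler01 ?lexx.
have [Vx|nVx] := pselect (V x).
  apply: (@near_cst_continuous _ _ (1 : R)).
  have : nbhs x V by exact: open_nbhs_nbhs.
  by apply: filterS => y Vy; rewrite mem_set.
apply: (@near_cst_continuous _ _ (0 : R)).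
have : nbhs x (~` V) by apply: open_nbhs_nbhs; split => //; exact: closed_openC.
by apply: filterS => y Vy; rewrite memNset.
Qed.

Definition ind (V : set X) : ufun :=
  match pselect (clopen V) with
  | left cV => SigSub (mem_set (indicator_continuous cV))
  | right _ => SigSub (mem_set (indicator_continuous (@clopen0 X)))
  end.

Lemma indE V x : clopen V -> val (ind V) x = (x \in V)%:R.
Proof. by move=> cV; rewrite /ind; case: pselect. Qed.

Lemma coordinate_continuous (f : ufun) : continuous (fun p : cube => p f).
Proof. exact: (@proj_continuous _ (fun _ : ufun => R) f). Qed.

Lemma emb_continuous : continuous emb.
Proof.
move=> x; apply: cvg_prod_topology => f U oU Ux.
have [fc _] := set_mem (valP f).
by apply: fc; exact: open_nbhs_nbhs.
Qed.

(** The extension of the indicator function of a clopen [V] is 0 or 1 at the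
    points of the compactification; those where it is 1 form the closure of [V]. *)
Definition mem (p : cube) (V : set X) := 2^-1 < p (ind V).

Lemma half_lt1 : (2^-1 : R) < 1.
Proof. by rewrite invf_lt1 ?ltr0n// ltr1n. Qed.

Lemma half_gt0 : (0 : R) < 2^-1.
Proof. by rewrite invr_gt0 ltr0n. Qed.

Lemma mem_emb x V : clopen V -> mem (emb x) V <-> V x.
Proof.
move=> cV; rewrite /mem /stone_cech_map indE//.
have [Vx|nVx] := pselect (V x).
  by rewrite mem_set// half_lt1.
by rewrite memNset//= ltNge ltW ?half_gt0.
Qed.

Lemma mem_open V : open [set p : cube | mem p V].
Proof.
have /continuousP/(_ _ (@open_gt _ 2^-1)) := @coordinate_continuous (ind V).
by [].
Qed.

Lemma bX_indicator p V : bX p -> clopen V -> p (ind V) = 0 \/ p (ind V) = 1.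
Proof.
move=> bp cV.
have cl : closed [set p : cube | p (ind V) \in [:: 0; 1]].
  have -> : [set p : cube | p (ind V) \in [:: 0; 1]] =
      (fun p : cube => p (ind V)) @^-1` ([set 0] `|` [set 1]).
    apply/seteqP; split=> z /=; rewrite !inE.
      by move=> /orP[/eqP ->|/eqP ->]; [left|right].
    by move=> [->|->]; rewrite eqxx ?orbT.
  apply: closed_comp => [z _|]; first exact: coordinate_continuous.
  by apply: closedU; exact: closed_eq.
have : closure (range emb) `<=` [set p : cube | p (ind V) \in [:: 0; 1]].
  rewrite [X in _ `<=` X](closure_id _).1//; apply: closureS => _ [x _ <-].
  rewrite /= /stone_cech_map indE//; case: (x \in V); by rewrite !inE eqxx ?orbT.
move=> /(_ p bp); rewrite /= !inE => /orP[/eqP ->|/eqP ->]; by [left|right].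
Qed.

Lemma nmem_open V : clopen V -> open [set p : cube | p (ind V) < 2^-1].
Proof.
have /continuousP/(_ _ (@open_lt _ 2^-1)) := @coordinate_continuous (ind V).
by [].
Qed.

Lemma nmem p V : bX p -> clopen V -> ~ mem p V -> p (ind V) < 2^-1.
Proof.
move=> bp cV; rewrite /mem; have [->|->] := bX_indicator bp cV; first by rewrite half_gt0.
by rewrite half_lt1.
Qed.

Lemma bX_near p (U : set cube) : bX p -> nbhs p U -> exists x, U (emb x).
Proof. by move=> bp /bp[_ [[x _ <-] Ux]]; exists x. Qed.

Lemma nbhsI {T : topologicalType} (p : T) (U V : set T) :
  nbhs p U -> nbhs p V -> nbhs p (U `&` V).
Proof. by move=> pU pV; exact: filterI. Qed.

Lemma mem_nbhs p V : bX p -> clopen V -> nbhs p [set z : cube | mem z V <-> mem p V].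
Proof.
move=> bp cV; have [pV|npV] := pselect (mem p V).
  have : nbhs p [set z : cube | mem z V] by apply: open_nbhs_nbhs; split=> //; exact: mem_open.
  by apply: filterS => z zV.
have : nbhs p [set z : cube | z (ind V) < 2^-1].
  by apply: open_nbhs_nbhs; split; [exact: nmem_open|exact: nmem].
apply: filterS => z /= zV; split=> // zV'.
by move: (lt_trans zV zV'); rewrite ltxx.
Qed.

Lemma mem_join p V V' : bX p -> clopen V -> clopen V' ->
  mem p (V `|` V') <-> mem p V \/ mem p V'.
Proof.
move=> bp cV cV'; have cU := clopenU cV cV'.
have nb := nbhsI (mem_nbhs bp cV) (nbhsI (mem_nbhs bp cV') (mem_nbhs bp cU)).
have [x [/= e [e' e'']]] := bX_near bp nb.
by rewrite -e -e' -e'' !mem_emb.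
Qed.

Lemma mem_meet p V V' : bX p -> clopen V -> clopen V' ->
  mem p (V `&` V') <-> mem p V /\ mem p V'.
Proof.
move=> bp cV cV'; have cU := clopenI cV cV'.
have nb := nbhsI (mem_nbhs bp cV) (nbhsI (mem_nbhs bp cV') (mem_nbhs bp cU)).
have [x [/= e [e' e'']]] := bX_near bp nb.
by rewrite -e -e' -e'' !mem_emb.
Qed.

Lemma mem_compl p V : bX p -> clopen V -> mem p (~` V) <-> ~ mem p V.
Proof.
move=> bp cV; have cC : clopen (~` V) by exact: (clopenC set0).
have [x [/= e e']] := bX_near bp (nbhsI (mem_nbhs bp cV) (mem_nbhs bp cC)).
by rewrite -e -e' !mem_emb.
Qed.

Lemma memT p : bX p -> mem p [set: X].
Proof.
move=> bp; have [x /= e] := bX_near bp (mem_nbhs bp (@clopenT X)).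
by apply/e/mem_emb => //; exact: clopenT.
Qed.

Lemma mem0 p : bX p -> ~ mem p set0.
Proof.
move=> bp; have [x /= e] := bX_near bp (mem_nbhs bp (@clopen0 X)).
by move=> /e; rewrite mem_emb//; exact: clopen0.
Qed.

Lemma cube_hausdorff : hausdorff_space cube.
Proof. by apply: hausdorff_product => f; exact: Rhausdorff. Qed.

Lemma bX_closed : closed bX. Proof. exact: closed_closure. Qed.

Lemma bX_compact : compact bX.
Proof.
apply: (subclosed_compact bX_closed (B := [set p : cube | forall f, `[0, 1]%classic (p f)])).
  apply: (@tychonoff _ (fun _ : ufun => R : topologicalType) (fun _ => `[0, 1]%classic)).
  by move=> f; exact: segment_compact.
have cl : closed [set p : cube | forall f, `[0, 1]%classic (p f)].
  rewrite (_ : [set p : cube | _] = \bigcap_(f in [set: ufun]) (fun p : cube => p f) @^-1` `[0, 1]%classic); last first.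
    by apply/seteqP; split=> z; [move=> zf f _; exact: zf|move=> zf f; exact: zf].
  apply: closed_bigI => f _; apply: closed_comp => [z _|].
    exact: coordinate_continuous.
  exact: interval_closed.
rewrite [X in _ `<=` X](closure_id _).1//; apply: closureS => _ [x _ <-] f /=.
by have [_ /(_ x)] := set_mem (valP f); rewrite in_itv.
Qed.

Lemma range_bX x : bX (emb x).
Proof. by apply: subset_closure; exists x. Qed.

(** The image of a finite union of pieces is compact, hence closed. *)
Lemma mem_piece p m : bX p -> mem p [set x | (rk x < m)%N] -> range emb p.
Proof.
move=> bp pm; set K := [set x | (rk x < m)%N] in pm *.
have : closed (emb @` K).
  apply: (compact_closed cube_hausdorff); apply: continuous_compact; last exact: rk_compact.
  by apply: continuous_subspaceT; exact: emb_continuous.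
move=> cK; suff : closure (emb @` K) p.
  by have <- := (closure_id _).1 cK; move=> [x _ <-]; exists x.
move=> U pU; have nb := nbhsI pU (mem_nbhs bp (rk_clopen m)).
have [x [Ux /= xm]] := bX_near bp nb.
exists (emb x); split=> //; exists x => //.
by apply/(mem_emb x (rk_clopen m))/xm.
Qed.

Lemma remP p : (bX `\` range emb) p <-> bX p /\ forall m, ~ mem p [set x | (rk x < m)%N].
Proof.
split=> [[bp np]|[bp pm]]; split=> //; first by move=> m /(mem_piece bp).
move=> [x _ xp]; apply: (pm (rk x).+1); rewrite -xp.
by apply/(mem_emb x (rk_clopen _)) => /=.
Qed.

Lemma rem_compact : compact (bX `\` range emb).
Proof.
apply: (subclosed_compact _ bX_compact); last by move=> p [].
rewrite (_ : _ `\` _ = bX `&` \bigcap_m ~` [set p : cube | mem p [set x | (rk x < m)%N]]).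
  apply: closedI; first exact: bX_closed.
  by apply: closed_bigI => m _; apply: open_closedC; exact: mem_open.
apply/seteqP; split=> p; first by move=> /remP[bp pm]; split=> // m _; exact: pm.
by move=> [bp pm]; apply/remP; split=> // m; exact: pm.
Qed.

Lemma rem_bX (z : rem) : bX (val z).
Proof. by have [] := set_mem (valP z). Qed.
Arguments rem_bX z : clear implicits.

Lemma rem_compactT : compact [set: rem].
Proof.
move=> F FF _; pose G : set_system cube := val @ F.
have GF : ProperFilter G by exact: fmap_proper_filter.
have [|p [pr pG]] := rem_compact GF.
  change (F (val @^-1` (bX `\` range emb))).
  by apply: filterS filterT => z _; exact: set_mem (valP z).
exists (SigSub (mem_set pr)); split=> // P U FP [_ [[W oW <-] Wp] WU].
have GP : G (val @` P).
  change (F (val @^-1` (val @` P))).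
  by apply: filterS FP => z Pz; exists z.
have [|_ [[z Pz <-] Wz]] := pG _ W GP; first exact: open_nbhs_nbhs.
by exists z; split=> //; exact: WU.
Qed.

Definition trace (V : set X) : set rem := [set z | mem (val z) V].

Lemma trace_clopen V : clopen V -> clopen (trace V).
Proof.
move=> cV; split.
  by exists [set p | mem p V] => //; exact: mem_open.
rewrite (_ : trace V = ~` (trace (~` V))).
  apply: open_closedC; exists [set p | mem p (~` V)] => //; exact: mem_open.
have E z := mem_compl (rem_bX z) cV.
by apply/seteqP; split=> z zV; [move=> /E|apply: contrapT => nz; apply/zV/E].
Qed.

(** If the condition fails infinitely often, then points of [v u] outside [v u']
    in infinitely many pieces accumulate in the remainder. *)
Lemma trace_le u u' : trace (v u) `<=` trace (v u') <-> ev (fun n => (u n <= u' n)%O).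
Proof.
split=> [sub|[m um] z zu].
  apply: contrapT => nev.
  have /choice[x xP] m : exists x, [/\ (m <= rk x)%N, v u x & ~ v u' x].
    apply: contrapT => no; apply: nev; exists m; apply/v_le => x mx ux.
    by apply: contrapT => nux; apply: no; exists x.
  pose F : set_system cube := (emb \o x) @ \oo.
  have FF : ProperFilter F by exact: fmap_proper_filter.
  have [|p [bp pF]] := bX_compact FF.
    by exists 0%N => // n _; exact: range_bX.
  have near (V : set X) m : clopen V -> exists n, (m <= n)%N /\ (V (x n) <-> mem p V).
    move=> cV.
    have [|_ [[n mn <-] xV]] := pF ((emb \o x) @` [set n | (m <= n)%N]) _ _ (mem_nbhs bp cV).
      by exists m => // n mn; exists n.
    by exists n; split=> //; apply: iff_trans xV; apply: iff_sym; exact: mem_emb.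
  have pr : (bX `\` range emb) p.
    apply/remP; split=> // m pm; have [n [mn [_ /(_ pm)]]] := near _ m (rk_clopen m).
    by have [nx _ _] := xP n; rewrite /= ltnNge (leq_trans mn nx).
  pose z : rem := SigSub (mem_set pr).
  have zu : trace (v u) z.
    by have [n [_ [+ _]]] := near _ 0%N (v_clopen u); apply; have [] := xP n.
  have [n [_ [_ /(_ (sub _ zu))]]] := near _ 0%N (v_clopen u').
  by have [] := xP n.
apply: contrapT => nzu; have bz := rem_bX z.
have [_ nm] := (remP (val z)).1 (set_mem (valP z)).
have nb := nbhsI (mem_nbhs bz (v_clopen u))
  (nbhsI (mem_nbhs bz (v_clopen u')) (mem_nbhs bz (rk_clopen m))).
have [x [/= xu [xu' xm]]] := bX_near bz nb.
apply: nzu; apply/xu'/(mem_emb x (v_clopen _)).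
apply: (v_le u u' m).2 => //.
  by rewrite leqNgt; apply/negP => xm'; apply: (nm m); apply/xm/(mem_emb x (rk_clopen m)).
by apply/(mem_emb x (v_clopen u))/xu.
Qed.

(** Distinct points of the remainder differ at some function [f]; [v_sep] gives
    a clopen set between two level sets of [f]. *)
Lemma trace_separates (z z' : rem) : z != z' -> exists2 V, clopen V & trace V z /\ ~ trace V z'.
Proof.
move=> zz'; have bz := rem_bX z; have bz' := rem_bX z'.
have [f zf] : exists f, val z f <> val z' f.
  apply: contrapT => no; move/eqP: zz'; apply; apply: val_inj.
  by apply/funext => f; apply: contrapT => nf; apply: no; exists f.
have sep (p p' : cube) : bX p -> bX p' -> p f < p' f ->
    exists2 V, clopen V & mem p V /\ ~ mem p' V.
  move=> bp bp' pp'; have [fc _] := set_mem (valP f).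
  pose r := (p f + p' f) / 2.
  have [pr rp'] : p f < r /\ r < p' f by split; [exact: (midf_lt pp').1|exact: (midf_lt pp').2].
  have [u [fu uf]] := v_sep r fc; exists (v u) => //.
  have oc (U : set R) (t : cube) : open U -> U (t f) -> nbhs t [set t' : cube | U (t' f)].
    by move=> oU Ut; apply: coordinate_continuous; exact: open_nbhs_nbhs.
  split.
    have [x [/= e xr]] := bX_near bp (nbhsI (mem_nbhs bp (v_clopen u)) (oc [set y | y < r] p (@open_lt _ r) pr)).
    by apply/e/mem_emb => //; exact: fu.
  have [x [/= e xr]] := bX_near bp' (nbhsI (mem_nbhs bp' (v_clopen u)) (oc [set y | r < y] p' (@open_gt _ r) rp')).
  rewrite -e mem_emb// => /uf; rewrite leNgt => /negP; apply.
  exact: xr.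
have [zz|zz|//] := ltgtP (val z f) (val z' f); first exact: sep.
have [V cV [z'V zV]] := sep _ _ bz' bz zz.
exists (~` V); first exact: (clopenC set0).
by rewrite /trace /= !mem_compl//; split=> // /(_ z'V).
Qed.

Lemma remainder_zero_dimensional : zero_dimensional rem.
Proof.
move=> z z' zz'; have [V cV [zV zV']] := trace_separates zz'.
by exists (trace V); split=> //; exact: trace_clopen.
Qed.

Lemma trace_surj (P : set rem) : clopen P -> exists2 V, clopen V & trace V = P.
Proof.
move=> [oP cP].
have traceI V V' : clopen V -> clopen V' -> trace (V `&` V') = trace V `&` trace V'.
  by move=> cV cV'; apply/seteqP; split=> z; rewrite /trace /= mem_meet//; exact: rem_bX.
have traceU V V' : clopen V -> clopen V' -> trace (V `|` V') = trace V `|` trace V'.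
  by move=> cV cV'; apply/seteqP; split=> z; rewrite /trace /= mem_join//; exact: rem_bX.
have local z : P z -> exists V, [/\ clopen V, trace V z & trace V `<=` P].
  move=> Pz; apply: contrapT => no.
  have [||||z' nPz' z'V] := compact_directed (K := ~` P)
      (D := [set V | clopen V /\ trace V z]) (F := trace).
  - apply: subclosed_compact rem_compactT _ => //; exact: open_closedC.
  - by exists setT; split; [exact: clopenT|apply: memT; exact: rem_bX].
  - move=> V V' [cV zV] [cV' zV']; exists (V `&` V'); last by rewrite traceI.
    by split; [exact: clopenI|rewrite traceI].
  - move=> V [cV zV]; apply: contrapT => nne; apply: no; exists V; split=> // z' z'V.
    by apply: contrapT => nPz'; apply: nne; exists z'.
  have [zz'|zz'] := eqVneq z z'; first by apply: nPz'; rewrite -zz'.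
  have [V cV [zV nz'V]] := trace_separates zz'.
  have [_ /closure_id eV] := trace_clopen cV.
  by have := z'V V (conj cV zV); rewrite -eV.
have [||||z Pz|V VP] := compact_generated (F := fun V : {V : set X | clopen V} =>
    trace (sval V)) (P := P).
- exact: subclosed_compact rem_compactT _.
- by move=> [V cV]; case: (trace_clopen cV).
- exists (exist _ set0 (@clopen0 X)); apply/seteqP; split=> // z.
  by rewrite /trace /= => /(mem0 (rem_bX z)).
- move=> [V cV] [V' cV']; exists (exist _ _ (clopenU cV cV')); exact: traceU.
- by have [V [cV Vz VP]] := local z Pz; exists (exist _ V cV).
by exists (sval V) => //; case: V {VP}.
Qed.

Theorem remainder_reduced_power : exists q : (nat -> C) -> clopens rem, reduced_power q.
Proof.
exists (fun u => mk_clopen (trace_clopen (v_clopen u))); split=> [P|u u'].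
  have [V cV VP] := trace_surj (clopens_clopen P); have [u uV] := v_surj cV.
  by exists u; apply: val_inj; rewrite /= uV.
by rewrite -trace_le; split=> [/asboolP|uu]; last exact/asboolP.
Qed.

End Remainder.

(** * The remainder of the natural numbers *)

Section DiscreteRemainder.
Variable R : realType.

Lemma nat_clopen (V : set nat) : clopen V.
Proof. by split; [exact: discrete_open|exact: discrete_closed]. Qed.

Let nat_set (u : nat -> bool) : set nat := [set n | u n].

Let nat_set_surj V : clopen V -> exists u, nat_set u = V.
Proof.
by move=> _; exists (fun n => n \in V); apply/seteqP; split=> n; rewrite /nat_set /= inE.
Qed.

Let nat_set_le u u' m : (forall n, (m <= n)%N -> nat_set u n -> nat_set u' n) <->
  (forall n, (m <= n)%N -> (u n <= u' n)%O).
Proof. by split=> uu n mn; apply/le_boolP; exact: uu. Qed.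

Let nat_initial_compact m : compact [set n | (n < m)%N].
Proof. by apply: finite_compact; exact: finite_II. Qed.

Let nat_sep (f : nat -> R) (r : R) : continuous f ->
  exists u, (forall n, (f n < r)%R -> nat_set u n) /\ (forall n, nat_set u n -> (f n <= r)%R).
Proof. by move=> _; exists (fun n => (f n < r)%R); split=> n // /ltW. Qed.

Lemma nat_remainder_zero_dimensional : zero_dimensional (stone_cech_remainder R nat).
Proof.
exact: (remainder_zero_dimensional (v := nat_set) (fun u => nat_clopen _) nat_sep).
Qed.

Lemma nat_remainder_reduced_power :
  exists q : (nat -> bool) -> clopens (stone_cech_remainder R nat), reduced_power q.
Proof.
exact: (remainder_reduced_power (rk := id) (v := nat_set) (fun u => nat_clopen _)
  nat_set_surj nat_set_le (fun m => nat_clopen _) nat_initial_compact nat_sep).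
Qed.

End DiscreteRemainder.

(** * Stone spaces *)

Section StoneSpace.
Context {d : Order.disp_t} {C : ctbDistrLatticeType d}.
Implicit Types (F : stone_space C) (c : C).

Definition basic c : set (stone_space C) := [set F | val F c].

Lemma basicT F : basic top F.
Proof. by have [] := set_mem (valP F). Qed.

Lemma basic0 F : ~ basic bot F.
Proof. by have [] := set_mem (valP F). Qed.

Lemma basicS c c' F : (c <= c')%O -> basic c F -> basic c' F.
Proof. by have [_ _ _ + _] := set_mem (valP F); apply. Qed.

Lemma basicI c c' F : basic (meet c c') F <-> basic c F /\ basic c' F.
Proof.
split=> [cF|[cF c'F]]; last by have [_ _ + _ _] := set_mem (valP F); apply.
by split; apply: basicS cF; rewrite ?leIl ?leIr.
Qed.

Lemma basicC c F : basic (neg c) F <-> ~ basic c F.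
Proof.
split=> [nc cF|ncF]; last by have [_ _ _ _ /(_ c)[]] := set_mem (valP F).
by apply: (@basic0 F); rewrite -(meetxC c); apply/basicI.
Qed.

Lemma basicU c c' F : basic (join c c') F <-> basic c F \/ basic c' F.
Proof.
split=> [cF|]; last by case; apply: basicS; rewrite ?leUl ?leUr.
apply: contrapT => /not_orP[/basicC nc /basicC nc'].
by have /basicI := conj nc nc'; rewrite -complU => /basicC.
Qed.

Lemma basic_open c : open (basic c).
Proof. by move=> F cF; exists c. Qed.

Lemma basic_nbhs F (U : set (stone_space C)) : open U -> U F ->
  exists2 c, basic c F & basic c `<=` U.
Proof. by move=> oU UF; apply: oU. Qed.

Lemma stone_compact : compact [set: stone_space C].
Proof.
rewrite compact_ultra => U UU _.
have ultraU : ultrafilter [set c | U (basic c)].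
  split=> /=.
  - by apply: filterS filterT => F _; exact: basicT.
  - by move=> U0; apply: (@filter_not_empty _ U); apply: filterS U0 => F /basic0.
  - by move=> a b Ua Ub; apply: filterS (filterI Ua Ub) => F; move=> /basicI.
  - by move=> a b ab; apply: filterS => F; exact: basicS.
  - move=> a; have [?|nU] := in_ultra_setVsetC (basic a) UU; [by left|right].
    by apply: filterS nU => F /basicC.
exists (SigSub (mem_set ultraU)); split=> // A.
rewrite nbhsE => -[O [oO OF] OA]; have [c /= cU cO] := basic_nbhs oO OF.
by apply: filterS cU => G /cO/OA.
Qed.

Lemma stone_clopen (V : set (stone_space C)) : clopen V -> exists c, basic c = V.
Proof.
move=> [oV cV]; apply: compact_generated.
- exact: subclosed_compact stone_compact _.
- exact: basic_open.
- by exists bot; apply/seteqP; split=> F // /basic0.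
- by move=> c c'; exists (join c c'); apply/seteqP; split=> F; move/basicU.
- by move=> F; exact: basic_nbhs.
Qed.

End StoneSpace.

(** * The remainder of a countable sum of copies of a Stone space *)

Section StoneRemainder.
Variable R : realType.
Context {d : Order.disp_t} {C : ctbDistrLatticeType d}.
Hypothesis points : forall c : C, c <> bot -> exists F, basic c F.
Hypothesis suprema : forall S : set C, exists s,
  (forall c, S c -> (c <= s)%O) /\ forall b, (forall c, S c -> (c <= b)%O) -> (s <= b)%O.

Local Notation X := (nat * stone_space C)%type.

Let pieces (u : nat -> C) : set X := [set x | basic (u x.1) x.2].

Let pair_continuous n : continuous (fun F : stone_space C => (n, F) : X).
Proof.
move=> F; exact: (@cvg_pair _ nat _ (nbhs F) (nbhs n) (nbhs F) _ _ _ (fun=> n) id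
  (@cvg_cst nat n _ _ _) (@cvg_id _ _)).
Qed.

Let pieces_open u : open (pieces u).
Proof.
rewrite openE => -[n F] nF; exists ([set n], basic (u n)) => /=.
  split; apply: open_nbhs_nbhs; split=> //; first exact: discrete_open.
  exact: basic_open.
by move=> [m G] /= [->].
Qed.

Let pieces_clopen u : clopen (pieces u).
Proof.
split; first exact: pieces_open.
rewrite (_ : pieces u = ~` pieces (fun n => neg (u n))).
  by apply: open_closedC; exact: pieces_open.
by apply/seteqP; split=> x; [move=> cF /basicC|move=> nc; apply: contrapT => /basicC].
Qed.

Let pieces_surj V : clopen V -> exists u, pieces u = V.
Proof.
move=> [oV cV]; have /choice[u uP] n : exists c, basic c = [set F | V (n, F)].
  apply: stone_clopen; split; first by have /continuousP := @pair_continuous n; apply.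
  by apply: closed_comp => // F _; exact: pair_continuous.
by exists u; apply/seteqP; split=> -[n F]; rewrite /pieces /= uP.
Qed.

Let pieces_le u u' m : (forall x : X, (m <= x.1)%N -> pieces u x -> pieces u' x) <->
  (forall n, (m <= n)%N -> (u n <= u' n)%O).
Proof.
split=> uu n mn; last by apply: basicS; exact: uu.
apply: contrapT => nle; have [|F] := points (c := meet (u n) (neg (u' n))).
  by move=> /eqP; rewrite disj_leC complK.
by move=> /basicI[uF /basicC]; apply; exact: (uu (n, F)).
Qed.

Let initial_clopen m : clopen [set x : X | (x.1 < m)%N].
Proof.
have fc : continuous (@fst nat (stone_space C)) by move=> x; exact: cvg_fst.
split.
  by apply: (@open_comp X nat fst [set n | (n < m)%N]) => [x _|];
    [exact: fc|exact: discrete_open].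
by apply: (@closed_comp X nat fst [set n | (n < m)%N]) => [x _|];
  [exact: fc|exact: discrete_closed].
Qed.

Let initial_compact m : compact [set x : X | (x.1 < m)%N].
Proof.
rewrite (_ : [set x | _] = [set n | (n < m)%N] `*` [set: stone_space C]); last first.
  by apply/seteqP; split=> x //= [].
apply: compact_setX; last exact: stone_compact.
by apply: finite_compact; exact: finite_II.
Qed.

(** The supremum of the elements of [C] on which [f < r] is disjoint from every
    element on which [f > r]; this is where completeness of [C] is used. *)
Let pieces_sep (f : X -> R) (r : R) : continuous f ->
  exists u, (forall x, (f x < r)%R -> pieces u x) /\ (forall x, pieces u x -> (f x <= r)%R).
Proof.
move=> fc; have fnc n : continuous (fun F => f (n, F)).
  by move=> F; apply: continuous_comp; [exact: pair_continuous|exact: fc].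
have /choice[u uP] n := suprema [set c | forall F, basic c F -> (f (n, F) < r)%R].
exists u; split=> -[n F] nF.
  have [|c cF cV] := basic_nbhs (F := F) (U := [set F | (f (n, F) < r)%R]) _ nF.
    by have /continuousP/(_ _ (@open_lt _ r)) := @fnc n.
  by apply: basicS cF; apply: (uP n).1.
rewrite leNgt; apply/negP => rf.
have [|c cF cV] := basic_nbhs (F := F) (U := [set F | (r < f (n, F))%R]) _ rf.
  by have /continuousP/(_ _ (@open_gt _ r)) := @fnc n.
have : (u n <= neg c)%O.
  apply: (uP n).2 => c' c'P; rewrite -disj_leC; apply/eqP.
  apply: contrapT => /points[G /basicI[c'G cG]].
  by have := lt_trans (c'P G c'G) (cV G cG); rewrite ltxx.
by move=> /basicS/(_ nF)/basicC.
Qed.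

Lemma stone_remainder_zero_dimensional : zero_dimensional (stone_cech_remainder R X).
Proof.
exact: (remainder_zero_dimensional (v := pieces) pieces_clopen pieces_sep).
Qed.

Lemma stone_remainder_reduced_power :
  exists q : (nat -> C) -> clopens (stone_cech_remainder R X), reduced_power q.
Proof.
exact: (remainder_reduced_power (rk := fst) (v := pieces) pieces_clopen
  pieces_surj pieces_le initial_clopen initial_compact pieces_sep).
Qed.

End StoneRemainder.

(** * Regular open sets of the Cantor cubes *)

Lemma power_set_retract_points {d} {C : ctbDistrLatticeType d} (c : C) :
  power_set_retract C -> c <> bot -> exists F, basic c F.
Proof.
move=> [h [r [hM hN _ rK]]] c0.
have h0 l : h l bot = false by rewrite -(meetxC bot) hM hN andbN.
have [l hc] : exists l, h l c.
  apply: contrapT => no; apply: c0; rewrite -(rK c) -(rK bot); congr r.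
  by apply/funext => l; rewrite h0; apply/negbTE/negP => hc; apply: no; exists l.
suff hl : ultrafilter [set c' | h l c'] by exists (SigSub (mem_set hl)).
split=> /= [||a b|a b ab|a].
- by rewrite -compl0 hN h0.
- by rewrite h0.
- by rewrite hM => -> ->.
- by rewrite -(meet_idPl ab) hM => /andP[].
- by rewrite hN; case: (h l a); [left|right].
Qed.

Section RegularOpens.
Variable X : topologicalType.

Lemma regopen_suprema (S : set (regopens X)) : exists s,
  (forall c, S c -> (c <= s)%O) /\ forall b, (forall c, S c -> (c <= b)%O) -> (s <= b)%O.
Proof.
exists (mk_regopen (interior_closure_idem (\bigcup_(c in S) val c))); split=> [c Sc|b Sb].
  apply/asboolP; rewrite -(regopens_regopen c); apply: interiorS; apply: closureS.
  by move=> p cp; exists c.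
apply/asboolP; rewrite -(regopens_regopen b); apply: interiorS; apply: closureS.
by move=> p [c /Sb/asboolP]; apply.
Qed.

(** Each point [y l] of the dense sequence extends to an ultrafilter containing
    its neighbourhoods and all dense open sets; since a regular open set and its
    complement have a dense union, the ultrafilter selects one of the two. *)
Lemma separable_power_set_retract (y : nat -> X) :
  (forall U, open U -> U !=set0 -> exists l, U (y l)) ->
  power_set_retract (regopens X).
Proof.
move=> ydense.
have /choice[W WP] l : exists W : set_system X, [/\ UltraFilter W,
    forall U, nbhs (y l) U -> W U &
    forall D, open D -> closure D = [set: X] -> W D].
  pose G := filter_from [set D | open D /\ closure D = [set: X]]
    (fun D => D).
  have GF : Filter G.
    apply: filter_from_filter; first by exists setT; split; [exact: openT|exact: closureT].
    move=> D D' [oD cD] [oD' cD']; exists (D `&` D') => //; split; first exact: openI.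
    apply/seteqP; split=> // p _; apply: interior_subset.
    by rewrite interior_closureI// cD cD' setIid interiorT.
  have GN : ProperFilter (filter_from [set UD : set X * set X | nbhs (y l) UD.1 /\ G UD.2]
      (fun UD => UD.1 `&` UD.2)).
    apply: filter_from_proper.
      apply: filter_from_filter; first by exists (setT, setT); split; exact: filterT.
      move=> [U D] [U' D'] [/= yU GD] [/= yU' GD']; exists (U `&` U', D `&` D').
        by split; exact: filterI.
      by move=> p [[? ?] [? ?]].
    move=> [U D] [/= yU [D' [oD' cD'] D'D]].
    have : closure D' (y l) by rewrite cD'.
    by move=> /(_ _ yU)[p [D'p Up]]; exists p; split=> //; exact: D'D.
  have [W [WU GW]] := ultraFilterLemma GN; exists W; split=> // [U yU|D oD cD]; apply: GW.
    by exists (U, setT); [split=> //; exact: filterT|move=> p []].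
  by exists (setT, D); [split; [exact: filterT|by exists D]|move=> p []].
have hM l (c c' : regopens X) : W l (val c `&` val c') <-> W l (val c) /\ W l (val c').
  have [WU _ _] := WP l; split=> [Wc|[]]; last exact: filterI.
  by split; apply: filterS Wc => p [].
have hN l (c : regopens X) : W l (val (neg c)) <-> ~ W l (val c).
  have [WU _ WD] := WP l; split=> [Wn Wc|Wn].
    apply: (@filter_not_empty _ (W l)); apply: filterS (filterI Wn Wc) => p [].
    by move=> /interior_subset.
  have [//|Wnc] := in_ultra_setVsetC (val c) WU.
  have Wd : W l (val c `|` (~` val c)°).
    apply: WD; last exact: closureU_ext.
    by apply: openU; [exact: regopens_open|exact: open_interior].
  by apply: filterS (filterI Wnc Wd) => p [nc []].
have /choice[r rP] (x : nat -> bool) :=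
  regopen_suprema [set c | forall l, W l (val c) -> x l].
exists (fun l c => `[< W l (val c) >]), r; split=> [l c c'|l c|x x' xx|c].
- by apply/asboolP/andP => [/hM[? ?]|[/asboolP ? /asboolP ?]];
    [split; apply/asboolP|apply/hM].
- by apply/asboolP/negP => [/hN nc /asboolP|nc] //; apply/hN => cl; apply/nc/asboolP.
- by apply: (rP x).2 => c cx; apply: (rP x').1 => l /cx/xx.
apply/le_anti/andP; split; last by apply: (rP _).1 => l /asboolP.
apply: (rP _).2 => c' c'c; rewrite -[leRHS]complK -disj_leC; apply/eqP.
apply: contrapT => ne.
have [||l [yc' yc]] := ydense (val (meet c' (neg c))).
- exact: regopens_open.
- apply: contrapT => e; apply: ne; apply: val_inj; apply/seteqP; split=> // p pc.
  by apply: e; exists p.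
have [_ Wy _] := WP l.
have Wc : W l (val (neg c)).
  by apply: Wy; apply: open_nbhs_nbhs; split=> //; exact: regopens_open.
apply: (hN l c).1 Wc _; apply/asboolP/c'c.
by apply: Wy; apply: open_nbhs_nbhs; split=> //; exact: regopens_open.
Qed.

End RegularOpens.

Lemma prefixes_separate {K : eqType} (x : K -> nat -> bool) (S : seq K) :
  injective x -> exists n, {in S &, injective (fun k => mkseq (x k) n)}.
Proof.
move=> xinj.
have /choice[N NP] (p : K * K) : exists i, p.1 <> p.2 -> x p.1 i <> x p.2 i.
  have [e|/eqP e] := eqVneq p.1 p.2; first by exists 0%N.
  apply: contrapT => no; apply: e; apply: xinj; apply/funext => i.
  by apply: contrapT => ne; apply: no; exists i.
exists (\max_(p <- [seq (k, k') | k <- S, k' <- S]) N p).+1 => k k' kS k'S e.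
apply: contrapT => ne; apply: (NP (k, k') ne) => /=.
set m := (X in X.+1) in e.
have Nm : (N (k, k') < m.+1)%N.
  by rewrite ltnS; apply: leq_bigmax_seq => //; apply/allpairsP; exists (k, k').
by have := congr1 (fun s => nth false s (N (k, k'))) e; rewrite !nth_mkseq.
Qed.

(** The point whose [k]-th coordinate says whether a member of [l] is an initial
    segment of the real [x k]. *)
Definition prefix_point {K : Type} (x : K -> nat -> bool) (l : seq (seq bool)) :
  cantor_cube K := fun k => has (fun s => mkseq (x k) (size s) == s) l.

Lemma prefix_point_interpolates {K : eqType} (x : K -> nat -> bool) (S : seq K)
    (z : cantor_cube K) : injective x ->
  exists l, {in S, forall k, prefix_point x l k = z k}.
Proof.
move=> xinj; have [n sep] := prefixes_separate S xinj.
exists [seq mkseq (x k) n | k <- S & z k] => k kS; apply/hasP/idP => [|zk].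
  move=> [_ /mapP[k' + ->]]; rewrite mem_filter size_mkseq => /andP[zk' k'S] /eqP.
  by move=> /(sep _ _ kS k'S) ->.
exists (mkseq (x k) n); last by rewrite size_mkseq.
by apply/mapP; exists k; rewrite // mem_filter zk.
Qed.

(** Cubes of weight at most the continuum are separable: finitely many
    coordinates [k] are distinguished by initial segments of the reals [x k], so
    that a countable set of points takes all values on them. *)
Lemma prefix_points_dense {K : eqType} (x : K -> nat -> bool) (U : set (cantor_cube K)) :
  injective x -> open U -> U !=set0 -> exists l, U (prefix_point x l).
Proof.
move=> xinj oU [z Uz].
pose F : set_system (cantor_cube K) :=
  [set A | exists S : seq K, forall y, {in S, forall k, y k = z k} -> A y].
have FF : Filter F.
  split; first by exists [::].
  - move=> A B [S SA] [S' SB]; exists (S ++ S') => y yz.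
    by split; [apply: SA|apply: SB] => k kS; apply: yz; rewrite mem_cat kS ?orbT.
  - by move=> A B AB [S SA]; exists S => y /SA/AB.
have [S SU] : F U; last by have [l /SU] := prefix_point_interpolates S z xinj; exists l.
have Fz : F --> z.
  apply: cvg_prod_topology => k V _ Vz; exists [:: k] => y /(_ k (mem_head _ _)).
  by move=> /= ->.
by apply: Fz; exact: open_nbhs_nbhs.
Qed.

Lemma cantor_cube_power_set_retract (K : Type) : [set: K] #<= continuum ->
  power_set_retract (regopens (cantor_cube K)).
Proof.
move=> Kc; have [x [_ xinj]] := card_le_inj (fun=> true) Kc.
apply: (@separable_power_set_retract _
  (fun n => prefix_point x (odflt [::] (unpickle n)))) => U oU U0.
have xinj' : injective (x : {classic K} -> nat -> bool) by move=> k k'; exact: xinj.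
have [l Ul] := prefix_points_dense xinj' oU U0.
by exists (pickle l); rewrite pickleK.
Qed.

(** * Cohen-Parovicenko remainders *)

Theorem theorem6p8 (R : realType) (K : Type)
    (hK : [set: K]%classic #<= continuum) :
  cohen_parovicenko_space (stone_cech_remainder R (E_space K)) <->
  cohen_parovicenko_space (stone_cech_remainder R nat).
Proof.
have Cret := cantor_cube_power_set_retract hK.
have points c c0 := @power_set_retract_points _ (regopens (cantor_cube K)) c Cret c0.
have lub := @regopen_suprema (cantor_cube K).
have [qE qEP] := stone_remainder_reduced_power R points lub.
have zE := stone_remainder_zero_dimensional (R := R) points lub.
have [qN qNP] := nat_remainder_reduced_power R.
have zN := @nat_remainder_zero_dimensional R.
have iffE := cohen_parovicenko_iff qEP qNP Cret.
have iffN := cohen_parovicenko_iff qNP qNP bool_power_set_retract.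
by split=> -[_ cp]; split=> //; [apply/iffN/iffE|apply/iffE/iffN].
Qed.
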